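(* Let $(M,\mathbf m)$ be a smooth metric projective manifold of dimension $n\ge2$ with Weyl nullity (at every point) and $B$ smooth. Then there is a 1-parameter family of canonical tractor connections $$\nabla^{\mathcal T_t}:=\nabla^{\mathcal T}+t\,\Phi,\qquad t\in\mathbb R,$$ on the projective tractor bundle $\mathcal T$, where $\nabla^{\mathcal T}$ is the normal projective tractor connection and $\Phi$ is the $\operatorname{End}(\mathcal T)$-valued 1-form $\Phi^C{}_{Ba}=X^CZ_B{}^b\phi_{ab}$ constructed from the fundamental 2-tensor $\phi_{ab}$ of $(M,\mathbf m)$. (Canonical means determined by $(M,\mathbf m)$ alone. In the scale of a metric $g\in\mathbf m$, $$\nabla^{\mathcal T_t}_a\begin{pmatrix}\nu^b\\ \rho\end{pmatrix}=\begin{pmatrix}\nabla_a\nu^b+\rho\,\delta^b_a\\ \nabla_a\rho-\mathsf P_{ab}\nu^b+t\,\phi_{ab}\nu^b\end{pmatrix}.)$$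
   Context: Manifolds are smooth and connected; metrics have arbitrary signature; indices are abstract. Two metrics are projectively equivalent if they have the same geodesics up to reparametrisation; a metric projective structure $\mathbf m$ is an equivalence class of projectively equivalent metrics. For the Levi-Civita connection $\nabla$ of $g$: $[\nabla_\ell,\nabla_k]v^j=R^j{}_{i\ell k}v^i$, $R_{jk}=R^a{}_{jak}$, $\mathsf P_{jk}=\frac1{n-1}R_{jk}$, $\mathsf P^i{}_j=g^{ik}\mathsf P_{kj}$. The projective Weyl tensor $W^i{}_{jk\ell}=R^i{}_{jk\ell}+\delta^i_\ell\mathsf P_{jk}-\delta^i_k\mathsf P_{j\ell}$ is the same for all $g\in\mathbf m$. $(M,\mathbf m)$ has Weyl nullity if at every $x$ there is $0\ne v\in T_xM$ with $W^i{}_{jk\ell}v^j=0$. Then each $g\in\mathbf m$ determines a function $B=B^g$ by $\mathsf P^i{}_jv^j=Bv^i$ for all $v$ in the nullity. The fundamental 2-tensor is $\phi_{ab}=\mathsf P_{ab}-Bg_{ab}$, which does not depend on the choice of $g\in\mathbf m$. $\mathcal E(1)$ is the positive $(2n+2)$-nd root of $(\Lambda^nTM)^2$, $\mathcal E(w)$ its real powers, and $\mathcal B(w)=\mathcal B\otimes\mathcal E(w)$. The cotractor bundle $\mathcal T^*=\mathcal E_A$ is $J^1\mathcal E(1)$ and the tractor bundle $\mathcal T=\mathcal E^A$ is its dual (rank $n+1$). $X^A\in\Gamma(\mathcal E^A(1))$ is the jet projection $J^1\mathcal E(1)\to\mathcal E(1)$ and $Z_A{}^a:T^*M(1)\to\mathcal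 E_A$ is the inclusion of its kernel. A choice of $g\in\mathbf m$ splits $\mathcal T\cong TM(-1)\oplus\mathcal E(-1)$, and sections are written $(\nu^b,\rho)$; under a change to another Levi-Civita connection $\widehat\nabla$ of a metric in $\mathbf m$, with $\widehat\nabla_aY^b=\nabla_aY^b+\Upsilon_aY^b+\Upsilon_cY^c\delta^b_a$, the components become $(\nu^b,\rho-\Upsilon_b\nu^b)$. The normal tractor connection is $\nabla^{\mathcal T}_a(\nu^b,\rho)=(\nabla_a\nu^b+\rho\delta^b_a,\ \nabla_a\rho-\mathsf P_{ab}\nu^b)$. The notation $\nabla^{\mathcal T}+t\Phi$ means $V^C\mapsto\nabla^{\mathcal T}_aV^C+tV^B\Phi^C{}_{Ba}$. *)

(* Defs.v *)
From HB Require Import structures.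
From mathcomp Require Import all_boot all_order all_algebra.
From mathcomp Require Import all_classical all_reals all_analysis.
From mathcomp Require Import ring.

Set Implicit Arguments.
Unset Strict Implicit.
Unset Printing Implicit Defensive.

Import Order.TTheory GRing.Theory Num.Theory numFieldNormedType.Exports.
Local Open Scope classical_set_scope.
Local Open Scope ring_scope.

(* Neither manifolds nor bundles are in the library.  Here a field on a
   manifold M is given by its components: a function of a chart c, a point p
   of M and indices, meaningful only when p lies in the domain of c, together
   with the change-of-chart law.  Statements about fields therefore only ever
   look at points of the chart domain.                                        *)

Section Calculus.
Variables (R : realType) (n : nat).

Definition partial (i : 'I_n) (f : 'rV[R]_n -> R) : 'rV[R]_n -> R :=
  fun x => 'D_(delta_mx 0 i) f x.

(* C^oo on an open set: all iterated partial derivatives are (Frechet)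
   differentiable there, hence in particular continuous.                      *)
Definition smooth_on (D : set 'rV[R]_n) (f : 'rV[R]_n -> R) : Prop :=
  forall (s : seq 'I_n) x, D x -> differentiable (foldr partial f s) x.

End Calculus.

Record manifold (R : realType) (n : nat) := Manifold {
  point :> topologicalType;
  point_hausdorff : hausdorff_space point;
  point_second_countable : @second_countable point;
  point_connected : connected [set: point];
  chart : Type;
  cdom : chart -> set point;
  cmap : chart -> point -> 'rV[R]_n;
  cinv : chart -> 'rV[R]_n -> point;
  cdom_open : forall c, open (cdom c);
  cimg_open : forall c, open (cmap c @` cdom c);
  cmapK : forall c p, cdom c p -> cinv c (cmap c p) = p;
  cmap_continuous : forall c p, cdom c p -> {for p, continuous (cmap c)};
  cinv_continuous :
    forall c x, (cmap c @` cdom c) x -> {for x, continuous (cinv c)};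
  cdom_cover : forall p, exists c, cdom c p;
  transition_smooth : forall c d (k : 'I_n),
    smooth_on (cmap c @` (cdom c `&` cdom d))
              (fun x => cmap d (cinv c x) 0 k)
}.

Section Geometry.
Variables (R : realType) (n : nat) (M : manifold R n).

Implicit Types (c d : chart M) (p : M) (f : M -> R).

Definition smooth_in c (O : set M) f : Prop :=
  smooth_on (cmap c @` (O `&` cdom c)) (f \o cinv c).

Definition smooth_fun f : Prop := forall c, smooth_in c setT f.

(* the coordinate derivative  df/dx^i  in the chart c *)
Definition cder c (i : 'I_n) f : M -> R :=
  fun p => partial i (f \o cinv c) (cmap c p).

(* dy^k/dx^j  for the coordinates x of c and y of d *)
Definition jac c d p : 'M[R]_n :=
  \matrix_(k, j) cder c j (fun q => cmap d q 0 k) p.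

(** Pseudo-Riemannian metrics of arbitrary signature *)

Record metric := Metric {
  gcomp :> chart M -> M -> 'M[R]_n;
  metric_smooth : forall c i j, smooth_in c setT (fun p => gcomp c p i j);
  metric_sym : forall c p, cdom c p -> (gcomp c p)^T = gcomp c p;
  metric_nondeg : forall c p, cdom c p -> gcomp c p \in unitmx;
  metric_chart : forall c d p, cdom c p -> cdom d p ->
    gcomp c p = (jac c d p)^T *m gcomp d p *m jac c d p
}.

Implicit Type g : metric.

(* Gamma^b_{ac}, with nabla_a v^b = d_a v^b + Gamma^b_{ac} v^c *)
Definition christoffel g c (b a e : 'I_n) : M -> R := fun p =>
  2^-1 * \sum_(k < n) invmx (g c p) b k *
    (cder c a (fun q => g c q k e) p + cder c e (fun q => g c q k a) p
     - cder c k (fun q => g c q a e) p).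

(* Gamma^b_{ab}: the connection form induced on Lambda^n TM *)
Definition christoffel_tr g c (a : 'I_n) : M -> R := fun p =>
  \sum_(b < n) christoffel g c b a b p.

(* Levi-Civita derivative nabla_a of densities of weight w and of vector
   fields of weight w.  E(1) is a (2n+2)-nd root of (Lambda^n TM)^2, so the
   connection form of Lambda^n TM enters with the factor w / (n + 1).         *)
Definition nabla_dens g (w : R) c (a : 'I_n) (s : M -> R) : M -> R := fun p =>
  cder c a s p + w / n.+1%:R * christoffel_tr g c a p * s p.

Definition nabla_vect g (w : R) c (a : 'I_n) (v : 'I_n -> M -> R)
    : 'I_n -> M -> R := fun b p =>
  cder c a (v b) p + \sum_(e < n) christoffel g c b a e p * v e p
  + w / n.+1%:R * christoffel_tr g c a p * v b p.

(* R^j_{ilk}, read off from [nabla_l, nabla_k] applied to the coordinate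
   vector field d/dx^i (coordinate fields commute).                           *)
Definition riemann g c (j i l k : 'I_n) : M -> R := fun p =>
  let di : 'I_n -> M -> R := fun b _ => (b == i)%:R in
  nabla_vect g 0 c l (nabla_vect g 0 c k di) j p
  - nabla_vect g 0 c k (nabla_vect g 0 c l di) j p.

Definition ricci g c (j k : 'I_n) : M -> R := fun p =>
  \sum_(a < n) riemann g c a j a k p.

Definition schouten g c p : 'M[R]_n :=
  \matrix_(j, k) ((n%:R - 1)^-1 * ricci g c j k p).

(* P^i_j = g^{ik} P_{kj} *)
Definition schouten_up g c p : 'M[R]_n := invmx (g c p) *m schouten g c p.

(* W^i_{jkl} *)
Definition weyl g c (i j k l : 'I_n) : M -> R := fun p =>
  riemann g c i j k l p + (i == l)%:R * schouten g c p j k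
  - (i == k)%:R * schouten g c p j l.

(** Projective equivalence *)

(* gamma is an affinely parametrised geodesic of g on the interval I.  It is
   asked to be twice differentiable, which is what the equation needs;
   solutions are then automatically smooth.                                   *)
Definition geodesic g (I : set R) (gamma : R -> M) : Prop :=
  (forall t, I t -> {for t, continuous gamma}) /\
  forall c t, I t -> cdom c (gamma t) ->
    let x (b : 'I_n) : R -> R := fun u => cmap c (gamma u) 0 b in
    (forall b, derivable (x b) t 1 /\ derivable (derive1 (x b)) t 1) /\
    forall b, derive1 (derive1 (x b)) t + \sum_(a < n) \sum_(e < n)
      christoffel g c b a e (gamma t) * derive1 (x a) t * derive1 (x e) t = 0.

Definition open_interval (I : set R) : Prop := open I /\ is_interval I.

Definition reparametrisation (J I : set R) (s : R -> R) : Prop :=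
  set_bij J I s /\
  forall t, J t -> [/\ derivable s t 1, derivable (derive1 s) t 1 & derive1 s t != 0].

Definition geodesics_reparam g h : Prop :=
  forall (I : set R) (gamma : R -> M), open_interval I -> geodesic g I gamma ->
  exists J s, [/\ open_interval J, reparametrisation J I s
                & geodesic h J (gamma \o s)].

Definition proj_equiv g h : Prop :=
  geodesics_reparam g h /\ geodesics_reparam h g.

Definition metric_projective_structure (m : set metric) : Prop :=
  exists g, m = [set h | proj_equiv g h].

(** Weyl nullity, the function B and the fundamental 2-tensor *)

(* v = components in the chart c of a tangent vector at p *)
Definition nullity g c p (v : 'cV[R]_n) : Prop :=
  forall i k l, \sum_(j < n) weyl g c i j k l p * v j 0 = 0.

Definition weyl_nullity (m : set metric) : Prop :=
  forall g, m g -> forall c p, cdom c p -> exists2 v, v != 0 & nullity g c p v.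

(* the number B with P^i_j v^j = B v^i for all v in the nullity at p *)
Definition Bfun g : M -> R := fun p =>
  xget 0 [set b | forall c, cdom c p -> forall v, nullity g c p v ->
                    schouten_up g c p *m v = b *: v].

Definition phi_of g c p : 'M[R]_n := schouten g c p - Bfun g p *: g c p.

Definition fundamental_tensor (m : set metric)
    (phi : chart M -> M -> 'M[R]_n) : Prop :=
  forall g, m g -> forall c p, cdom c p -> phi c p = phi_of g c p.

(** The projective tractor bundle *)

(* Sections of E(w) over an open set O.  Sections of Lambda^n TM change by
   det (dy/dx), so those of the positive root E(w) of (Lambda^n TM)^2 change
   by |det (dy/dx)| ^ (w / (n + 1)).                                          *)
Definition density_on (w : R) (O : set M) (s : chart M -> M -> R) : Prop :=
  (forall c, smooth_in c O (s c)) /\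
  forall c d p, O p -> cdom c p -> cdom d p ->
    s d p = `|\det (jac c d p)| `^ (w / n.+1%:R) * s c p.

(* Tractor indices: the components of the 1-jet of s in the chart c are
   s (index None) and d_a s (index Some a).                                   *)
Definition jet1 (s : chart M -> M -> R) c p (A : option 'I_n) : R :=
  if A is Some a then cder c a (s c) p else s c p.

(* Components V^A w.r.t. the basis of T = (J^1 E(1))^* dual to that of jet1.  *)
Definition tfield := chart M -> M -> option 'I_n -> R.

Definition pairing (V : option 'I_n -> R) (s : chart M -> M -> R) c p : R :=
  \sum_(A : option 'I_n) V A * jet1 s c p A.

(* Smooth sections of T, the dual of the bundle of 1-jets of sections of E(1):
   the pairing with the 1-jet of any local section of E(1) is well defined.   *)
Definition tractor_field (V : tfield) : Prop :=
  (forall c A, smooth_in c setT (fun p => V c p A)) /\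
  forall (O : set M) s, open O -> density_on 1 O s ->
  forall c d p, O p -> cdom c p -> cdom d p ->
    pairing (V c p) s c p = pairing (V d p) s d p.

(* T-valued 1-forms; the last but one argument is the form index *)
Definition tform := chart M -> M -> 'I_n -> option 'I_n -> R.

Definition tractor_form (F : tform) : Prop :=
  (forall c a A, smooth_in c setT (fun p => F c p a A)) /\
  forall (O : set M) s, open O -> density_on 1 O s ->
  forall c d p a, O p -> cdom c p -> cdom d p ->
    pairing (F c p a) s c p
    = \sum_(b < n) jac c d p b a * pairing (F d p b) s d p.

Definition tractor_connection (D : tfield -> tform) : Prop :=
  [/\ forall V, tractor_field V -> tractor_form (D V),
      forall V W, tractor_field V -> tractor_field W ->
        (forall c p, cdom c p -> V c p = W c p) ->
        forall c p, cdom c p -> D V c p = D W c p,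
      forall V W, tractor_field V -> tractor_field W ->
        forall c p a A, cdom c p ->
        D (fun c p A => V c p A + W c p A) c p a A
        = D V c p a A + D W c p a A
    & forall f V, smooth_fun f -> tractor_field V ->
        forall c p a A, cdom c p ->
        D (fun c p A => f p * V c p A) c p a A
        = cder c a f p * V c p A + f p * D V c p a A].

(* The components (nu^b, rho) of a tractor in the splitting
   T = TM(-1) + E(-1) determined by g, i.e. dual to the splitting
   j^1 s |-> (nabla_a s, s) of J^1 E(1); see pairing_scale.                   *)
Definition nu (V : tfield) c (b : 'I_n) : M -> R := fun p => V c p (Some b).

Definition rho g (V : tfield) c : M -> R := fun p =>
  V c p None
  - \sum_(a < n) 1 / n.+1%:R * christoffel_tr g c a p * V c p (Some a).

Lemma pairing_option (V : option 'I_n -> R) s c p :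
  pairing V s c p
  = V None * s c p + \sum_(a < n) V (Some a) * cder c a (s c) p.
Proof.
rewrite /pairing (bigD1 None)//=; congr (_ + _).
rewrite (reindex_omap Some id) => [|[a|]//].
by apply: eq_bigl => a; rewrite /= eqxx.
Qed.

Lemma pairing_scale g (V : tfield) s c p :
  pairing (V c p) s c p
  = \sum_(a < n) nu V c a p * nabla_dens g 1 c a (s c) p + rho g V c p * s c p.
Proof.
rewrite pairing_option /nu /rho /nabla_dens mulrBl addrCA mulr_suml -sumrB.
by congr (_ + _); apply: eq_bigr => a _; ring.
Qed.

(* In the scale of g,
   D_a (nu^b, rho) = (nabla_a nu^b + rho delta^b_a,
                      nabla_a rho - P_ab nu^b + t phi_ab nu^b).               *)
Definition in_scale g (t : R) (D : tfield -> tform) : Prop :=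
  forall V, tractor_field V -> forall c p a, cdom c p ->
  let DaV : tfield := fun c p => D V c p a in
  (forall b, nu DaV c b p
     = nabla_vect g (-1) c a (nu V c) b p + rho g V c p * (b == a)%:R) /\
  rho g DaV c p
    = nabla_dens g (-1) c a (rho g V c) p
      - \sum_(b < n) schouten g c p a b * nu V c b p
      + t * \sum_(b < n) phi_of g c p a b * nu V c b p.

Definition normal_tractor_connection (m : set metric) (D : tfield -> tform) :=
  tractor_connection D /\ forall g, m g -> in_scale g 0 D.

(* X^A (weight 1): the jet projection J^1 E(1) -> E(1), in components *)
Definition tX (A : option 'I_n) : R := (A == None)%:R.

(* Z_A^a: the inclusion T^*M(1) -> J^1 E(1) of its kernel, in components *)
Definition tZ (A : option 'I_n) (a : 'I_n) : R := (A == Some a)%:R.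

Lemma tXE s c p : pairing tX s c p = s c p.
Proof.
by rewrite pairing_option big1 ?addr0 /tX ?mul1r// => a _; rewrite mul0r.
Qed.

Lemma tZE s c p A : s c p = 0 ->
  jet1 s c p A = \sum_(a < n) tZ A a * cder c a (s c) p.
Proof.
case: A => [a _|s0] /=; last by rewrite big1// => a _; rewrite /tZ mul0r.
rewrite (bigD1 a)//= /tZ eqxx mul1r big1 ?addr0// => b ba.
by rewrite [_ == _](negbTE _) ?mul0r// eq_sym; apply: contra ba => /eqP[->].
Qed.

(* Phi^C_{Ba} = X^C Z_B^b phi_ab *)
Definition Phi (phi : chart M -> M -> 'M[R]_n) c p
    (C B : option 'I_n) (a : 'I_n) : R :=
  tX C * \sum_(b < n) tZ B b * phi c p a b.

(* D + t F : V^C |-> D_a V^C + t V^B F^C_{Ba} *)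
Definition add_form (D : tfield -> tform) (t : R)
    (F : chart M -> M -> option 'I_n -> option 'I_n -> 'I_n -> R)
    : tfield -> tform := fun V c p a C =>
  D V c p a C + t * \sum_(B : option 'I_n) V c p B * F c p C B a.

Definition same_connection (D D' : tfield -> tform) : Prop :=
  forall V, tractor_field V -> forall c p a A, cdom c p ->
  D V c p a A = D' V c p a A.

End Geometry.

(* Main.v *)
(* The first point is Weyl's theorem: projectively equivalent metrics have
   Christoffel symbols that differ by Upsilon_a delta^b_c + Upsilon_c delta^b_a.
   Since projective equivalence is stated through geodesics, this needs a geodesic
   of g in every direction at every point (Picard iteration); reparametrising it
   to a geodesic of h shows that the difference of the Christoffel symbols, as a
   quadratic form in the velocity, is a multiple of the velocity.  The curvature
   then changes by delta_k psi_l - delta_l psi_k, the Schouten tensor by - psi and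
   the Weyl tensor not at all.

   If v is a nonzero nullity vector, the symmetries of the Riemann tensor of g
   give P_jk v^k = B v_j and W^i_jkl v^k = - v^i phi_jl.  So v and the invariant W
   determine phi, which is therefore the same for all metrics of the class.

   The formula for the normal connection in the scale of g defines a connection:
   pairing with enough local densities turns the definition of a tractor field
   into the rule that (nu, rho) transforms as a weighted vector and a density,
   and covariance follows from the transformation rules of Christoffel symbols
   and Schouten tensor.  The psi of the curvature change cancels the derivatives of
   Upsilon in rho - Upsilon_b nu^b, so the formula holds in all scales.  Adding
   t Phi only involves the invariant tensor phi, and the formula in one scale
   determines the connection. *)
Require Import Defs.
From HB Require Import structures.
From mathcomp Require Import all_boot all_order all_algebra.
From mathcomp Require Import all_classical all_reals all_analysis.
From mathcomp Require Import perm ring lra.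

Set Implicit Arguments.
Unset Strict Implicit.
Unset Printing Implicit Defensive.

Import Order.TTheory GRing.Theory Num.Theory numFieldNormedType.Exports.
Local Open Scope classical_set_scope.
Local Open Scope ring_scope.

(** * Calculus on open subsets of R^n *)

(** In a chart the Levi-Civita connection is a family of matrices A_k acting on column vectors, and
    the Jacobian J of two charts acts on it as a gauge transformation: J A_k = d_k J + A'_k J.
    Expanding the Christoffel symbols to prove this law would be laborious; it comes instead from
    the uniqueness of the torsion-free connection that preserves g. Its derivative is the tensor law
    of the curvature, and its trace matches the derivative of log |det J|, which is how the weights
    of densities fit in.

    Upsilon is the difference of the traces of the two connections divided by n + 1, because
    Upsilon_a delta^b_c + Upsilon_c delta^b_a has trace (n + 1) Upsilon_a over b = c. The curvature
    of a metric is trace-free, so these traces are closed and Upsilon is closed. This makes psi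
    symmetric and removes the multiple of delta^i_j from the change of the curvature.

    Components satisfy their laws only on chart domains. A law that is to be differentiated at p is
    therefore first established at all points near p. *)

Lemma near_eq_differentiable (R : realType) (V W : normedModType R)
    (f g : V -> W) (x : V) :
  {near x, f =1 g} -> differentiable f x -> differentiable g x.
Proof.
move=> fg df.
have fgx := nbhs_singleton fg.
suff [dc e] : continuous ('d f x) /\ g \o shift x = cst (g x) + 'd f x +o_ 0 id.
  by apply/diff_locallyP; rewrite (diff_unique dc e).
split; first exact: diff_continuous.
apply/eqaddoP => e e0.
have /eqaddoP/(_ e e0) := diff_locally df.
have : \forall h \near (0 : V), f (h + x) = g (h + x).
  by move: fg; rewrite (near_shift 0); apply: filterS => h; rewrite /= subr0.
move=> fgh; apply: filter_app; near=> h.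
by rewrite /= !fctE /= -fgx (near fgh h).
Unshelve. all: by end_near. Qed.

Section Partial.
Variables (R : realType) (n : nat).
Implicit Types (f g : 'rV[R]_n -> R) (x : 'rV[R]_n).

Lemma partialE f x i : differentiable f x -> partial i f x = 'd f x (delta_mx 0 i).
Proof. by move=> df; rewrite /partial deriveE. Qed.

Lemma diff_partial f x h : differentiable f x ->
  'd f x h = \sum_(i < n) h 0 i * partial i f x.
Proof.
move=> df; rewrite {1}(row_sum_delta h) linear_sum.
by apply: eq_bigr => i _; rewrite linearZ /= partialE.
Qed.

Lemma near_partial f g x i : {near x, f =1 g} -> partial i f x = partial i g x.
Proof. by move=> fg; apply: near_eq_derive. Qed.

Lemma partialD f g x i : differentiable f x -> differentiable g x ->
  partial i (fun y => f y + g y) x = partial i f x + partial i g x.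
Proof. by move=> df dg; rewrite /partial deriveD//; exact: diff_derivable. Qed.

Lemma partialM f g x i : differentiable f x -> differentiable g x ->
  partial i (fun y => f y * g y) x = partial i f x * g x + f x * partial i g x.
Proof.
move=> df dg; rewrite /partial deriveM; try exact: diff_derivable.
by rewrite addrC [in LHS]/GRing.scale /= mulrC.
Qed.

Lemma partial_cst (a : R) x i : partial i (fun=> a) x = 0.
Proof. exact: derive_cst. Qed.

Lemma partial_coord x (i k : 'I_n) :
  partial i (fun y => y 0 k) x = (k == i)%:R.
Proof.
have @l : {linear 'rV[R]_n -> R}.
  by exists (fun N : 'rV[R]_n => N 0 k); do 2![eexists]; do ?[constructor];
     rewrite ?mxE// => ? *; rewrite ?mxE//; move=> ?; rewrite !mxE.
have -> : (fun y : 'rV[R]_n => y 0 k) = l by [].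
rewrite partialE; last exact/linear_differentiable/coord_continuous.
by rewrite diff_lin /=; [rewrite mxE eqxx | exact/coord_continuous].
Qed.

Lemma differentiable_funM f g x : differentiable f x -> differentiable g x ->
  differentiable (fun y => f y * g y) x.
Proof. by move=> df dg; exact: differentiableM. Qed.

Lemma differentiable_funD f g x : differentiable f x -> differentiable g x ->
  differentiable (fun y => f y + g y) x.
Proof. by move=> df dg; exact: differentiableD. Qed.

Lemma differentiable_comp1 (h : R -> R) f x :
  differentiable f x -> derivable h (f x) 1 -> differentiable (fun y => h (f y)) x.
Proof. by move=> df /derivable1_diffP dh; exact: differentiable_comp. Qed.

Lemma partial_comp1 (h : R -> R) f x i (dh : R) :
  differentiable f x -> is_derive (f x) 1 h dh ->
  partial i (fun y => h (f y)) x = dh * partial i f x.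
Proof.
move=> df hd; have [dhx hE] := hd.
have dh' : differentiable h (f x) by apply/derivable1_diffP.
have dc : differentiable (h \o f) x := differentiable_comp df dh'.
rewrite (partialE i dc) (diff_comp df dh') /=.
have -> : 'd f x (delta_mx 0 i) = partial i f x *: (1 : R).
  by rewrite -(partialE i df) /GRing.scale /= mulr1.
have -> : 'd h (f x) (partial i f x *: (1 : R)) = partial i f x *: 'd h (f x) (1 : R).
  exact: linearZ.
by rewrite -(deriveE _ dh') hE mulrC.
Qed.

(* C^k in the form suited to induction on k *)
Fixpoint Csm (k : nat) (D : set 'rV[R]_n) f : Prop :=
  (forall x, D x -> differentiable f x) /\
  if k is k'.+1 then forall i, Csm k' D (partial i f) else True.

Lemma Csm_diff k D f x : Csm k D f -> D x -> differentiable f x.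
Proof. by case: k => [|k] [+ _] => /[apply]. Qed.

Lemma CsmW k D f : Csm k.+1 D f -> Csm k D f.
Proof.
elim: k f => [|k IH] f [df dp]; split => // i.
exact: IH.
Qed.

(** [foldr] applies the last index of the list first, so [rcons] peels off the innermost derivative,
    just as the recursion of [Csm] does. *)
Lemma smooth_onP D f : smooth_on D f <-> forall k, Csm k D f.
Proof.
split=> [sf k|sf s x Dx].
  elim: k f sf => [|k IH] f sf; split=> //; try exact: (sf [::]).
  move=> i; apply: IH => s x Dx.
  by have := sf (rcons s i) x Dx; rewrite foldr_rcons.
elim/last_ind: s f sf => [|s i IH] f sf; first exact: (Csm_diff (sf 0%N)).
rewrite foldr_rcons; apply: IH => k.
by have [_] := sf k.+1; exact.
Qed.

Variables (D : set 'rV[R]_n) (oD : open D).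

Lemma near_open x (P : 'rV[R]_n -> Prop) : D x -> (forall y, D y -> P y) ->
  \forall y \near x, P y.
Proof.
move=> Dx DP; have : nbhs x D by exact: open_nbhs_nbhs.
by apply: filterS.
Qed.

Lemma Csm_ext k f g : (forall x, D x -> f x = g x) -> Csm k D f -> Csm k D g.
Proof.
elim: k f g => [|k IH] f g fg [df dp]; split=> //.
- by move=> x Dx; apply: near_eq_differentiable (df x Dx); exact: near_open.
- by move=> x Dx; apply: near_eq_differentiable (df x Dx); exact: near_open.
- move=> i; apply: IH (dp i) => x Dx; apply: near_partial; exact: near_open.
Qed.

Lemma Csm_cst k (a : R) : Csm k D (fun=> a).
Proof.
elim: k a => [|k IH] a; split=> //; try by move=> x _; exact: differentiable_cst.
move=> i; apply: Csm_ext (IH 0) => x Dx; by rewrite partial_cst.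
Qed.

Lemma CsmD k f g : Csm k D f -> Csm k D g -> Csm k D (fun x => f x + g x).
Proof.
elim: k f g => [|k IH] f g [df pf] [dg pg]; split=> //.
- by move=> x Dx; apply: differentiable_funD; [exact: df|exact: dg].
- by move=> x Dx; apply: differentiable_funD; [exact: df|exact: dg].
- move=> i; apply: Csm_ext (IH _ _ (pf i) (pg i)) => x Dx.
  by rewrite partialD//; [exact: df|exact: dg].
Qed.

Lemma CsmM k f g : Csm k D f -> Csm k D g -> Csm k D (fun x => f x * g x).
Proof.
elim: k f g => [|k IH] f g sf sg; have [df pf] := sf; have [dg pg] := sg; split=> //.
- by move=> x Dx; apply: differentiable_funM; [exact: df|exact: dg].
- by move=> x Dx; apply: differentiable_funM; [exact: df|exact: dg].
- move=> i; apply: Csm_ext (CsmD (IH _ _ (pf i) (CsmW sg)) (IH _ _ (CsmW sf) (pg i))).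
  by move=> x Dx; rewrite partialM//; [exact: df|exact: dg].
Qed.

Lemma is_derive_inv (a : R) : a != 0 -> is_derive a 1 (fun y => y^-1) (- (a^-1 * a^-1)).
Proof.
move=> a0; apply: DeriveDef; first exact: (@derivableV _ _ id).
by rewrite (@deriveV _ _ id)// derive_id /GRing.scale /= mulr1 expr2 invfM.
Qed.

(** The derivative - f^-1 f^-1 df involves the inverse itself, but only to one order less, where the
    induction hypothesis applies. *)
Lemma CsmV k f : (forall x, D x -> f x != 0) -> Csm k D f -> Csm k D (fun x => (f x)^-1).
Proof.
move=> f0; elim: k => [|k IH] sf; have [df pf] := sf; split=> //.
- move=> x Dx; apply: (differentiable_comp1 (h := fun y => y^-1)) (df x Dx) _.
  by have [] := is_derive_inv (f0 x Dx).
- move=> x Dx; apply: (differentiable_comp1 (h := fun y => y^-1)) (df x Dx) _.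
  by have [] := is_derive_inv (f0 x Dx).
- move=> i; have sV := IH (CsmW sf).
  apply: Csm_ext (CsmM (CsmM (Csm_cst k (-1)) (CsmM sV sV)) (pf i)) => x Dx.
  by rewrite (partial_comp1 i (df x Dx) (is_derive_inv (f0 x Dx))) mulN1r.
Qed.

End Partial.

(** * Real powers of absolute values *)

Section PowR.
Variables (R : realType).

(** Passing to the positive number u^2 treats both signs of u at once and leaves a composite of
    differentiable functions. *)
Lemma abs_powR_sq (u w : R) : u != 0 -> `|u| `^ w = (u * u) `^ (w / 2).
Proof.
move=> u0; rewrite -(ger0_norm (_ : 0 <= u * u)); last by rewrite -expr2 sqr_ge0.
rewrite normrM powRM// -powRD -?splitr// .
by rewrite normr_eq0 u0 implybT.
Qed.

Lemma is_derive_abs_powR (a w : R) : a != 0 ->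
  is_derive a 1 (fun y => `|y| `^ w) (w * `|a| `^ w * a^-1).
Proof.
move=> a0; have aa0 : 0 < a * a by rewrite -expr2 exprn_even_gt0.
have d2 : is_derive a 1 (fun y : R => y * y) (a + a).
  have [d v] := @is_deriveM _ _ id id a 1 1 1 _ _.
  by apply: DeriveDef => //; rewrite v /GRing.scale /= !mulr1.
have dp : is_derive (a * a) 1 (fun z : R => z `^ (w / 2))
                    (w / 2 * (a * a) `^ (w / 2 - 1)).
  exact: is_derive1_powR.
apply: (@near_eq_is_derive _ _ _ (fun y : R => (y * y) `^ (w / 2))).
  have : \forall y \near a, y != 0 by exact: (@cvgr_neq0 _ _ _ _ _ id a cvg_id a0).
  by apply: filterS => y y0; rewrite abs_powR_sq.
have H := @is_derive1_comp _ (fun z => z `^ (w / 2)) (fun y => y * y) a _ _ dp d2.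
apply: is_derive_eq H _.
rewrite powRB; last by rewrite mulf_neq0// implybT.
rewrite powRr1 ?ltW// abs_powR_sq//; field.
by [].
Qed.

End PowR.

(** * Smoothness of powers, curves and mixed partial derivatives *)

Section Partial2.
Variables (R : realType) (n : nat).
Implicit Types (f g : 'rV[R]_n -> R) (x : 'rV[R]_n) (D : set 'rV[R]_n).

Lemma Csm_abs_powR D (oD : open D) w k f : (forall x, D x -> f x != 0) ->
  Csm k D f -> Csm k D (fun x => `|f x| `^ w).
Proof.
move=> f0; elim: k => [|k IH] sf; have [df pf] := sf; split=> //.
- move=> x Dx; apply: (differentiable_comp1 (h := fun y => `|y| `^ w)) (df x Dx) _.
  by have [] := is_derive_abs_powR w (f0 x Dx).
- move=> x Dx; apply: (differentiable_comp1 (h := fun y => `|y| `^ w)) (df x Dx) _.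
  by have [] := is_derive_abs_powR w (f0 x Dx).
- move=> i; have sP := IH (CsmW sf).
  apply: (Csm_ext oD) (CsmM oD (CsmM oD (CsmM oD (Csm_cst oD k w) sP)
    (CsmV oD f0 (CsmW sf))) (pf i)) => x Dx.
  by rewrite (partial_comp1 i (df x Dx) (is_derive_abs_powR w (f0 x Dx))).
Qed.

Lemma is_derive_curve f (c : R -> 'rV[R]_n) t (v : 'I_n -> R) :
  differentiable f (c t) -> (forall k, is_derive t 1 (fun u => c u 0 k) (v k)) ->
  is_derive t 1 (fun u => f (c u)) (\sum_(k < n) v k * partial k f (c t)).
Proof.
move=> df dc.
have dct : derivable c t 1.
  by apply/derivable_mxP => i j; rewrite ord1; have [] := dc j.
have dcd : differentiable c t by apply/derivable1_diffP.
have dfc : differentiable (f \o c) t := differentiable_comp dcd df.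
apply: DeriveDef; first exact/derivable1_diffP.
rewrite (deriveE (1 : R) dfc) (diff_comp dcd df) /= -(deriveE (1 : R) dcd) (diff_partial _ df).
apply: eq_bigr => k _; congr (_ * _).
by rewrite derive_mx// mxE; have [_ ->] := dc k.
Qed.

Lemma is_derive_line f x i (s : R) : differentiable f (s *: delta_mx 0 i + x) ->
  is_derive s 1 (fun u => f (u *: delta_mx 0 i + x)) (partial i f (s *: delta_mx 0 i + x)).
Proof.
move=> df.
have := @is_derive_curve f (fun u => u *: delta_mx 0 i + x) s (fun k => (k == i)%:R) df.
move=> H; apply: is_derive_eq.
  apply: H => k.
  rewrite [X in is_derive _ _ X](_ : _ = fun u : R => u * (k == i)%:R + x 0 k); last first.
    by apply/funext => u; rewrite !mxE eqxx.
  apply: is_derive_eq; rewrite addr0 /GRing.scale /= mulr1 mulr0 add0r //.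
rewrite (bigD1 i)//= eqxx mul1r big1 ?addr0// => k /negbTE ->.
by rewrite mul0r.
Qed.

(* The second difference is symmetric in i and j, whence the equality of mixed
   partial derivatives. *)
Lemma second_difference f x (i j : 'I_n) :
  (\forall y \near x, differentiable f y) -> differentiable (partial i f) x ->
  forall e : R, 0 < e -> \forall h \near 0^'+,
  `|f (h *: delta_mx 0 i + (h *: delta_mx 0 j + x)) - f (h *: delta_mx 0 i + x)
    - f (h *: delta_mx 0 j + x) + f x - h ^+ 2 * partial j (partial i f) x|
   <= e * h ^+ 2.
Proof.
move=> nf dG e e0; set G := partial i f.
(* The expansion of the derivative is used at displacements of norm at most 2 h and h, so an error
   rate of e / 3 adds up to e h. *)
have /eqaddoP/(_ (e / 3)) := diff_locally dG; rewrite divr_gt0// => /(_ isT).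
rewrite -/G => /nbhs_normP[r /= r0 Hr].
have /nbhs_normP[q /= q0 Hq] := nf.
near=> h.
have h0 : 0 < h by [].
have h2 : h <= h * 2 by lra.
have [hr hq] : h * 2 < r /\ h * 2 < q.
  by split; rewrite -ltr_pdivlMr//; near: h; apply: nbhs_right_lt; rewrite divr_gt0.
have nd (k : 'I_n) : `|delta_mx 0 k : 'rV[R]_n| <= 1.
  rewrite [leLHS]/Num.Def.normr/= mx_normrE; apply: bigmax_le => // -[a b] _.
  by rewrite mxE; case: (_ && _); rewrite /= ?normr1 ?normr0.
have nz (a : R) (k : 'I_n) : 0 <= a -> a <= h -> `|a *: delta_mx 0 k : 'rV[R]_n| <= h.
  move=> a0 ah; rewrite normrZ ger0_norm//.
  by rewrite -[h]mulr1 ler_pM.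
have nz2 (a : R) : 0 <= a -> a <= h -> `|a *: delta_mx 0 i + h *: delta_mx 0 j : 'rV[R]_n| <= h * 2.
  move=> a0 ah; apply: le_trans (ler_normD _ _) _.
  by rewrite mulr_natr mulr2n lerD// nz// ltW.
have d1 (a : R) : 0 <= a -> a <= h -> differentiable f (a *: delta_mx 0 i + (h *: delta_mx 0 j + x)).
  move=> a0 ah; apply: Hq => /=; rewrite addrA distrC addrK.
  exact: le_lt_trans (nz2 _ a0 ah) hq.
have d0 (a : R) : 0 <= a -> a <= h -> differentiable f (a *: delta_mx 0 i + x).
  move=> a0 ah; apply: Hq => /=; rewrite distrC addrK.
  by apply: le_lt_trans (nz _ i a0 ah) _; apply: le_lt_trans hq; exact: h2.
(* The second difference is the increment over [0, h] of the difference of f along two parallel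
   segments in direction i. The mean value theorem turns it into h times a difference of values of
   the i-th derivative. *)
pose phi := fun s : R => f (s *: delta_mx 0 i + (h *: delta_mx 0 j + x)) - f (s *: delta_mx 0 i + x).
pose dphi := fun s : R => G (s *: delta_mx 0 i + (h *: delta_mx 0 j + x)) - G (s *: delta_mx 0 i + x).
have dphiP s : 0 <= s -> s <= h -> is_derive s 1 phi (dphi s).
  move=> s0 sh; apply: is_deriveB; apply: is_derive_line.
    exact: d1.
  exact: d0.
have [||xi /[!in_itv]/= /andP[xi0 xih] E] := @MVT _ phi dphi 0 h h0.
- by move=> s /[!in_itv]/= /andP[s0 sh]; apply: dphiP; exact: ltW.
- apply: derivable_within_continuous => s /[!in_itv]/= /andP[s0 sh].
  by have [] := dphiP s s0 sh.
have -> : f (h *: delta_mx 0 i + (h *: delta_mx 0 j + x)) - f (h *: delta_mx 0 i + x)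
    - f (h *: delta_mx 0 j + x) + f x = dphi xi * h.
  by move: E; rewrite /phi subr0 !scale0r !add0r => <-; ring.
have P1 := Hr (xi *: delta_mx 0 i + h *: delta_mx 0 j).
have P0 := Hr (xi *: delta_mx 0 i).
rewrite /= !fctE /= !add0r !normrN in P1 P0.
have {}P1 := P1 (le_lt_trans (nz2 _ (ltW xi0) (ltW xih)) hr).
have {}P0 : `|G (xi *: delta_mx 0 i + x) - (G x + 'd G x (xi *: delta_mx 0 i))| <= e / 3 * `|xi *: delta_mx 0 i : 'rV[R]_n|.
  apply: P0; apply: le_lt_trans (nz _ i (ltW xi0) (ltW xih)) _; apply: le_lt_trans hr.
  exact: h2.
have E2 : dphi xi - h * partial j G x =
   (G (xi *: delta_mx 0 i + h *: delta_mx 0 j + x) - (G x + 'd G x (xi *: delta_mx 0 i + h *: delta_mx 0 j)))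
   - (G (xi *: delta_mx 0 i + x) - (G x + 'd G x (xi *: delta_mx 0 i))).
  rewrite /dphi (partialE j dG) addrA.
  have -> : 'd G x (xi *: delta_mx 0 i + h *: delta_mx 0 j)
    = 'd G x (xi *: delta_mx 0 i) + h * 'd G x (delta_mx 0 j).
    by rewrite linearD; congr (_ + _); rewrite linearZ.
  by ring.
have -> : dphi xi * h - h ^+ 2 * partial j G x = (dphi xi - h * partial j G x) * h by ring.
rewrite normrM (gtr0_norm h0) expr2 mulrA ler_pM2r// E2.
apply: le_trans (ler_normB _ _) _.
have -> : e * h = e / 3 * (h * 2) + e / 3 * h by field.
apply: lerD.
  by apply: le_trans P1 _; rewrite ler_pM2l ?divr_gt0// nz2 ?ltW.
by apply: le_trans P0 _; rewrite ler_pM2l ?divr_gt0// nz ?ltW.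
Unshelve. all: by end_near. Qed.

Lemma partial_partialC f x (i j : 'I_n) :
  (\forall y \near x, differentiable f y) ->
  differentiable (partial i f) x -> differentiable (partial j f) x ->
  partial i (partial j f) x = partial j (partial i f) x.
Proof.
move=> nf di dj; apply/subr0_eq/eqP; rewrite -normr_le0; apply/ler_addgt0Pr => e e0.
have e2 : 0 < e / 2 by rewrite divr_gt0.
have HA := @second_difference f x i j nf di _ e2.
have HB := @second_difference f x j i nf dj _ e2.
have [h [h0 [A B]]] := filter_ex (filterI (nbhs_right_gt (0 : R)) (filterI HA HB)).
move: {HA HB} A B => /= A B.
have hh : 0 < h ^+ 2 by rewrite exprn_gt0.
rewrite add0r -(ler_pM2r hh) -{1}(gtr0_norm hh) -normrM.
move: A B; rewrite [h *: delta_mx 0 j + (_ + x)]addrCA.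
set a := f _; set b := f _; set c := f _; set d := f x; set p := partial j _ x; set q := partial i _ x.
move=> A B.
have -> : (q - p) * h ^+ 2
    = (a - b - c + d - h ^+ 2 * p) - (a - c - b + d - h ^+ 2 * q) by ring.
rewrite [e]splitr mulrDl.
exact: le_trans (ler_normB _ _) (lerD A B).
Qed.
End Partial2.

Opaque partial.

(** * Fields on a manifold *)

Section Chain.
Variables (R : realType) (n m : nat).

Lemma differentiable_rV (T : 'rV[R]_n -> 'rV[R]_m) x :
  (forall k, differentiable (fun y => T y 0 k) x) -> differentiable T x.
Proof.
move=> dT.
have -> : T = \sum_(k < m) (fun y => T y 0 k *: delta_mx 0 k).
  by apply/funext => y; rewrite fct_sumE [LHS]row_sum_delta.
apply: differentiable_sum => k.
exact: (@differentiableZl _ _ _ (fun y => T y 0 k)).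
Qed.

Lemma partial_chain (F : 'rV[R]_m -> R) (T : 'rV[R]_n -> 'rV[R]_m) x :
  differentiable F (T x) -> (forall k, differentiable (fun y => T y 0 k) x) ->
  differentiable (fun y => F (T y)) x /\ forall i,
  partial i (fun y => F (T y)) x
  = \sum_(k < m) partial i (fun y => T y 0 k) x * partial k F (T x).
Proof.
move=> dF dT; have dTx := differentiable_rV dT.
have dFT : differentiable (F \o T) x := differentiable_comp dTx dF.
split=> // i.
rewrite (partialE i dFT) (diff_comp dTx dF) /= (diff_partial _ dF).
apply: eq_bigr => k _; congr (_ * _).
rewrite -(deriveE _ dTx) derive_mx ?mxE//; exact: diff_derivable.
Qed.
End Chain.

Section Fields.
Variables (R : realType) (n : nat) (M : manifold R n).
Implicit Types (c d e : chart M) (p q : M) (f g : M -> R) (O : set M).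

Definition dif c p f := differentiable (f \o cinv c) (cmap c p).

Lemma cmap_cinv c x : (cmap c @` cdom c) x -> cmap c (cinv c x) = x.
Proof. by move=> [p cp <-]; rewrite cmapK. Qed.

Lemma near_cinv c p (P : M -> Prop) : cdom c p -> (\forall q \near p, P q) ->
  \forall y \near cmap c p, P (cinv c y).
Proof.
move=> cp nP.
have := @cinv_continuous _ _ _ c (cmap c p) (ex_intro2 _ _ p cp erefl).
by move=> H; apply: H; rewrite cmapK.
Qed.

Lemma near_cdom c p : cdom c p -> \forall q \near p, cdom c q.
Proof. by move=> cp; apply: open_nbhs_nbhs; split; [exact: cdom_open|]. Qed.

Lemma near_img c p : cdom c p -> \forall y \near cmap c p, (cmap c @` cdom c) y.
Proof.
by move=> cp; apply: open_nbhs_nbhs; split; [exact: cimg_open | exists p].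
Qed.

Lemma open_sdom c O : open O -> open (cmap c @` (O `&` cdom c)).
Proof.
move=> oO; rewrite openE => x [p [Op cp] <-].
have nO : \forall q \near p, O q by exact: open_nbhs_nbhs.
have A := near_cinv cp nO.
have B := near_img cp.
rewrite /interior; near=> y.
have [q cq qy] : (cmap c @` cdom c) y by near: y.
have Oy : O (cinv c y) by near: y.
by exists q => //; split=> //; rewrite -(cmapK cq) qy.
Unshelve. all: by end_near. Qed.

Lemma cder_ext c i f g p : cdom c p -> (\forall q \near p, f q = g q) ->
  cder c i f p = cder c i g p.
Proof. by move=> cp fg; apply: near_partial; exact: (near_cinv cp fg). Qed.

Lemma dif_ext c f g p : cdom c p -> (\forall q \near p, f q = g q) ->
  dif c p f -> dif c p g.
Proof.
by move=> cp fg; apply: near_eq_differentiable; exact: (near_cinv cp fg).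
Qed.

Lemma eq_cder c i f g p : f =1 g -> cder c i f p = cder c i g p.
Proof. by move=> /funext ->. Qed.

Lemma dif_cst c p a : dif c p (fun=> a).
Proof. exact: differentiable_cst. Qed.

Lemma difD c p f g : dif c p f -> dif c p g -> dif c p (fun q => f q + g q).
Proof. exact: differentiable_funD. Qed.

Lemma difM c p f g : dif c p f -> dif c p g -> dif c p (fun q => f q * g q).
Proof. exact: differentiable_funM. Qed.

Lemma dif_sum c p (I : Type) (r : seq I) (P : pred I) (F : I -> M -> R) :
  (forall i, P i -> dif c p (F i)) -> dif c p (fun q => \sum_(i <- r | P i) F i q).
Proof.
move=> dF; elim: r => [|i r IH].
  have -> : (fun q => \sum_(i <- [::] | P i) F i q) = fun=> 0.
    by apply/funext => q; rewrite big_nil.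
  exact: dif_cst.
case Pi : (P i).
  have -> : (fun q => \sum_(i <- i :: r | P i) F i q)
      = fun q => F i q + \sum_(i <- r | P i) F i q.
    by apply/funext => q; rewrite big_cons Pi.
  by apply: difD => //; exact: dF.
have -> // : (fun q => \sum_(i <- i :: r | P i) F i q)
      = fun q => \sum_(i <- r | P i) F i q.
by apply/funext => q; rewrite big_cons Pi.
Qed.

Lemma cder_cst c i p a : cder c i (fun=> a) p = 0.
Proof. exact: partial_cst. Qed.

Lemma cderD c i p f g : dif c p f -> dif c p g ->
  cder c i (fun q => f q + g q) p = cder c i f p + cder c i g p.
Proof. exact: partialD. Qed.

Lemma cderM c i p f g : cdom c p -> dif c p f -> dif c p g ->
  cder c i (fun q => f q * g q) p = cder c i f p * g p + f p * cder c i g p.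
Proof.
by move=> cp df dg; have := partialM i df dg; rewrite /= cmapK.
Qed.

Lemma cder_sum c i p (I : Type) (r : seq I) (P : pred I) (F : I -> M -> R) :
  (forall i, P i -> dif c p (F i)) ->
  cder c i (fun q => \sum_(i <- r | P i) F i q) p
  = \sum_(j <- r | P j) cder c i (F j) p.
Proof.
move=> dF; elim: r => [|j r IH].
  have -> : (fun q => \sum_(i <- [::] | P i) F i q) = fun=> 0.
    by apply/funext => q; rewrite big_nil.
  by rewrite big_nil cder_cst.
rewrite big_cons -IH; case Pj : (P j).
  have -> : (fun q => \sum_(i <- j :: r | P i) F i q)
      = fun q => F j q + \sum_(i <- r | P i) F i q.
    by apply/funext => q; rewrite big_cons Pj.
  by rewrite cderD//; [exact: dF | exact: dif_sum].
by apply: eq_cder => q; rewrite big_cons Pj.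
Qed.

Lemma cder_comp1 (h : R -> R) c i p f dh : cdom c p -> dif c p f ->
  is_derive (f p) 1 h dh -> cder c i (fun q => h (f q)) p = dh * cder c i f p.
Proof.
move=> cp df hd; apply: partial_comp1 => //=; by rewrite cmapK.
Qed.

Lemma smooth_inP c O f : smooth_in c O f <->
  forall k, Csm k (cmap c @` (O `&` cdom c)) (f \o cinv c).
Proof. exact: smooth_onP. Qed.

Lemma smooth_dif c O f p : smooth_in c O f -> O p -> cdom c p -> dif c p f.
Proof. by move=> sf Op cp; apply: (sf [::]); exists p. Qed.

Section Smooth.
Variables (c : chart M) (O : set M) (oO : open O).

Lemma smooth_ext f g : (forall p, O p -> cdom c p -> f p = g p) ->
  smooth_in c O f -> smooth_in c O g.
Proof.
move=> fg /smooth_inP sf; apply/smooth_inP => k.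
apply: (Csm_ext (open_sdom (c:=c) oO)) (sf k) => x [p [Op cp] <-] /=.
by rewrite cmapK// fg.
Qed.

Lemma smooth_cst a : smooth_in c O (fun=> a).
Proof. by apply/smooth_inP => k; exact: (Csm_cst (open_sdom (c:=c) oO)). Qed.

Lemma smoothD f g : smooth_in c O f -> smooth_in c O g ->
  smooth_in c O (fun p => f p + g p).
Proof.
move=> /smooth_inP sf /smooth_inP sg; apply/smooth_inP => k.
exact: (CsmD (open_sdom (c:=c) oO) (sf k) (sg k)).
Qed.

Lemma smoothM f g : smooth_in c O f -> smooth_in c O g ->
  smooth_in c O (fun p => f p * g p).
Proof.
move=> /smooth_inP sf /smooth_inP sg; apply/smooth_inP => k.
exact: (CsmM (open_sdom (c:=c) oO) (sf k) (sg k)).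
Qed.

Lemma smoothN f : smooth_in c O f -> smooth_in c O (fun p => - f p).
Proof.
move=> sf; apply: smooth_ext (smoothM (smooth_cst (-1)) sf) => p _ _.
by rewrite mulN1r.
Qed.

Lemma smoothB f g : smooth_in c O f -> smooth_in c O g ->
  smooth_in c O (fun p => f p - g p).
Proof. by move=> sf sg; apply: smoothD => //; exact: smoothN. Qed.

Lemma smooth_sum (I : Type) (r : seq I) (P : pred I) (F : I -> M -> R) :
  (forall i, smooth_in c O (F i)) ->
  smooth_in c O (fun q => \sum_(i <- r | P i) F i q).
Proof.
move=> sF; elim: r => [|i r IH].
  by apply: smooth_ext (smooth_cst 0) => p _ _; rewrite big_nil.
case Pi : (P i).
  by apply: smooth_ext (smoothD (sF i) IH) => p _ _; rewrite big_cons Pi.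
by apply: smooth_ext IH => p _ _; rewrite big_cons Pi.
Qed.

Lemma smooth_prod (I : Type) (r : seq I) (P : pred I) (F : I -> M -> R) :
  (forall i, smooth_in c O (F i)) ->
  smooth_in c O (fun q => \prod_(i <- r | P i) F i q).
Proof.
move=> sF; elim: r => [|i r IH].
  by apply: smooth_ext (smooth_cst 1) => p _ _; rewrite big_nil.
case Pi : (P i).
  by apply: smooth_ext (smoothM (sF i) IH) => p _ _; rewrite big_cons Pi.
by apply: smooth_ext IH => p _ _; rewrite big_cons Pi.
Qed.

Lemma smoothV f : (forall p, O p -> cdom c p -> f p != 0) -> smooth_in c O f ->
  smooth_in c O (fun p => (f p)^-1).
Proof.
move=> f0 /smooth_inP sf; apply/smooth_inP => k.
apply: (CsmV (open_sdom (c:=c) oO)) (sf k) => x [p [Op cp] <-] /=.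
by rewrite cmapK// f0.
Qed.

Lemma smooth_abs_powR w f : (forall p, O p -> cdom c p -> f p != 0) ->
  smooth_in c O f -> smooth_in c O (fun p => `|f p| `^ w).
Proof.
move=> f0 /smooth_inP sf; apply/smooth_inP => k.
apply: (Csm_abs_powR (open_sdom (c:=c) oO)) (sf k) => x [p [Op cp] <-] /=.
by rewrite cmapK// f0.
Qed.

Lemma smooth_det k (A : M -> 'M[R]_k) :
  (forall i j, smooth_in c O (fun p => A p i j)) ->
  smooth_in c O (fun p => \det (A p)).
Proof.
move=> sA; rewrite /determinant; apply: smooth_sum => s.
by apply: smoothM; [exact: smooth_cst | exact: smooth_prod].
Qed.

(** By Cramer's rule an entry of the inverse is a cofactor divided by the determinant. *)
Lemma smooth_invmx k (A : M -> 'M[R]_k) i j :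
  (forall p, O p -> cdom c p -> A p \in unitmx) ->
  (forall i j, smooth_in c O (fun p => A p i j)) ->
  smooth_in c O (fun p => invmx (A p) i j).
Proof.
move=> uA sA.
have sV : smooth_in c O (fun p => (\det (A p))^-1).
  apply: smoothV; last exact: smooth_det.
  by move=> p Op cp; have := uA p Op cp; rewrite unitmxE unitfE.
have sC : smooth_in c O (fun p => \adj (A p) i j).
  suff : smooth_in c O (fun p => cofactor (A p) j i).
    by apply: smooth_ext => p _ _; rewrite mxE.
  rewrite /cofactor; apply: smoothM; first exact: smooth_cst.
  apply: smooth_det => a b.
  by apply: smooth_ext (sA (lift j a) (lift i b)) => p _ _; rewrite !mxE.
apply: smooth_ext (smoothM sV sC) => p Op cp.
by rewrite /invmx uA// [RHS]mxE.
Qed.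

Lemma smooth_cder i f : smooth_in c O f -> smooth_in c O (cder c i f).
Proof.
move=> sf; have H : smooth_on (cmap c @` (O `&` cdom c)) (partial i (f \o cinv c)).
  by move=> s x Dx; have := sf (rcons s i) x Dx; rewrite foldr_rcons.
apply/smooth_inP => k; move/smooth_onP : H => /(_ k).
apply: (Csm_ext (open_sdom (c:=c) oO)) => x [p [Op cp] <-] /=.
by rewrite /cder cmapK.
Qed.

Lemma cderC i j f p : smooth_in c O f -> O p -> cdom c p ->
  cder c i (cder c j f) p = cder c j (cder c i f) p.
Proof.
move=> sf Op cp.
have nf : \forall y \near cmap c p, differentiable (f \o cinv c) y.
  by apply: (near_open (open_sdom (c:=c) oO)); [exists p|move=> y; exact: (sf [::])].
have dp k : differentiable (partial k (f \o cinv c)) (cmap c p).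
  by apply: (sf [:: k]); exists p.
have E a b : cder c a (cder c b f) p = partial a (partial b (f \o cinv c)) (cmap c p).
  apply: near_partial; apply: (near_open (open_sdom (c:=c) oO)); first by exists p.
  by move=> y [q [Oq cq] <-] /=; rewrite /cder cmapK.
by rewrite !E partial_partialC.
Qed.

End Smooth.

Lemma smooth_transition c d k : smooth_in c (cdom d) (fun p => cmap d p 0 k).
Proof. by rewrite /smooth_in setIC; exact: transition_smooth. Qed.

(** Near the image of p the expression of f in c is its expression in d composed with the transition
    map; they differ away from the overlap of the two domains. *)
Lemma cder_chain c d p f : cdom c p -> cdom d p -> dif d p f ->
  dif c p f /\
  forall a, cder c a f p = \sum_(b < n) jac c d p b a * cder d b f p.
Proof.
move=> cp dp df.
have dT k : differentiable (fun y => cmap d (cinv c y) 0 k) (cmap c p).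
  exact: (smooth_dif (@smooth_transition c d k) dp cp).
have dF : differentiable (f \o cinv d) (cmap d (cinv c (cmap c p))) by rewrite cmapK.
have [H1 H2] := partial_chain dF dT.
have nE : \forall y \near cmap c p, (f \o cinv d) (cmap d (cinv c y)) = (f \o cinv c) y.
  have := near_cinv cp (near_cdom dp); apply: filterS => y dy /=.
  by rewrite cmapK.
split; first exact: near_eq_differentiable nE H1.
move=> a; rewrite /cder -(near_partial a nE) H2.
by apply: eq_bigr => b _; rewrite mxE cmapK.
Qed.

Lemma dif_chart c d p f : cdom c p -> cdom d p -> dif d p f -> dif c p f.
Proof. by move=> cp dp /(cder_chain cp dp) []. Qed.

Lemma cder_chart c d p f a : cdom c p -> cdom d p -> dif d p f ->
  cder c a f p = \sum_(b < n) jac c d p b a * cder d b f p.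
Proof. by move=> cp dp /(cder_chain cp dp) []. Qed.

Lemma cder_coord c k j p : cdom c p -> cder c j (fun q => cmap c q 0 k) p = (k == j)%:R.
Proof.
move=> cp; rewrite -(@partial_coord _ _ (cmap c p)); apply: near_partial.
by have := near_img cp; apply: filterS => y /cmap_cinv /= ->.
Qed.

Lemma jacE c d p k j : jac c d p k j = cder c j (fun q => cmap d q 0 k) p.
Proof. by rewrite mxE. Qed.

Lemma jac_cocycle c d e p : cdom c p -> cdom d p -> cdom e p ->
  jac c e p = jac d e p *m jac c d p.
Proof.
move=> cp dp ep; apply/matrixP => i j; rewrite !mxE.
rewrite (@cder_chart c d)//; last exact: smooth_dif (@smooth_transition d e i) ep dp.
by apply: eq_bigr => k _; rewrite mulrC !mxE.
Qed.

Lemma jac_id c p : cdom c p -> jac c c p = 1%:M.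
Proof. by move=> cp; apply/matrixP => i j; rewrite !mxE cder_coord. Qed.

Lemma jacK c d p : cdom c p -> cdom d p -> jac d c p *m jac c d p = 1%:M.
Proof. by move=> cp dp; rewrite -(jac_cocycle (d := d))// jac_id. Qed.

Lemma jac_unit c d p : cdom c p -> cdom d p -> jac c d p \in unitmx.
Proof. by move=> cp dp; have /mulmx1_unit [] := jacK cp dp. Qed.

Lemma jac_inv c d p : cdom c p -> cdom d p -> invmx (jac c d p) = jac d c p.
Proof.
move=> cp dp; rewrite -[RHS](mulmxK (jac_unit cp dp)).
by rewrite jacK// mul1mx.
Qed.

Lemma smooth_jac c d i j : smooth_in c (cdom d) (fun p => jac c d p i j).
Proof.
apply: (smooth_ext (cdom_open d)) (smooth_cder (cdom_open d) j (@smooth_transition c d i)).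
by move=> p dp cp; rewrite mxE.
Qed.

Lemma cder_jacC c d k l i p : cdom c p -> cdom d p ->
  cder c l (fun q => jac c d q i k) p = cder c k (fun q => jac c d q i l) p.
Proof.
move=> cp dp.
have E a b : cder c a (fun q => jac c d q i b) p
    = cder c a (cder c b (fun q => cmap d q 0 i)) p.
  by apply: eq_cder => q; rewrite mxE.
by rewrite !E (cderC (cdom_open d) _ _ (@smooth_transition c d i)).
Qed.

End Fields.

Opaque cder jac.

(** * Levi-Civita connection and curvature in charts *)

HB.lock Definition dmx (R : realType) (n : nat) (M : manifold R n) (c : chart M)
    (k : 'I_n) a b (A : M -> 'M[R]_(a, b)) (p : M) : 'M[R]_(a, b) :=
  \matrix_(i, j) cder c k (fun q => A q i j) p.

(* The matrix A_k of the connection: nabla_k v = d_k v + A_k v on column vectors. *)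
HB.lock Definition conn (R : realType) (n : nat) (M : manifold R n) (g : metric M)
    (c : chart M) (k : 'I_n) (p : M) : 'M[R]_n :=
  \matrix_(b, e) christoffel g c b k e p.

Section MatrixFields.
Variables (R : realType) (n : nat) (M : manifold R n).
Implicit Types (c d e : chart M) (p q : M) (f : M -> R) (O : set M).

Lemma near_cdom2 c d p (P : M -> Prop) : cdom c p -> cdom d p ->
  (forall q, cdom c q -> cdom d q -> P q) -> \forall q \near p, P q.
Proof.
move=> cp dp cdP.
have n1 := near_cdom cp; have n2 := near_cdom dp.
by near=> q; apply: cdP; near: q.
Unshelve. all: by end_near. Qed.

Lemma dmxE c k a b (A : M -> 'M[R]_(a, b)) p i j :
  dmx c k A p i j = cder c k (fun q => A q i j) p.
Proof. by rewrite dmx.unlock mxE. Qed.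

Definition difmx c p a b (A : M -> 'M[R]_(a, b)) :=
  forall i j, dif c p (fun q => A q i j).

Definition smoothmx c O a b (A : M -> 'M[R]_(a, b)) :=
  forall i j, smooth_in c O (fun q => A q i j).

Section Rules.
Variables (c : chart M) (p : M) (cp : cdom c p).

Lemma smooth_difmx O a b (A : M -> 'M[R]_(a, b)) : smoothmx c O A -> O p -> difmx c p A.
Proof. by move=> sA Op i j; exact: smooth_dif (sA i j) Op cp. Qed.

Lemma smooth_dmx O k a b (A : M -> 'M[R]_(a, b)) : open O -> smoothmx c O A ->
  smoothmx c O (dmx c k A).
Proof.
move=> oO sA i j; apply: (smooth_ext oO) (smooth_cder oO k (sA i j)) => q _ _.
by rewrite dmxE.
Qed.

Lemma dmx_ext k a b (A B : M -> 'M[R]_(a, b)) : (\forall q \near p, A q = B q) ->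
  dmx c k A p = dmx c k B p.
Proof.
move=> AB; apply/matrixP => i j; rewrite !dmxE; apply: cder_ext => //.
by apply: filterS AB => q ->.
Qed.

Lemma dmxD k a b (A B : M -> 'M[R]_(a, b)) : difmx c p A -> difmx c p B ->
  dmx c k (fun q => A q + B q) p = dmx c k A p + dmx c k B p.
Proof.
move=> dA dB; apply/matrixP => i j; rewrite [RHS]mxE !dmxE -cderD//.
by apply: eq_cder => q; rewrite mxE.
Qed.

Lemma difmxM a b s (A : M -> 'M[R]_(a, b)) (B : M -> 'M[R]_(b, s)) :
  difmx c p A -> difmx c p B -> difmx c p (fun q => A q *m B q).
Proof.
move=> dA dB i j; apply: (@dif_ext _ _ _ c (fun q => \sum_k A q i k * B q k j)) => //.
  by near=> q; rewrite mxE.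
by apply: dif_sum => k _; exact: difM.
Unshelve. all: by end_near. Qed.

Lemma dmxM k a b s (A : M -> 'M[R]_(a, b)) (B : M -> 'M[R]_(b, s)) :
  difmx c p A -> difmx c p B ->
  dmx c k (fun q => A q *m B q) p = dmx c k A p *m B p + A p *m dmx c k B p.
Proof.
move=> dA dB; apply/matrixP => i j.
rewrite dmxE (_ : (fun q => _) = fun q => \sum_k A q i k * B q k j); last first.
  by apply/funext => q; rewrite mxE.
rewrite cder_sum; last by move=> l _; exact: difM.
rewrite !mxE -big_split; apply: eq_bigr => l _ /=.
by rewrite cderM// !dmxE.
Qed.

Lemma dmxT k a b (A : M -> 'M[R]_(a, b)) :
  dmx c k (fun q => (A q)^T) p = (dmx c k A p)^T.
Proof.
apply/matrixP => i j; rewrite [RHS]mxE !dmxE; apply: eq_cder => q.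
by rewrite mxE.
Qed.

Lemma difmxT a b (A : M -> 'M[R]_(a, b)) : difmx c p A -> difmx c p (fun q => (A q)^T).
Proof.
move=> dA i j; rewrite (_ : (fun q => _) = fun q => A q j i)//.
by apply/funext => q; rewrite mxE.
Qed.

End Rules.

Lemma dmx_chart c d p k a b (A : M -> 'M[R]_(a, b)) : cdom c p -> cdom d p ->
  difmx d p A -> dmx c k A p = \sum_(m < n) jac c d p m k *: dmx d m A p.
Proof.
move=> cp dp dA; apply/matrixP => i j; rewrite dmxE (cder_chart _ cp dp)// summxE.
by apply: eq_bigr => m _; rewrite [RHS]mxE dmxE.
Qed.

Lemma difmx_chart c d p a b (A : M -> 'M[R]_(a, b)) : cdom c p -> cdom d p ->
  difmx d p A -> difmx c p A.
Proof. by move=> cp dp dA i j; exact: dif_chart (dA i j). Qed.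

End MatrixFields.

Ltac mxring := apply/matrixP => ? ?; rewrite !mxE; ring.

Section LeviCivita.
Variables (R : realType) (n : nat) (M : manifold R n).
Implicit Types (c d e : chart M) (p q : M) (g h : metric M).

Lemma connE g c (k : 'I_n) p b l : conn g c k p b l = christoffel g c b k l p.
Proof. by rewrite conn.unlock mxE. Qed.

Lemma metric_smoothmx g c : smoothmx c setT (g c).
Proof. by move=> i j; exact: metric_smooth. Qed.

Lemma metric_symE g c p i j : cdom c p -> g c p i j = g c p j i.
Proof. by move=> cp; rewrite -{1}(Defs.metric_sym g cp) mxE. Qed.

Lemma cder_metric_sym g c k i j p : cdom c p ->
  cder c k (fun q => g c q i j) p = cder c k (fun q => g c q j i) p.
Proof.
move=> cp; apply: cder_ext => //; have := near_cdom cp.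
by apply: filterS => q cq; exact: metric_symE.
Qed.

Lemma smooth_christoffel g c (b a l : 'I_n) : smooth_in c setT (christoffel g c b a l).
Proof.
have oT : open (setT : set M) by exact: openT.
rewrite /christoffel; apply: (smoothM oT); first exact: smooth_cst.
apply: (smooth_sum oT) => k; apply: (smoothM oT).
  apply: (smooth_invmx oT); last by move=> i j; exact: metric_smooth.
  by move=> p _ cp; exact: metric_nondeg.
have sg i j : smooth_in c setT (fun q => g c q i j) by exact: metric_smooth.
by apply: (smoothB oT); [apply: (smoothD oT)|]; apply: smooth_cder.
Qed.

Lemma smooth_conn g c k : smoothmx c setT (conn g c k).
Proof.
move=> i j; rewrite (_ : (fun q => _) = christoffel g c i k j).
  exact: smooth_christoffel.
by apply/funext => q; rewrite connE.
Qed.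

Lemma conn_sym g c k l p i : cdom c p -> conn g c k p i l = conn g c l p i k.
Proof.
move=> cp; rewrite !connE /christoffel; congr (_ * _); apply: eq_bigr => m _.
by rewrite (cder_metric_sym _ _ k l)// [in RHS]addrAC addrAC -!addrA; congr (_ * _); ring.
Qed.

Lemma conn_low g c k p i j : cdom c p ->
  (g c p *m conn g c k p) i j
  = 2^-1 * (cder c k (fun q => g c q i j) p + cder c j (fun q => g c q i k) p
            - cder c i (fun q => g c q k j) p).
Proof.
move=> cp; set t : 'cV[R]_n := \col_l (2^-1 * (cder c k (fun q => g c q l j) p
  + cder c j (fun q => g c q l k) p - cder c l (fun q => g c q k j) p)).
transitivity ((g c p *m (invmx (g c p) *m t)) i 0).
  rewrite mxE [RHS]mxE; apply: eq_bigr => b _; rewrite connE !mxE; congr (_ * _).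
  rewrite /christoffel mulr_sumr; apply: eq_bigr => l _; rewrite mxE; ring.
by rewrite mulKVmx ?metric_nondeg// mxE.
Qed.

Lemma conn_metric g c k p : cdom c p ->
  dmx c k (g c) p = (conn g c k p)^T *m g c p + g c p *m conn g c k p.
Proof.
move=> cp; apply/matrixP => i j.
rewrite -{1}(Defs.metric_sym g cp) -trmx_mul [RHS]mxE [in RHS]mxE !conn_low// dmxE.
rewrite (cder_metric_sym _ _ j i)// (cder_metric_sym _ _ j k)//.
by rewrite (cder_metric_sym _ _ k i)//; field.
Qed.

(** Lower the difference to C_k = G (A_k - B_k). Compatibility with G makes C k i j skew in i, j and
    the absence of torsion makes it symmetric in k, j; alternating the two symmetries returns to C k
    i j with the opposite sign. *)
Lemma levi_civita_unique (G : 'M[R]_n) (A B : 'I_n -> 'M[R]_n) :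
  G \in unitmx -> G^T = G ->
  (forall k l i, A k i l = A l i k) -> (forall k l i, B k i l = B l i k) ->
  (forall k, (A k)^T *m G + G *m A k = (B k)^T *m G + G *m B k) ->
  forall k, A k = B k.
Proof.
move=> uG sG tA tB mAB k.
pose C k := G *m (A k - B k).
have Csk m i j : C m i j = - C m j i.
  have : C m + (C m)^T = 0.
    have tB' : (A m - B m)^T = (A m)^T - (B m)^T by rewrite linearB.
    rewrite /C trmx_mul sG tB' mulmxBr mulmxBl.
    by apply/eqP; rewrite addrACA -opprD subr_eq0 addrC mAB addrC.
  by move/matrixP/(_ i j)/eqP; rewrite !mxE addr_eq0 => /eqP.
have Csy m i j : C m i j = C j i m.
  rewrite /C !mulmxBr !mxE; congr (_ - _); apply: eq_bigr => b _; congr (_ * _).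
    exact: tA.
  exact: tB.
have C0 : C k = 0.
  apply/matrixP => i j; rewrite [RHS]mxE.
  have : C k i j = - C k i j.
    by rewrite {1}Csk Csy Csk opprK Csy Csk Csy.
  by move/eqP; rewrite -addr_eq0 -mulr2n mulrn_eq0 /= => /eqP.
apply/subr0_eq; rewrite -[LHS](mulKmx uG).
by rewrite -/(C k) C0 mulmx0.
Qed.

Section ChartChange.
Variables (g : metric M) (c d : chart M).
Local Notation J := (jac c d).
Implicit Types k l : 'I_n.

(* the connection matrices of g in the chart d, as a form in the chart c *)
Definition pconn k p : 'M[R]_n := \sum_(m < n) J p m k *: conn g d m p.

Variables (p : M) (cp : cdom c p) (dp : cdom d p).

Lemma dif_jac : difmx c p J.
Proof. by move=> i j; apply: (smooth_dif (@smooth_jac _ _ _ c d i j)). Qed.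

Lemma dif_conn e k : cdom e p -> difmx e p (conn g e k).
Proof. by move=> ep; exact: (smooth_difmx ep (@smooth_conn g e k)). Qed.

Lemma pconn_sym k l i : (pconn k p *m J p) i l = (pconn l p *m J p) i k.
Proof.
rewrite /pconn !mulmx_suml !summxE.
under eq_bigr => m _ do rewrite -scalemxAl mxE [X in _ * X]mxE mulr_sumr.
under [RHS]eq_bigr => m _ do rewrite -scalemxAl mxE [X in _ * X]mxE mulr_sumr.
rewrite exchange_big; apply: eq_bigr => m _; apply: eq_bigr => a _.
by rewrite (conn_sym _ a)//; ring.
Qed.

Lemma dmx_jac_sym a b m : dmx c a J p m b = dmx c b J p m a.
Proof.
transitivity (cder c a (fun q => J q m b) p); first exact: dmxE.
by rewrite (@cder_jacC _ _ _ c d b a m p cp dp) dmxE.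
Qed.

(* J^-1 (dJ + pconn J) is torsion free and preserves g in the chart c, so it is the
   Levi-Civita connection of g there. *)
Lemma conn_chart k : J p *m conn g c k p = dmx c k J p + pconn k p *m J p.
Proof.
have uJ := jac_unit cp dp.
pose A k := invmx (J p) *m (dmx c k J p + pconn k p *m J p).
suff -> : conn g c k p = A k by rewrite mulKVmx.
apply: (@levi_civita_unique _ (fun k => conn g c k p) A (metric_nondeg g cp)).
- exact: Defs.metric_sym.
- by move=> a b i; rewrite (conn_sym _ a).
- move=> a b i; rewrite /A !mxE; apply: eq_bigr => m _; congr (_ * _).
  rewrite mxE pconn_sym [RHS]mxE; congr (_ + _).
  exact: dmx_jac_sym.
move=> a; rewrite -conn_metric//.
(* Preservation of g: differentiate g_c = J^T g_d J and insert the compatibility of g_d with its own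
   connection. *)
have nG : \forall q \near p, g c q = (J q)^T *m (g d q *m J q).
  apply: (near_cdom2 cp dp) => q cq dq.
  by rewrite (metric_chart g cq dq) mulmxA.
have dG : difmx d p (g d) by exact: (smooth_difmx dp (@metric_smoothmx g d) I).
have dGc : difmx c p (g d) := difmx_chart cp dp dG.
rewrite (dmx_ext cp a nG) dmxM//; first last.
- by apply: difmxM => //; exact: dif_jac.
- by apply: difmxT; exact: dif_jac.
rewrite dmxM//; last exact: dif_jac.
rewrite dmxT (dmx_chart a cp dp dG).
have -> : \sum_(m < n) J p m a *: dmx d m (g d) p
    = (pconn a p)^T *m g d p + g d p *m pconn a p.
  rewrite /pconn linear_sum mulmx_suml mulmx_sumr -big_split; apply: eq_bigr => m _ /=.
  by rewrite conn_metric// linearZ /= scalerDr scalemxAl scalemxAr.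
have JA : J p *m A a = dmx c a J p + pconn a p *m J p by rewrite /A mulKVmx.
have AJ : (A a)^T *m (J p)^T = (dmx c a J p)^T + (J p)^T *m (pconn a p)^T.
  by rewrite -trmx_mul JA linearD /= trmx_mul.
clearbody A; rewrite (metric_chart g cp dp) !mulmxA AJ -[_ *m A a]mulmxA JA.
rewrite !(mulmxDl, mulmxDr) !mulmxA.
mxring.
Qed.

End ChartChange.

(** The curvature dA + A wedge A of the connection matrices on the coordinate fields l, k. Its
    matrix indices are the first two indices of the Riemann tensor. *)
Definition curv g c (l k : 'I_n) p : 'M[R]_n :=
  dmx c l (conn g c k) p - dmx c k (conn g c l) p
  + conn g c l p *m conn g c k p - conn g c k p *m conn g c l p.

Lemma riemannE g c j i l k p : riemann g c j i l k p = curv g c l k p j i.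
Proof.
have E a : nabla_vect g 0 c a (fun b _ => (b == i)%:R) = fun b => christoffel g c b a i.
  apply/funext => b; apply/funext => q; rewrite /nabla_vect cder_cst add0r.
  rewrite !mul0r addr0 (bigD1 i)//= eqxx mulr1 big1 ?addr0// => m /negbTE ->.
  by rewrite mulr0.
rewrite /riemann !E /nabla_vect !mul0r !addr0 /curv !mxE.
have F a : (fun q => conn g c a q j i) = christoffel g c j a i.
  by apply/funext => q; rewrite connE.
rewrite !dmxE !F -!addrA; congr (_ + _); rewrite opprD addrCA; congr (_ + (_ - _)).
  by apply: eq_bigr => m _; rewrite !connE.
by apply: eq_bigr => m _; rewrite !connE.
Qed.

(** * Curvature under a change of chart *)

Section CurvatureChart.
Variables (g : metric M) (c d : chart M) (p : M) (cp : cdom c p) (dp : cdom d p).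
Local Notation J := (jac c d).
Implicit Types k l : 'I_n.

Lemma dmx_jacC k l : dmx c l (dmx c k J) p = dmx c k (dmx c l J) p.
Proof.
apply/matrixP => i j.
have E a b : dmx c a (dmx c b J) p i j = cder c a (cder c b (fun q => J q i j)) p.
  have E2 : (fun q => dmx c b J q i j) = cder c b (fun q => J q i j).
    by apply/funext => q; exact: dmxE.
  exact: etrans (dmxE c a (dmx c b J) p i j) (congr1 (fun F => cder c a F p) E2).
exact: etrans (E l k) (etrans (@cderC _ _ _ c _ (cdom_open d) l k _ p
  (@smooth_jac _ _ _ c d i j) dp cp) (esym (E k l))).
Qed.

Lemma dif_pconn k : difmx c p (pconn g c d k).
Proof.
move=> i j.
have -> : (fun q => pconn g c d k q i j)
  = fun q => \sum_(m < n) J q m k * conn g d m q i j.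
  by apply/funext => q; rewrite summxE; apply: eq_bigr => m _; rewrite mxE.
apply: dif_sum => m _; apply: difM; first exact: dif_jac.
by apply: (dif_chart cp dp); exact: dif_conn.
Qed.

Lemma dmx_pconn k l : dmx c l (pconn g c d k) p
  = \sum_(m < n) (dmx c l J p m k *: conn g d m p
     + \sum_(r < n) (J p m k * J p r l) *: dmx d r (conn g d m) p).
Proof.
apply/matrixP => i j; rewrite dmxE summxE.
have -> : (fun q => pconn g c d k q i j)
  = fun q => \sum_(m < n) J q m k * conn g d m q i j.
  by apply/funext => q; rewrite summxE; apply: eq_bigr => m _; rewrite mxE.
have dc m : dif d p (fun q => conn g d m q i j) by exact: dif_conn.
rewrite cder_sum; last first.
  move=> m _; apply: difM; first exact: dif_jac.
  exact: (dif_chart cp dp).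
apply: eq_bigr => m _; rewrite cderM//; first last.
- exact: (dif_chart cp dp).
- exact: dif_jac.
rewrite (cder_chart l cp dp (dc m)) mulr_sumr [RHS]mxE; congr (_ + _).
  by rewrite [RHS]mxE dmxE.
by rewrite summxE; apply: eq_bigr => r _; rewrite [RHS]mxE dmxE mulrA.
Qed.

(** Differentiate J A_k = d_k J + A'_k J along l and skew-symmetrise in l, k. Second derivatives of
    J cancel by symmetry, and products of dJ with connection matrices cancel in pairs. *)
Lemma curv_chart l k : J p *m curv g c l k p
  = (\sum_(m < n) \sum_(r < n) (J p m k * J p r l) *: curv g d r m p) *m J p.
Proof.
have dJ : difmx c p J by exact: dif_jac.
have dA a : difmx c p (conn g c a) by exact: dif_conn.
have D a b : dmx c b J p *m conn g c a p + J p *m dmx c b (conn g c a) p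
  = dmx c b (dmx c a J) p
    + (dmx c b (pconn g c d a) p *m J p + pconn g c d a p *m dmx c b J p).
  rewrite -dmxM// -dmxM//; last exact: dif_pconn.
  rewrite -dmxD//.
  + apply: dmx_ext => //.
    apply: (near_cdom2 cp dp) => q cq dq.
    exact: conn_chart.
  + have := smooth_dmx a (cdom_open d) (fun i j => @smooth_jac _ _ _ c d i j).
    by move=> sJ; exact: (smooth_difmx cp sJ).
  + by apply: difmxM => //; exact: dif_pconn.
have E a b : J p *m dmx c b (conn g c a) p = dmx c b (dmx c a J) p
    + (dmx c b (pconn g c d a) p *m J p + pconn g c d a p *m dmx c b J p)
    - dmx c b J p *m conn g c a p.
  by rewrite -D addrC addKr.
have F a b : J p *m conn g c a p *m conn g c b p
   = dmx c a J p *m conn g c b p + pconn g c d a p *m dmx c b J p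
     + pconn g c d a p *m pconn g c d b p *m J p.
  by rewrite {1}conn_chart// mulmxDl -mulmxA conn_chart// mulmxDr !mulmxA addrA.
rewrite /curv !(mulmxDr, mulmxN, mulmxA) !E !F (dmx_jacC k l).
(* What remains is the curvature of the pulled-back connection. Expanding [pconn] brings in dJ once
   more, again symmetric in k and l. *)
transitivity ((dmx c l (pconn g c d k) p - dmx c k (pconn g c d l) p
  + pconn g c d l p *m pconn g c d k p - pconn g c d k p *m pconn g c d l p) *m J p).
  by rewrite !(mulmxDl, mulNmx); mxring.
congr (_ *m _).
rewrite !dmx_pconn !big_split /=.
have -> : \sum_(i < n) dmx c l J p i k *: conn g d i p
   = \sum_(i < n) dmx c k J p i l *: conn g d i p.
  by apply: eq_bigr => m _; rewrite dmx_jac_sym.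
have -> : pconn g c d l p *m pconn g c d k p
    = \sum_(m < n) \sum_(r < n) (J p m k * J p r l) *: (conn g d r p *m conn g d m p).
  rewrite /pconn mulmx_suml exchange_big; apply: eq_bigr => m _.
  rewrite mulmx_sumr; apply: eq_bigr => r _.
  by rewrite -scalemxAl -scalemxAr scalerA mulrC.
have -> : pconn g c d k p *m pconn g c d l p
    = \sum_(m < n) \sum_(r < n) (J p m k * J p r l) *: (conn g d m p *m conn g d r p).
  rewrite /pconn mulmx_suml; apply: eq_bigr => m _.
  rewrite mulmx_sumr; apply: eq_bigr => r _.
  by rewrite -scalemxAl -scalemxAr scalerA.
rewrite (exchange_big _ _ _ _ _ (fun m r => (J p m l * J p r k) *: dmx d r (conn g d m) p)) /=.
rewrite opprD addrACA subrr add0r -!sumrB -big_split /= -sumrB.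
apply: eq_bigr => m _; rewrite -!sumrB -big_split /= -sumrB; apply: eq_bigr => r _.
rewrite /curv; mxring.
Qed.

End CurvatureChart.

End LeviCivita.

(** * Curvature symmetries and nullity *)

HB.lock Definition hess (R : realType) (n : nat) (M : manifold R n) (g : metric M)
    (c : chart M) (p : M) (a b i j : 'I_n) : R :=
  cder c a (cder c b (fun q => g c q i j)) p.

(* g_ab Gamma^a_lm Gamma^b_ki *)
HB.lock Definition gam_gam (R : realType) (n : nat) (M : manifold R n) (g : metric M)
    (c : chart M) (p : M) (l m k i : 'I_n) : R :=
  ((conn g c l p)^T *m g c p *m conn g c k p) m i.

Section CurvatureSymmetries.
Variables (R : realType) (n : nat) (M : manifold R n).
Variables (g : metric M) (c : chart M) (p : M) (cp : cdom c p).
Implicit Types i j k l m : 'I_n.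

Local Notation A k := (conn g c k p).
Local Notation G := (g c p).

Local Notation hess := (hess g c p).
Local Notation gam_gam := (gam_gam g c p).

Lemma hessC a b i j : hess a b i j = hess b a i j.
Proof. rewrite hess.unlock; exact: (cderC openT _ _ (@metric_smooth _ _ _ g c i j) I cp). Qed.

Lemma hess_sym a b i j : hess a b i j = hess a b j i.
Proof.
rewrite hess.unlock; apply: cder_ext => //; have := near_cdom cp.
by apply: filterS => q cq; exact: cder_metric_sym.
Qed.

Lemma dmx_conn_low l k m i :
  dmx c l (fun q => g c q *m conn g c k q) p m i
  = 2^-1 * (hess l k m i + hess l i m k - hess l m k i).
Proof.
have sg a b : smooth_in c setT (fun q => g c q a b) by exact: metric_smooth.
have dc a b e : dif c p (cder c a (fun q => g c q b e)).
  exact: smooth_dif (smooth_cder openT a (sg b e)) I cp.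
rewrite hess.unlock dmxE (@cder_ext _ _ _ c l _ (fun q => 2^-1 * (cder c k (fun q => g c q m i) q
  + cder c i (fun q => g c q m k) q + (-1) * cder c m (fun q => g c q k i) q)))//; last first.
  have := near_cdom cp; apply: filterS => q cq.
  by rewrite conn_low// mulN1r.
have d1 := difD (dc k m i) (dc i m k).
have d2 := difM (dif_cst c p (-1)) (dc m k i).
rewrite (cderM l cp (dif_cst c p _) (difD d1 d2)) (cderD l d1 d2).
rewrite (cderD l (dc k m i) (dc i m k)) (cderM l cp (dif_cst c p _) (dc m k i)).
by rewrite !cder_cst !mul0r !add0r mulN1r.
Qed.

Lemma dmx_conn_lowE l k :
  dmx c l (fun q => g c q *m conn g c k q) p
  = (A l)^T *m G *m A k + G *m A l *m A k + G *m dmx c l (conn g c k) p.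
Proof.
rewrite dmxM//.
- by rewrite conn_metric// mulmxDl.
- exact: (smooth_difmx cp (@metric_smoothmx _ _ _ g c) I).
- exact: dif_conn.
Qed.

Lemma gam_gamE l m k i :
  gam_gam l m k i = \sum_a \sum_b A l a m * G a b * A k b i.
Proof.
rewrite gam_gam.unlock mxE exchange_big; apply: eq_bigr => b _.
by rewrite mxE mulr_suml; apply: eq_bigr => a _; rewrite mxE.
Qed.

Lemma gam_gam_sym1 l m k i : gam_gam l m k i = gam_gam m l k i.
Proof.
rewrite !gam_gamE; apply: eq_bigr => a _; apply: eq_bigr => b _.
by rewrite (conn_sym g l).
Qed.

Lemma gam_gamC l m k i : gam_gam l m k i = gam_gam k i l m.
Proof.
rewrite !gam_gamE exchange_big; apply: eq_bigr => a _; apply: eq_bigr => b _.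
by rewrite (metric_symE g _ _ cp); ring.
Qed.

Lemma gam_gam_sym2 l m k i : gam_gam l m k i = gam_gam l m i k.
Proof. by rewrite gam_gamC gam_gam_sym1 gam_gamC. Qed.

(** Differentiating the lowered matrices g A_k instead of A_k avoids derivatives of the inverse
    metric. In this classical expression every symmetry of the Riemann tensor is a permutation of
    terms. *)
Lemma curv_low l k m i : (G *m curv g c l k p) m i
  = 2^-1 * (hess l i m k - hess l m k i - hess k i m l + hess k m l i)
    - gam_gam l m k i + gam_gam k m l i.
Proof.
have D a b : G *m dmx c a (conn g c b) p = dmx c a (fun q => g c q *m conn g c b q) p
    - (A a)^T *m G *m A b - G *m A a *m A b.
  by rewrite dmx_conn_lowE; mxring.
have -> : G *m curv g c l k p = dmx c l (fun q => g c q *m conn g c k q) p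
    - dmx c k (fun q => g c q *m conn g c l q) p
    - (A l)^T *m G *m A k + (A k)^T *m G *m A l.
  by rewrite /curv !(mulmxDr, mulmxN) !D !mulmxA; mxring.
have X (U V : 'M[R]_n) : (U - V - (A l)^T *m G *m A k + (A k)^T *m G *m A l) m i
    = U m i - V m i - gam_gam l m k i + gam_gam k m l i.
  by rewrite gam_gam.unlock; move: (_ *m A k) (_ *m A l) => Y Z; rewrite !mxE.
by rewrite X !dmx_conn_low (hessC k l); ring.
Qed.

Lemma curv_skew l k m i : (G *m curv g c l k p) m i = - (G *m curv g c l k p) i m.
Proof.
rewrite !curv_low (gam_gamC k m) (gam_gamC l m) (gam_gamC k i) (gam_gamC l i).
rewrite (hess_sym l m k i) (hess_sym k m l i) (hess_sym l i k m) (hess_sym k i l m).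
ring.
Qed.

Lemma curv_pair l k m i : (G *m curv g c l k p) m i = (G *m curv g c m i p) l k.
Proof.
rewrite !curv_low (gam_gam_sym1 m l) (gam_gam_sym2 l m i k) (gam_gamC i l m k).
rewrite (gam_gam_sym1 m k) (gam_gam_sym2 k m i l).
rewrite (hessC m k l i) (hessC m l i k) (hess_sym l m i k) (hessC i k l m).
by rewrite (hess_sym k i l m) (hessC i l m k); ring.
Qed.

Lemma invmx_metric_sym a b : invmx G a b = invmx G b a.
Proof. by rewrite -{1}(Defs.metric_sym g cp) -trmx_inv mxE. Qed.

Lemma curv_raise l k : curv g c l k p = invmx G *m (G *m curv g c l k p).
Proof. by rewrite mulKmx// metric_nondeg. Qed.

(** The trace contracts the symmetric inverse metric with a skew tensor. *)
Lemma curv_trace0 l k : \tr (curv g c l k p) = 0.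
Proof.
have : \tr (curv g c l k p) = - \tr (curv g c l k p).
  rewrite {1}curv_raise {2}curv_raise /mxtrace -sumrN.
  under eq_bigr => i _ do rewrite mxE.
  under [RHS]eq_bigr => i _ do rewrite mxE -sumrN.
  rewrite exchange_big; apply: eq_bigr => a _; apply: eq_bigr => b _.
  by rewrite invmx_metric_sym curv_skew mulrN.
by move/eqP; rewrite -addr_eq0 -mulr2n mulrn_eq0 /= => /eqP.
Qed.

Lemma ricci_curv i k : ricci g c i k p = \sum_a curv g c a k p a i.
Proof. by apply: eq_bigr => a _; rewrite riemannE. Qed.

Lemma ricci_sym i k : ricci g c i k p = ricci g c k i p.
Proof.
rewrite !ricci_curv.
under eq_bigr => a _ do rewrite curv_raise mxE.
under [RHS]eq_bigr => a _ do rewrite curv_raise mxE.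
rewrite exchange_big; apply: eq_bigr => a _; apply: eq_bigr => b _.
by rewrite invmx_metric_sym curv_pair.
Qed.

Lemma schouten_sym i k : schouten g c p i k = schouten g c p k i.
Proof. by rewrite !mxE ricci_sym. Qed.

Lemma weylE i j k l : weyl g c i j k l p = curv g c k l p i j
  + (i == l)%:R * schouten g c p j k - (i == k)%:R * schouten g c p j l.
Proof. by rewrite /weyl riemannE. Qed.

Lemma sum_delta (f : 'I_n -> R) i : \sum_j (i == j)%:R * f j = f i.
Proof.
rewrite (bigD1 i)//= eqxx mul1r big1 ?addr0// => j ji.
by rewrite eq_sym (negbTE ji) mul0r.
Qed.

Lemma sum_deltar (f : 'I_n -> R) i : \sum_j f j * (j == i)%:R = f i.
Proof.
by rewrite -[RHS]sum_delta; apply: eq_bigr => j _; rewrite mulrC eq_sym.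
Qed.

Lemma schouten_mulv (v : 'cV[R]_n) b :
  (schouten g c p *m v) b 0 = \sum_j schouten g c p j b * v j 0.
Proof. by rewrite mxE; apply: eq_bigr => j _; rewrite schouten_sym. Qed.

Lemma nullity_curv_low (v : 'cV[R]_n) i k l : nullity g c p v ->
  (G *m curv g c k l p *m v) i 0
  = G i k * (schouten g c p *m v) l 0 - G i l * (schouten g c p *m v) k 0.
Proof.
move=> nv; set w := schouten g c p *m v.
have E a : (curv g c k l p *m v) a 0 = w l 0 * (a == k)%:R - w k 0 * (a == l)%:R.
  have : (curv g c k l p *m v) a 0 + (a == l)%:R * w k 0 - (a == k)%:R * w l 0 = 0.
    rewrite -(nv a k l) /w !schouten_mulv mxE !mulr_sumr -big_split -sumrB /=.
    by apply: eq_bigr => j _; rewrite weylE; ring.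
  by move=> H; rewrite -[LHS]subr0 -[X in _ - X]H; ring.
rewrite -mulmxA mxE.
under eq_bigr => a _ do rewrite E mulrBr !mulrA.
by rewrite sumrB !sum_deltar.
Qed.

Lemma cV_neq0 (v : 'cV[R]_n) : v != 0 -> exists i, v i 0 != 0.
Proof.
move=> v0; apply/existsP; apply: contraNT v0; rewrite negb_exists => /forallP H.
apply/eqP/matrixP => i j; rewrite ord1 [RHS]mxE; apply/eqP.
by have := H i; rewrite negbK.
Qed.

Lemma metric_mul_neq0 (v : 'cV[R]_n) : v != 0 -> exists i, (G *m v) i 0 != 0.
Proof.
move=> v0; apply: cV_neq0; apply: contraNneq v0 => Gv0.
by rewrite -(mulKmx (metric_nondeg g cp) v) Gv0 mulmx0.
Qed.

(** Let w = P v and u = g v. Skewness gives R_ijkl v^i v^j = 0, and nullity evaluates this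
    contraction to u_k w_l - u_l w_k, so w is parallel to u. As v may be a null vector, the factor
    is read off from a nonzero component of u and not from g(v, v). *)
Lemma nullity_schouten (v : 'cV[R]_n) : v != 0 -> nullity g c p v ->
  exists b, schouten g c p *m v = b *: (G *m v).
Proof.
move=> v0 nv; set w := schouten g c p *m v; set u := G *m v.
have H k l : u k 0 * w l 0 = u l 0 * w k 0.
  have : \sum_i v i 0 * (G *m curv g c k l p *m v) i 0 = 0.
    set S := \sum_i _; have : S = - S.
      rewrite /S -sumrN; under eq_bigr => i _ do rewrite mxE mulr_sumr.
      under [RHS]eq_bigr => i _ do rewrite mxE mulr_sumr -sumrN.
      rewrite exchange_big; apply: eq_bigr => i _; apply: eq_bigr => j _.
      by rewrite curv_skew; ring.
    by move/eqP; rewrite -addr_eq0 -mulr2n mulrn_eq0 /= => /eqP.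
  under eq_bigr => i _ do rewrite nullity_curv_low// -/w mulrBr.
  have U a b : \sum_i v i 0 * (G i a * b) = u a 0 * b.
    rewrite /u mxE mulr_suml; apply: eq_bigr => i _.
    by rewrite (metric_symE g i a cp); ring.
  by rewrite sumrB !U => /eqP; rewrite subr_eq0 => /eqP.
have [m um] := metric_mul_neq0 v0.
exists (w m 0 / u m 0); apply/matrixP => i j; rewrite ord1 [RHS]mxE.
by apply: (mulfI um); rewrite -/u -/w H [LHS]mulrC; field.
Qed.

(* The right-hand side is - v^i phi_jl: a nonzero nullity vector and the Weyl tensor
   determine phi, which makes phi projectively invariant. *)
Lemma nullity_weyl (v : 'cV[R]_n) b i j l : nullity g c p v ->
  schouten g c p *m v = b *: (G *m v) ->
  \sum_k weyl g c i j k l p * v k 0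
  = - (v i 0 * (schouten g c p j l - b * G j l)).
Proof.
move=> nv Pv.
have Pvk k : (schouten g c p *m v) k 0 = b * (G *m v) k 0 by rewrite Pv mxE.
(* x is the curvature part of the left-hand side and y its intended value. They are compared after
   lowering the index: there pair symmetry moves v into the second slot, where the nullity condition
   evaluates it. *)
pose x : 'cV[R]_n := \col_i \sum_k curv g c k l p i j * v k 0.
pose y : 'cV[R]_n := \col_i (b * (v i 0 * G l j - (i == l)%:R * (G *m v) j 0)).
have xy : G *m x = G *m y.
  apply/matrixP => a z; rewrite {z}ord1.
  have -> : (G *m x) a 0 = - (G *m curv g c a j p *m v) l 0.
    rewrite mxE [X in - X]mxE -sumrN.
    under eq_bigr => m _ do rewrite mxE mulr_sumr.
    rewrite exchange_big; apply: eq_bigr => k _.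
    rewrite -mulNr -curv_skew -curv_pair mxE mulr_suml.
    by apply: eq_bigr => m _; rewrite mulrA.
  rewrite nullity_curv_low// !Pvk [RHS]mxE.
  have -> : \sum_m G a m * y m 0
      = \sum_m (b * G l j * (G a m * v m 0) - (b * (G *m v) j 0 * G a m) * (m == l)%:R).
    by apply: eq_bigr => m _; rewrite [y m 0]mxE; ring.
  rewrite sumrB sum_deltar -mulr_sumr.
  have -> : \sum_m G a m * v m 0 = (G *m v) a 0 by rewrite [RHS]mxE.
  by rewrite (metric_symE g l a cp); ring.
have {xy} xy : x = y.
  by rewrite -(mulKmx (metric_nondeg g cp) x) xy mulKmx// metric_nondeg.
have xi : \sum_k curv g c k l p i j * v k 0 = y i 0 by rewrite -xy mxE.
under eq_bigr => k _ do rewrite weylE !mulrDl.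
rewrite !big_split /= xi.
have -> : \sum_k (i == l)%:R * schouten g c p j k * v k 0
   = (i == l)%:R * (b * (G *m v) j 0).
  by rewrite -Pvk mxE mulr_sumr; apply: eq_bigr => k _; rewrite mulrA.
have -> : \sum_k - ((i == k)%:R * schouten g c p j l) * v k 0
   = - (v i 0 * schouten g c p j l).
  rewrite -(sum_delta (fun k => v k 0) i) mulr_suml -sumrN.
  by apply: eq_bigr => k _; ring.
by rewrite mxE (metric_symE g l j cp); ring.
Qed.

(** Contract W^i_jkl with v^k and w^j. The nullity of w makes the result zero, while [nullity_weyl]
    makes it - v^i (P w - b g w)_l; some v^i is nonzero. So a single b serves the whole nullity. *)
Lemma nullity_schouten_all (v w : 'cV[R]_n) b : v != 0 -> nullity g c p v ->
  schouten g c p *m v = b *: (G *m v) -> nullity g c p w ->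
  schouten g c p *m w = b *: (G *m w).
Proof.
move=> v0 nv Pv nw; have [i vi] := cV_neq0 v0.
apply/matrixP => l z; rewrite {z}ord1 [RHS]mxE.
have : \sum_j \sum_k weyl g c i j k l p * v k 0 * w j 0 = 0.
  rewrite exchange_big big1// => k _.
  transitivity (v k 0 * \sum_j weyl g c i j k l p * w j 0); last by rewrite nw mulr0.
  by rewrite mulr_sumr; apply: eq_bigr => j _; ring.
under eq_bigr => j _ do rewrite -mulr_suml (nullity_weyl _ _ _ nv Pv).
have -> : \sum_j - (v i 0 * (schouten g c p j l - b * G j l)) * w j 0
   = - v i 0 * ((schouten g c p *m w) l 0 - b * (G *m w) l 0).
  rewrite schouten_mulv [(G *m w) l 0]mxE mulr_sumr -sumrB mulr_sumr.
  by apply: eq_bigr => j _; rewrite (metric_symE g l j cp); ring.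
by move/eqP; rewrite mulf_eq0 oppr_eq0 (negbTE vi) /= subr_eq0 => /eqP.
Qed.

End CurvatureSymmetries.

(** * Projective change of the curvature *)

Section CurvatureTensors.
Variables (R : realType) (n : nat) (M : manifold R n).
Variables (g : metric M).
Implicit Types (c d : chart M) (p : M) (i j k l m : 'I_n).

Lemma schouten_chart c d p : cdom c p -> cdom d p ->
  schouten g c p = (jac c d p)^T *m schouten g d p *m jac c d p.
Proof.
move=> cp dp; set J := jac c d p; have uJ := jac_unit cp dp.
have C l k : curv g c l k p
    = \sum_m \sum_r (J m k * J r l) *: (invmx J *m curv g d r m p *m J).
  rewrite -[LHS](mulKmx uJ) curv_chart// mulmx_suml mulmx_sumr; apply: eq_bigr => m _.
  rewrite mulmx_suml mulmx_sumr; apply: eq_bigr => r _.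
  by rewrite -scalemxAl -scalemxAr mulmxA.
apply/matrixP => i k; rewrite mxE ricci_curv.
have -> : \sum_a curv g c a k p a i
    = \sum_m J m k * \sum_r (J *m (invmx J *m curv g d r m p *m J)) r i.
  under eq_bigr => a _ do rewrite C summxE.
  rewrite exchange_big; apply: eq_bigr => m _.
  under eq_bigr => a _ do rewrite summxE.
  rewrite exchange_big mulr_sumr; apply: eq_bigr => r _.
  rewrite [X in _ = _ * X]mxE mulr_sumr; apply: eq_bigr => a _.
  by rewrite [LHS]mxE mulrA.
rewrite [RHS]mxE mulr_sumr; apply: eq_bigr => m _.
rewrite [X in _ = X * _]mxE mulrCA mulrC; congr (_ * _).
have E r : (J *m (invmx J *m curv g d r m p *m J)) r i = \sum_s curv g d r m p r s * J s i.
  by rewrite -mulmxA mulKVmx// mxE.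
under eq_bigr => r _ do rewrite E.
rewrite exchange_big mulr_sumr; apply: eq_bigr => s _.
rewrite [J^T i s]mxE [schouten g d p s m]mxE ricci_curv -mulr_suml; ring.
Qed.

Lemma nullityP c p v : cdom c p -> nullity g c p v <-> forall k l,
  curv g c k l p *m v + (schouten g c p *m v) k 0 *: delta_mx l 0
   - (schouten g c p *m v) l 0 *: delta_mx k 0 = 0.
Proof.
move=> cp; have E i k l : \sum_j weyl g c i j k l p * v j 0
   = (curv g c k l p *m v + (schouten g c p *m v) k 0 *: delta_mx l 0
   - (schouten g c p *m v) l 0 *: delta_mx k 0) i 0.
  rewrite [RHS]mxE [X in _ = X + _]mxE [X in _ = _ + X]mxE.
  rewrite [(_ *: delta_mx l 0) i 0]mxE [(_ *: delta_mx k 0) i 0]mxE !schouten_mulv//.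
  rewrite [delta_mx l 0 i 0]mxE [delta_mx k 0 i 0]mxE [(_ *m _) i 0]mxE eqxx !andbT.
  rewrite !mulr_suml -big_split -sumrB; apply: eq_bigr => j _ /=.
  by rewrite weylE; ring.
split=> [nv k l|nv i k l]; last by rewrite E nv mxE.
by apply/matrixP => i z; rewrite {z}ord1 -E nv mxE.
Qed.

(** J times the Weyl expression of v in the chart c is a linear combination of the Weyl expressions
    of J v in the chart d. *)
Lemma nullity_chart c d p v : cdom c p -> cdom d p ->
  nullity g d p (jac c d p *m v) -> nullity g c p v.
Proof.
move=> cp dp; set J := jac c d p; have uJ := jac_unit cp dp.
move=> /(nullityP _ dp) nv; apply/(nullityP _ cp) => k l.
pose w' := schouten g d p *m (J *m v).
have -> : schouten g c p *m v = J^T *m w' by rewrite (schouten_chart cp dp) /w' !mulmxA.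
have wk a : (J^T *m w') a 0 = \sum_r J r a * w' r 0.
  by rewrite mxE; apply: eq_bigr => r _; rewrite mxE.
have Jd a : J *m delta_mx a 0 = \sum_m J m a *: delta_mx m (0 : 'I_1).
  rewrite -colE; apply/matrixP => i z; rewrite {z}ord1 mxE summxE.
  rewrite -[LHS](sum_deltar (fun m => J m a) i).
  by apply: eq_bigr => m _; rewrite !mxE eqxx andbT eq_sym.
apply: (can_inj (mulKmx uJ)); rewrite mulmx0.
rewrite mulmxBr mulmxDr mulmxA curv_chart// -!scalemxAr !Jd !wk.
transitivity (\sum_m \sum_r (J m l * J r k) *: (curv g d r m p *m (J *m v)
   + w' r 0 *: delta_mx m 0 - w' m 0 *: delta_mx r 0)); last first.
  by apply: big1 => m _; apply: big1 => r _; rewrite nv scaler0.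
rewrite -mulmxA mulmx_suml.
have -> : (\sum_r J r k * w' r 0) *: (\sum_m J m l *: delta_mx m 0)
   = \sum_m \sum_r (J m l * J r k) *: (w' r 0 *: delta_mx m 0) :> 'cV[R]_n.
  rewrite scaler_sumr; apply: eq_bigr => m _; rewrite scaler_suml.
  by apply: eq_bigr => r _; rewrite !scalerA; congr (_ *: _); ring.
have -> : (\sum_r J r l * w' r 0) *: (\sum_m J m k *: delta_mx m 0)
   = \sum_m \sum_r (J m l * J r k) *: (w' m 0 *: delta_mx r 0) :> 'cV[R]_n.
  rewrite scaler_suml; apply: eq_bigr => m _; rewrite scaler_sumr.
  by apply: eq_bigr => r _; rewrite !scalerA; congr (_ *: _); ring.
rewrite -big_split -sumrB; apply: eq_bigr => m _ /=.
rewrite mulmx_suml -big_split -sumrB; apply: eq_bigr => r _ /=.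
by rewrite -scalemxAl -scalerDr -scalerBr.
Qed.

(** [Bfun] selects a number that works in every chart around p. The factor of v in c is such a
    number, because nullity vectors and P transform as tensors and one factor serves all nullity
    vectors; hence the selection succeeds. *)
Lemma Bfun_spec c p v : cdom c p -> v != 0 -> nullity g c p v ->
  schouten g c p *m v = Bfun g p *: (g c p *m v).
Proof.
move=> cp v0 nv; have [b Pb] := nullity_schouten cp v0 nv.
have H : forall d, cdom d p -> forall w, nullity g d p w ->
    schouten_up g d p *m w = b *: w.
  move=> d dp w nw.
  have nJw : nullity g c p (jac d c p *m w).
    apply: (nullity_chart cp dp).
    by rewrite mulmxA (jacK dp cp) mul1mx.
  have PJw := nullity_schouten_all cp v0 nv Pb nJw.
  have -> : schouten_up g d p *m w
     = invmx (g d p) *m ((jac d c p)^T *m (schouten g c p *m (jac d c p *m w))).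
    by rewrite /schouten_up (schouten_chart dp cp) !mulmxA.
  rewrite PJw -!scalemxAr; congr (_ *: _).
  have -> : (jac d c p)^T *m (g c p *m (jac d c p *m w)) = g d p *m w.
    by rewrite (metric_chart g dp cp) !mulmxA.
  by rewrite mulKmx// metric_nondeg.
have /(_ c cp v nv) := @xgetPex _ 0 [set b | forall c, cdom c p -> forall v,
  nullity g c p v -> schouten_up g c p *m v = b *: v] (ex_intro _ b H).
rewrite -/(Bfun g p) => E.
by rewrite scalemxAr -E /schouten_up mulmxA mulmxA mulmxV ?mul1mx// metric_nondeg.
Qed.

End CurvatureTensors.

Definition upsilon (R : realType) (n : nat) (M : manifold R n) (g h : metric M)
    (c : chart M) (p : M) : 'rV[R]_n :=
  \row_k (n.+1%:R^-1 * (christoffel_tr h c k p - christoffel_tr g c k p)).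

HB.lock Definition upsilon_mx (R : realType) (n : nat) (M : manifold R n)
    (g h : metric M) (c : chart M) (k : 'I_n) (p : M) : 'M[R]_n :=
  delta_mx k 0 *m upsilon g h c p + (upsilon g h c p 0 k)%:M.

Section ProjectiveChange.
Variables (R : realType) (n : nat) (M : manifold R n) (g h : metric M).
Implicit Types (c d : chart M) (p : M) (i j k l m : 'I_n).

Lemma christoffel_trE g' c a p : christoffel_tr g' c a p = \tr (conn g' c a p).
Proof. by apply: eq_bigr => b _; rewrite connE. Qed.

Local Notation upsilon := (upsilon g h).
Local Notation upsilon_mx := (upsilon_mx g h).

Hypothesis projgh : forall c p k, cdom c p ->
  conn h c k p = conn g c k p + upsilon_mx c k p.

Lemma smooth_christoffel_tr g' c a : smooth_in c setT (christoffel_tr g' c a).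
Proof. by apply: (smooth_sum openT) => b; exact: smooth_christoffel. Qed.

Lemma smooth_upsilon c : smoothmx c setT (upsilon c).
Proof.
move=> i k; rewrite ord1.
apply: (smooth_ext openT (f := fun p => n.+1%:R^-1 *
   (christoffel_tr h c k p - christoffel_tr g c k p))).
  by move=> p _ _; rewrite mxE.
apply: (smoothM openT); first exact: (smooth_cst openT).
by apply: (smoothB openT); exact: smooth_christoffel_tr.
Qed.

Section AtPoint.
Variables (c : chart M) (p : M) (cp : cdom c p).
Local Notation U := (upsilon c p).

Lemma dmx_trace l k g' : cder c l (christoffel_tr g' c k) p = \tr (dmx c l (conn g' c k) p).
Proof.
rewrite (_ : christoffel_tr g' c k = fun q => \sum_(b < n) christoffel g' c b k b q)//.
rewrite cder_sum; last first.
  by move=> b _; exact: (smooth_dif (smooth_christoffel g' b k b) I cp).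
apply: eq_bigr => b _; rewrite dmxE; apply: eq_cder => q.
by rewrite connE.
Qed.

(** The commutator in the curvature has trace zero, so the trace of the curvature is the exterior
    derivative of the trace of the connection. *)
Lemma christoffel_tr_closed l k g' :
  cder c l (christoffel_tr g' c k) p = cder c k (christoffel_tr g' c l) p.
Proof.
have := curv_trace0 g' cp l k; rewrite /curv !(linearD, linearN) /=.
by rewrite [\tr (_ *m _)]mxtrace_mulC addrK !dmx_trace => /eqP; rewrite subr_eq0 => /eqP.
Qed.

Lemma upsilon_closed l k : dmx c l (upsilon c) p 0 k = dmx c k (upsilon c) p 0 l.
Proof.
have dt a g' : dif c p (christoffel_tr g' c a).
  exact: (smooth_dif (@smooth_christoffel_tr g' c a) I cp).
have E a b : dmx c a (upsilon c) p 0 b = n.+1%:R^-1 *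
   (cder c a (christoffel_tr h c b) p + (-1) * cder c a (christoffel_tr g c b) p).
  rewrite dmxE (@eq_cder _ _ _ _ _ _ (fun q => n.+1%:R^-1 *
   (christoffel_tr h c b q + (-1) * christoffel_tr g c b q))); last first.
    by move=> q; rewrite mxE mulN1r.
  have d1 := difM (dif_cst c p (-1)) (dt b g).
  rewrite (cderM a cp (dif_cst c p _) (difD (dt b h) d1)) cder_cst mul0r add0r.
  by rewrite (cderD a (dt b h) d1) (cderM a cp (dif_cst c p _) (dt b g)) cder_cst mul0r add0r.
by rewrite !E !(christoffel_tr_closed l k).
Qed.

Lemma upsilon_mxE k q i j : upsilon_mx c k q i j
  = (i == k)%:R * upsilon c q 0 j + upsilon c q 0 k * (i == j)%:R.
Proof.
rewrite upsilon_mx.unlock [LHS]mxE [X in _ + X]mxE [X in X + _]mxE big_ord1.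
by rewrite [delta_mx _ _ _ _]mxE eqxx andbT mulr_natr.
Qed.

Lemma dmx_upsilon_mx l k i j : dmx c l (upsilon_mx c k) p i j
  = (i == k)%:R * dmx c l (upsilon c) p 0 j + dmx c l (upsilon c) p 0 k * (i == j)%:R.
Proof.
have du a : dif c p (fun q => upsilon c q 0 a).
  exact: (smooth_dif (@smooth_upsilon c 0 a) I cp).
rewrite !dmxE (eq_cder _ _ _ (upsilon_mxE k ^~ i ^~ j)).
have d1 := difM (dif_cst c p (i == k)%:R) (du j).
have d2 := difM (du k) (dif_cst c p (i == j)%:R).
rewrite (cderD l d1 d2) (cderM l cp (dif_cst c p _) (du j)).
by rewrite (cderM l cp (du k) (dif_cst c p _)) !cder_cst mul0r mulr0 add0r addr0.
Qed.

Lemma mul_upsilon_mx (A : 'M[R]_n) k i j : (A *m upsilon_mx c k p) i j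
  = A i k * U 0 j + U 0 k * A i j.
Proof.
rewrite mxE; under eq_bigr => a _ do rewrite upsilon_mxE mulrDr.
rewrite big_split /= -[A i k](sum_deltar (fun a => A i a)) mulr_suml.
rewrite -[X in _ = _ + _ * X](sum_deltar (fun a => A i a)) mulr_sumr.
by congr (_ + _); apply: eq_bigr => a _; ring.
Qed.

Lemma upsilon_mx_mul (A : 'M[R]_n) k i j : (upsilon_mx c k p *m A) i j
  = (i == k)%:R * (U *m A) 0 j + U 0 k * A i j.
Proof.
rewrite mxE; under eq_bigr => a _ do rewrite upsilon_mxE mulrDl.
rewrite big_split /= [(U *m A) 0 j]mxE mulr_sumr.
rewrite -[X in _ = _ + _ * X](sum_delta (fun a => A a j)) mulr_sumr.
by congr (_ + _); apply: eq_bigr => a _; ring.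
Qed.

(** The tensor nabla_l Upsilon_j - Upsilon_l Upsilon_j, with nabla the connection of g. *)
Definition psi l j : R :=
  dmx c l (upsilon c) p 0 j - (U *m conn g c l p) 0 j - U 0 l * U 0 j.

Lemma psi_sym l j : psi l j = psi j l.
Proof.
rewrite /psi upsilon_closed; congr (_ - _ - _); last exact: mulrC.
by rewrite !mxE; apply: eq_bigr => a _; rewrite (conn_sym g l).
Qed.

Lemma curv_proj l k i j : curv h c l k p i j
  = curv g c l k p i j + (i == k)%:R * psi l j - (i == l)%:R * psi k j.
Proof.
have dA a : difmx c p (conn g c a) by exact: dif_conn.
have du a : difmx c p (upsilon_mx c a).
  move=> x y; apply: (dif_ext cp (f := fun q => (x == a)%:R * upsilon c q 0 y
    + upsilon c q 0 a * (x == y)%:R)).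
    by apply: nearW => q; rewrite upsilon_mxE.
  have du b : dif c p (fun q => upsilon c q 0 b).
    exact: (smooth_dif (@smooth_upsilon c 0 b) I cp).
  by apply: difD; apply: difM => //; exact: dif_cst.
have D a b : dmx c a (conn h c b) p = dmx c a (conn g c b) p + dmx c a (upsilon_mx c b) p.
  rewrite -dmxD//; apply: dmx_ext => //; have := near_cdom cp.
  by apply: filterS => q cq; exact: projgh.
rewrite /curv !projgh// !D !(mulmxDl, mulmxDr).
have X (a1 a2 b1 b2 x1 x2 x3 x4 y1 y2 y3 y4 : 'M[R]_n) :
    (a1 + a2 - (b1 + b2) + (x1 + x2 + (x3 + x4)) - (y1 + y2 + (y3 + y4))) i j
    = (a1 - b1 + x1 - y1) i j + (a2 i j - b2 i j) + (x2 i j - y3 i j)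
      + (x3 i j - y2 i j) + (x4 i j - y4 i j).
  by rewrite !mxE; ring.
rewrite X !mul_upsilon_mx !upsilon_mx_mul !dmx_upsilon_mx !upsilon_mxE /psi.
(* Closedness of Upsilon removes the multiple of delta^i_j, and symmetry of the Christoffel symbols
   the products of Gamma^i_lk with Upsilon_j. *)
rewrite (conn_sym g l k i cp) (upsilon_closed k l); ring.
Qed.

Hypothesis n2 : (2 <= n)%N.

(** Tracing [curv_proj] changes the Ricci tensor by psi - n psi, and the Schouten tensor divides
    this by n - 1, which is nonzero for n >= 2. *)
Lemma schouten_proj i k : schouten h c p i k = schouten g c p i k - psi k i.
Proof.
have n1 : (n%:R - 1 : R) != 0.
  by rewrite subr_eq0 pnatr_eq1 gtn_eqF.
rewrite [LHS]mxE [schouten g c p i k]mxE !ricci_curv.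
under eq_bigr => a _ do rewrite curv_proj eqxx mul1r.
rewrite big_split sumrN big_split /= sumr_const card_ord.
have -> : \sum_a (a == k)%:R * psi a i = psi k i.
  by rewrite -[RHS](sum_deltar (fun a => psi a i)); apply: eq_bigr => a _; rewrite mulrC.
by rewrite -[psi k i *+ n]mulr_natl; field.
Qed.

Lemma weyl_proj i j k l : weyl h c i j k l p = weyl g c i j k l p.
Proof.
have alg (C a b x y x' y' s t : R) : x' = x - s -> y' = y - t ->
  C + a * s - b * t + a * x' - b * y' = C + a * x - b * y by move=> -> ->; ring.
rewrite !weylE curv_proj.
exact: alg (schouten_proj j k) (schouten_proj j l).
Qed.

Lemma phi_proj v : v != 0 -> nullity g c p v -> phi_of h c p = phi_of g c p.
Proof.
move=> v0 nv; have nh : nullity h c p v.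
  move=> i k l; apply: etrans (nv i k l).
  by apply: eq_bigr => j _; rewrite weyl_proj.
have [i vi] := cV_neq0 v0.
have Eg j l := nullity_weyl cp i j l nv (Bfun_spec cp v0 nv).
have Eh j l := nullity_weyl cp i j l nh (Bfun_spec cp v0 nh).
have phE (g' : metric M) j l :
    phi_of g' c p j l = schouten g' c p j l - Bfun g' p * g' c p j l.
  rewrite /phi_of; move: (schouten g' c p) (g' c p) => P G.
  by rewrite !mxE.
apply/matrixP => j l; rewrite !phE; apply: (mulfI vi); apply: oppr_inj.
apply: etrans (esym (Eh j l)) (etrans _ (Eg j l)).
by apply: eq_bigr => k _; rewrite weyl_proj.
Qed.

End AtPoint.
End ProjectiveChange.

(** * The Picard-Lindelof theorem *)

Section Picard.
Variable R : realType.
Implicit Types (f : R -> R) (t s e : R).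

Lemma is_derive_funD (f g : R -> R) t a b : is_derive t 1 f a -> is_derive t 1 g b ->
  is_derive t 1 (fun u => f u + g u) (a + b).
Proof. by move=> df dg; exact: (@is_deriveD _ _ _ f g). Qed.

Lemma is_derive_funB (f g : R -> R) t a b : is_derive t 1 f a -> is_derive t 1 g b ->
  is_derive t 1 (fun u => f u - g u) (a - b).
Proof. by move=> df dg; exact: (@is_deriveB _ _ _ f g). Qed.

Lemma is_derive_funM (f g : R -> R) t a b : is_derive t 1 f a -> is_derive t 1 g b ->
  is_derive t 1 (fun u => f u * g u) (a * g t + f t * b).
Proof.
move=> df dg; have H : is_derive t 1 (f * g) (f t *: b + g t *: a) by exact: is_deriveM.
apply: is_derive_eq H _.
by rewrite addrC /GRing.scale /=; congr (_ + _); exact: mulrC.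
Qed.

Lemma is_derive_fun_sum (J : Type) (r : seq J) (F : J -> R -> R) (a : J -> R) t :
  (forall j, is_derive t 1 (F j) (a j)) ->
  is_derive t 1 (fun u => \sum_(j <- r) F j u) (\sum_(j <- r) a j).
Proof.
move=> dF; elim: r => [|j r IH].
  rewrite big_nil (_ : (fun u => _) = cst 0); first exact: is_derive_cst.
  by apply/funext => u; rewrite big_nil.
rewrite big_cons (_ : (fun u => _) = fun u => F j u + \sum_(j <- r) F j u).
  exact: is_derive_funD.
by apply/funext => u; rewrite big_cons.
Qed.

(** The integral from -1, shifted to vanish at 0. The range |t| < 1 is enough because the time of
    existence [T] chosen below is less than 1. *)
Lemma primitive_ex f : continuous f ->
  exists Phi : R -> R, Phi 0 = 0 /\ forall t, `|t| < 1 -> is_derive t 1 Phi (f t).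
Proof.
move=> cf; pose mu := @lebesgue_measure R.
have intf : mu.-integrable `[(-1 : R), 1] (EFin \o f).
  apply: continuous_compact_integrable; first exact: segment_compact.
  exact: continuous_subspaceT.
pose F x := (\int[mu]_(t in `[(-1 : R), x]) f t)%R.
have FP t : `|t| < 1 -> is_derive t 1 F (f t).
  rewrite ltr_norml => /andP[t1 t2].
  have [dF <-] := @continuous_FTC1_closed R f (-1) t 1 t2 intf t1 (cf t).
  by rewrite derive1E; exact: derivableP.
exists (fun x => F x - F 0); split; first by rewrite subrr.
move=> t t1; have := FP t t1 => dF.
apply: is_derive_eq (is_derive_funB dF (is_derive_cst (F 0) t 1)) _.
by rewrite subr0.
Qed.

(** A primitive vanishing at 0 as an operator on all functions; its value at a discontinuous
    function is a dummy. *)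
Definition prim f : R -> R :=
  if pselect (continuous f) is left cf then sval (cid (primitive_ex cf)) else f.

Lemma primP f : continuous f ->
  prim f 0 = 0 /\ forall t, `|t| < 1 -> is_derive t 1 (prim f) (f t).
Proof. by move=> cf; rewrite /prim; case: pselect => // ?; case: cid. Qed.

(** The 1-Lipschitz retraction of the line onto [a - r, a + r]. It extends local data, in time and
    in state space, to global data. *)
Definition clamp (a r x : R) : R := Num.max (a - r) (Num.min x (a + r)).

Lemma clamp_in a r x : 0 <= r -> `|clamp a r x - a| <= r.
Proof.
move=> r0; rewrite ler_norml /clamp; apply/andP; split.
  by rewrite lerBrDr addrC le_max lexx.
rewrite lerBlDr ge_max ge_min [a + r]addrC lexx orbT andbT; lra.
Qed.

Lemma clamp_id a r x : `|x - a| <= r -> clamp a r x = x.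
Proof.
rewrite ler_norml => /andP[h1 h2]; rewrite /clamp min_l; last by rewrite -lerBlDl.
by rewrite max_r//; lra.
Qed.

Lemma clamp_lip a r x y : `|clamp a r x - clamp a r y| <= `|x - y|.
Proof.
wlog xy : x y / x <= y.
  by move=> H; have [/H//|/ltW/H] := leP x y; rewrite distrC [leRHS]distrC.
have cxy : clamp a r x <= clamp a r y.
  rewrite /clamp; apply: le_max2 => //; exact: le_min2.
rewrite ler0_norm ?subr_le0// ler0_norm ?subr_le0// !opprB /clamp /Num.max /Num.min.
by do !case: ifPn; rewrite -?leNgt => *; lra.
Qed.

Lemma clamp_continuous a r : continuous (clamp a r).
Proof.
move=> x; apply/cvgrPdist_le => e e0; exists e => //= y xy.
exact: le_trans (clamp_lip _ _ _ _) (ltW xy).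
Qed.

Lemma is_derive_continuous f t a : is_derive t 1 f a -> {for t, continuous f}.
Proof.
by move=> [df _]; apply: differentiable_continuous; exact/derivable1_diffP.
Qed.

Lemma mean_value_bound (f df : R -> R) b e : 0 <= e -> f 0 = 0 ->
  (forall t, `|t| <= `|b| -> is_derive t 1 f (df t)) ->
  (forall t, `|df t| <= e) -> `|f b| <= e * `|b|.
Proof.
move=> e0 f0 Df dfe.
have cont u v : (forall x, x \in `[u, v] -> `|x| <= `|b|) -> {within `[u, v], continuous f}.
  move=> uv; apply: derivable_within_continuous => x xuv.
  by have [] := Df x (uv x xuv).
have [b0|b0] := leP 0 b.
  have [||c _] := @MVT_segment R f df 0 b b0.
  - move=> x /[!in_itv]/= /andP[x0 xb]; apply: Df.
    by rewrite !ger0_norm// ltW.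
  - apply: cont => x /[!in_itv]/= /andP[x0 xb]; by rewrite !ger0_norm.
  by rewrite f0 !subr0 => ->; rewrite normrM ler_wpM2r.
have [||c _] := @MVT_segment R f df b 0 (ltW b0).
- move=> x /[!in_itv]/= /andP[bx x0]; apply: Df.
  by rewrite !ler0_norm ?lerN2 // ltW.
- apply: cont => x /[!in_itv]/= /andP[bx x0].
  by rewrite !ler0_norm ?lerN2 // ltW.
by rewrite f0 !sub0r => E; rewrite -normrN E normrM normrN ler_wpM2r.
Qed.

Lemma prim_bound f g t e : continuous f -> continuous g -> `|t| < 1 -> 0 <= e ->
  (forall s, `|f s - g s| <= e) -> `|prim f t - prim g t| <= e * `|t|.
Proof.
move=> cf cg t1 e0 fge; have [f0 Df] := primP cf; have [g0 Dg] := primP cg.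
apply: (@mean_value_bound (fun s => prim f s - prim g s) (fun s => f s - g s)) => //.
  by rewrite f0 g0 subrr.
move=> s st; have s1 := le_lt_trans st t1.
exact: is_derive_funB (Df s s1) (Dg s s1).
Qed.

Section PicardLindelof.
Variables (J : finType) (F : (J -> R) -> J -> R) (L : R) (u0 : J -> R).
Hypothesis L0 : 0 <= L.
Hypothesis FL : forall (u v : J -> R) e, (forall i, `|u i - v i| <= e) ->
  forall i, `|F u i - F v i| <= L * e.

(** This makes L T at most 1/2, so that one Picard step halves uniform distances, and also T < 1.
    Using L + 1 covers L = 0. *)
Let T : R := (2 * (L + 1))^-1.

Let L1 : 0 < L + 1. Proof. by rewrite ltr_wpDl. Qed.

Let T0 : 0 < T.
Proof. by rewrite invr_gt0 mulr_gt0// ltr_wpDl. Qed.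

Let TL : L * T <= 2^-1.
Proof.
by rewrite /T invfM mulrCA ler_piMr// ler_pdivrMr// mul1r lerDl.
Qed.

Let T1 : T < 1.
Proof. by rewrite /T invf_lt1 ?mulr_gt0//; move: L0; lra. Qed.

Lemma clampT t : `|clamp 0 T t| <= T.
Proof. by have := clamp_in 0 t (ltW T0); rewrite subr0. Qed.

Lemma clampT1 t : `|clamp 0 T t| < 1.
Proof. exact: le_lt_trans (clampT t) T1. Qed.

Definition curve_continuous (y : R -> J -> R) := forall i, continuous (fun s => y s i).

Lemma rhs_continuous y i : curve_continuous y -> continuous (fun s => F (y s) i).
Proof.
move=> cy s; apply/cvgrPdist_le => e e0.
have d0 : 0 < e / (L + 1) by rewrite divr_gt0// ltr_wpDl.
have H : \forall s' \near s, forall j, `|y s j - y s' j| <= e / (L + 1).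
  apply: (@filter_forall _ J (fun j s' => `|y s j - y s' j| <= e / (L + 1)) (nbhs s) _) => j.
  by have /cvgrPdist_le := cy j s; exact.
apply: filterS H => s' H.
apply: le_trans (FL H i) _.
by rewrite mulrCA ger_pMr// ler_pdivrMr// mul1r lerDl.
Qed.

(** Time is clamped to [-T, T], so curves live on the whole line and uniform estimates hold for
    every t; the integral equation is the original one for |t| <= T. *)
Definition picard_op (y : R -> J -> R) : R -> J -> R :=
  fun t i => u0 i + prim (fun s => F (y s) i) (clamp 0 T t).

Lemma picard_op_continuous y : curve_continuous y -> curve_continuous (picard_op y).
Proof.
move=> cy i t; have [_ D] := primP (rhs_continuous (i:=i) cy).
rewrite /continuous_at /picard_op; apply: cvgD; first exact: cvg_cst.
apply: (@continuous_comp _ _ _ (clamp 0 T)); first exact: clamp_continuous.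
exact: is_derive_continuous (D _ (clampT1 t)).
Qed.

Lemma picard_op_contract y z e : curve_continuous y -> curve_continuous z -> 0 <= e ->
  (forall t i, `|y t i - z t i| <= e) ->
  forall t i, `|picard_op y t i - picard_op z t i| <= e / 2.
Proof.
move=> cy cz e0 yz t i.
rewrite /picard_op opprD addrACA subrr add0r.
apply: le_trans (prim_bound (rhs_continuous (i:=i) cy) (rhs_continuous (i:=i) cz) (clampT1 t)
  (mulr_ge0 L0 e0) (fun s => FL (yz s) i)) _.
apply: (@le_trans _ _ (L * e * T)).
  by rewrite ler_wpM2l ?clampT// mulr_ge0.
by rewrite mulrAC mulrC ler_wpM2l.
Qed.

Lemma picard_op_derive y t i : curve_continuous y -> `|t| < T ->
  is_derive t 1 (fun s => picard_op y s i) (F (y t) i).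
Proof.
move=> cy tT; have [_ D] := primP (rhs_continuous (i:=i) cy).
apply: (@near_eq_is_derive _ _ _ (fun s => u0 i + prim (fun s => F (y s) i) s)).
  have : \forall s \near t, `|s| < T.
    have : `|t| < T by [].
    rewrite ltr_norml => tTT.
    have oI : open [set` `]-T, T[] by exact: itv_open.
    have : nbhs t [set` `]-T, T[] by apply: open_nbhs_nbhs; split => //=; rewrite in_itv.
    by apply: filterS => s /=; rewrite in_itv/= ltr_norml.
  by apply: filterS => s sT; rewrite /picard_op clamp_id// subr0 ltW.
apply: is_derive_eq (is_derive_funD (is_derive_cst (u0 i) t 1)
  (D t (lt_trans tT T1))) _.
by rewrite add0r.
Qed.

Fixpoint picard_iter (k : nat) : R -> J -> R :=
  if k is k'.+1 then picard_op (picard_iter k') else fun _ => u0.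

Lemma picard_iter_continuous k : curve_continuous (picard_iter k).
Proof.
elim: k => [|k IH]; first by move=> i t; exact: cst_continuous.
exact: picard_op_continuous.
Qed.

Let C : R := \sum_i `|F u0 i|.

Let C0 : 0 <= C.
Proof. by apply: sumr_ge0 => i _. Qed.

Let dist_k (k : nat) : R := C / 2 ^+ k.

Let dist_ge0 k : 0 <= dist_k k.
Proof. by rewrite divr_ge0// exprn_ge0. Qed.

Let dist_S k : dist_k k.+1 = dist_k k / 2.
Proof. by rewrite /dist_k exprS invfM; ring. Qed.

Lemma picard_iter_step k t i :
  `|picard_iter k.+1 t i - picard_iter k t i| <= dist_k k.
Proof.
elim: k t i => [|k IH] t i; last first.
  rewrite dist_S.
  exact: (picard_op_contract (@picard_iter_continuous k.+1) (@picard_iter_continuous k)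
    (dist_ge0 k) IH).
rewrite /= /picard_op addrC addKr /dist_k expr0 divr1.
have cf : continuous (fun _ : R => F u0 i) by move=> s; exact: cst_continuous.
have [p0 D] := primP cf.
have := @mean_value_bound (prim (fun=> F u0 i)) (fun=> F u0 i) (clamp 0 T t) `|F u0 i|.
move=> /(_ (normr_ge0 _) p0) H; apply: le_trans (H _ _) _ => //.
  by move=> s st; apply: D; apply: le_lt_trans st (clampT1 t).
apply: (@le_trans _ _ `|F u0 i|).
  by rewrite ler_piMr// ltW// clampT1.
by rewrite /C (bigD1 i)//= lerDl sumr_ge0.
Qed.

(* The successive differences are at most C / 2 ^ k, so lo increases and hi decreases
   with k, and the iterates converge to the supremum of lo. *)
Let lo k t i := picard_iter k t i - 2 * dist_k k.
Let hi k t i := picard_iter k t i + 2 * dist_k k.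

Let lo_mono t i k m : (k <= m)%N -> lo k t i <= lo m t i.
Proof.
move=> /subnK <-; elim: (m - k)%N => [|j IH]//; apply: le_trans IH _; rewrite addSn.
have := picard_iter_step (j + k) t i; rewrite ler_norml => /andP[h1 h2].
rewrite /lo dist_S; lra.
Qed.

Let hi_mono t i k m : (k <= m)%N -> hi m t i <= hi k t i.
Proof.
move=> /subnK <-; elim: (m - k)%N => [|j IH]//; apply: le_trans IH; rewrite addSn.
have := picard_iter_step (j + k) t i; rewrite ler_norml => /andP[h1 h2].
rewrite /hi dist_S; lra.
Qed.

Let lo_hi t i k m : lo k t i <= hi m t i.
Proof.
apply: (@le_trans _ _ (lo (maxn k m) t i)); first by apply: lo_mono; exact: leq_maxl.
apply: (@le_trans _ _ (hi (maxn k m) t i)); last by apply: hi_mono; exact: leq_maxr.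
have := dist_ge0 (maxn k m); rewrite /lo /hi; lra.
Qed.

Definition picard_sol t i : R := sup [set lo k t i | k in [set: nat]].

Lemma picard_sol_dist k t i : `|picard_sol t i - picard_iter k t i| <= 2 * dist_k k.
Proof.
rewrite ler_norml; apply/andP; split.
  rewrite lerBrDl -/(lo k t i); apply: ub_le_sup; last by exists k.
  by exists (hi 0%N t i) => _ [m _ <-]; exact: lo_hi.
rewrite lerBlDl; apply: ge_sup; first by exists (lo 0%N t i), 0%N.
by move=> _ [m _ <-]; exact: lo_hi.
Qed.

Lemma dist_small e : 0 < e -> exists k, 2 * dist_k k <= e.
Proof.
move=> e0; have [k Hk] : exists k : nat, 2 * C / e < k%:R.
  exists (Num.bound (2 * C / e)); apply: archi_boundP.
  by rewrite divr_ge0 ?mulr_ge0// ltW.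
exists k; rewrite /dist_k mulrA ler_pdivrMr ?exprn_gt0// [leRHS]mulrC -ler_pdivrMr//.
apply: le_trans (ltW Hk) _.
by rewrite -natrX ler_nat ltnW// ltn_expl.
Qed.

Lemma picard_sol_continuous : curve_continuous picard_sol.
Proof.
move=> i t; apply/cvgrPdist_le => e e0.
have [k Hk] := dist_small (divr_gt0 e0 (ltr0n R 3)).
have := @picard_iter_continuous k i t => /cvgrPdist_le /(_ (e / 3)).
rewrite divr_gt0// => /(_ isT); apply: filterS => s H.
have A := picard_sol_dist k t i; have B := picard_sol_dist k s i.
have -> : picard_sol t i - picard_sol s i = (picard_sol t i - picard_iter k t i)
  + (picard_iter k t i - picard_iter k s i) - (picard_sol s i - picard_iter k s i) by ring.
apply: le_trans (ler_normB _ _) _; apply: le_trans (lerD (ler_normD _ _) (lexx _)) _.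
lra.
Qed.

(** Both sides are close to the iterate k + 1: the left one by the choice of the limit, the right
    one because the operator halves the distance to the iterate k. *)
Lemma picard_sol_fix t i : picard_sol t i = picard_op picard_sol t i.
Proof.
apply/esym/subr0_eq/eqP; rewrite -normr_le0; apply/ler_addgt0Pr => e e0.
rewrite add0r; have [k Hk] := dist_small (divr_gt0 e0 (ltr0n R 2)).
have A := picard_op_contract picard_sol_continuous (@picard_iter_continuous k)
  (mulr_ge0 (ler0n _ 2) (dist_ge0 k)) (picard_sol_dist k) t i.
have B := picard_sol_dist k.+1 t i.
have -> : picard_op picard_sol t i - picard_sol t i
  = (picard_op picard_sol t i - picard_iter k.+1 t i)
    - (picard_sol t i - picard_iter k.+1 t i) by ring.
apply: le_trans (ler_normB _ _) _.
move: A B; rewrite dist_S /= => A B; apply: le_trans (lerD A B) _; lra.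
Qed.

Theorem picard_lindelof : exists (r : R) (y : R -> J -> R), [/\ 0 < r, y 0 = u0 &
  forall t i, `|t| < r -> is_derive t 1 (fun s => y s i) (F (y t) i)].
Proof.
exists T, picard_sol; split=> //.
  apply/funext => i; rewrite picard_sol_fix /picard_op clamp_id; last first.
    by rewrite subr0 normr0 ltW.
  by have [-> _] := primP (rhs_continuous (i:=i) picard_sol_continuous); rewrite addr0.
move=> t i tT.
rewrite (_ : (fun s => picard_sol s i) = fun s => picard_op picard_sol s i); last first.
  by apply/funext => s; exact: picard_sol_fix.
exact: picard_op_derive picard_sol_continuous tT.
Qed.

End PicardLindelof.
End Picard.

(** * Geodesics *)

Section BoundedLipschitz.
Variables (R : realType).

(** Boundedness is carried along because a product of Lipschitz functions is Lipschitz when the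
    factors are bounded. Distances are measured by the maximum over [J]. *)
Definition bdlip (J : finType) (f : (J -> R) -> R) : Prop :=
  exists2 K : R, 0 <= K & (forall u, `|f u| <= K) /\
    forall u v e, (forall i, `|u i - v i| <= e) -> `|f u - f v| <= K * e.

Variable J : finType.
Hypothesis J0 : (0 < #|J|)%N.
Implicit Types (f g : (J -> R) -> R).

(** Over an empty index set the bound would be vacuous and e could be negative. *)
Lemma sup_dist_ge0 (u v : J -> R) e : (forall i, `|u i - v i| <= e) -> 0 <= e.
Proof. by case/card_gt0P: J0 => i _ /(_ i); apply: le_trans. Qed.

Lemma bdlip_cst a : bdlip (fun _ : J -> R => a).
Proof.
exists `|a| => //; split=> // u v e /sup_dist_ge0 e0.
by rewrite subrr normr0 mulr_ge0.
Qed.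

Lemma bdlipD f g : bdlip f -> bdlip g -> bdlip (fun u => f u + g u).
Proof.
move=> [K K0 [fK fL]] [K' K'0 [gK gL]]; exists (K + K'); first exact: addr_ge0.
split=> [u|u v e uv]; first exact: le_trans (ler_normD _ _) (lerD (fK u) (gK u)).
rewrite opprD addrACA mulrDl.
exact: le_trans (ler_normD _ _) (lerD (fL _ _ _ uv) (gL _ _ _ uv)).
Qed.

Lemma bdlipM f g : bdlip f -> bdlip g -> bdlip (fun u => f u * g u).
Proof.
move=> [K K0 [fK fL]] [K' K'0 [gK gL]]; exists (K * K' + K * K' + K * K').
  by rewrite !addr_ge0 ?mulr_ge0.
split=> [u|u v e uv].
  rewrite normrM; apply: (@le_trans _ _ (K * K')); first exact: ler_pM.
  by rewrite lerDr addr_ge0 ?mulr_ge0.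
have e0 := sup_dist_ge0 uv.
have -> : f u * g u - f v * g v = (f u - f v) * g u + f v * (g u - g v) by ring.
apply: le_trans (ler_normD _ _) _; rewrite !normrM.
apply: (@le_trans _ _ (K * e * K' + K * (K' * e))).
  by apply: lerD; apply: ler_pM => //; [exact: fL|exact: gL].
rewrite -[leLHS]addr0.
have -> : (K * K' + K * K' + K * K') * e = K * e * K' + K * (K' * e) + K * K' * e by ring.
by rewrite lerD2l !mulr_ge0.
Qed.

Lemma bdlipN f : bdlip f -> bdlip (fun u => - f u).
Proof.
move=> [K K0 [fK fL]]; exists K => //; split=> [u|u v e uv]; first by rewrite normrN.
by rewrite -opprD normrN; exact: fL.
Qed.

Lemma bdlip_sum (I : Type) (r : seq I) (F : I -> (J -> R) -> R) :
  (forall i, bdlip (F i)) -> bdlip (fun u => \sum_(i <- r) F i u).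
Proof.
move=> bF; elim: r => [|i r IH].
  rewrite (_ : (fun u => _) = fun=> 0); first exact: bdlip_cst.
  by apply/funext => u; rewrite big_nil.
rewrite (_ : (fun u => _) = fun u => F i u + \sum_(j <- r) F j u).
  exact: bdlipD.
by apply/funext => u; rewrite big_cons.
Qed.

Lemma bdlip_clamp (a r : R) (i : J) : 0 <= r -> bdlip (fun u : J -> R => clamp a r (u i)).
Proof.
(* The values are bounded by |a| + r and the Lipschitz constant is 1. *)
move=> r0; exists (`|a| + r + 1); first by rewrite !addr_ge0.
split=> [u|u v e uv].
  have -> : clamp a r (u i) = a + (clamp a r (u i) - a) by ring.
  apply: le_trans (ler_normD _ _) _; rewrite -addrA lerD2l.
  by apply: le_trans (clamp_in _ _ r0) _; rewrite lerDl.
have e0 := sup_dist_ge0 uv.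
apply: le_trans (clamp_lip _ _ _ _) _; apply: le_trans (uv i) _.
by rewrite ler_peMl// lerDr addr_ge0.
Qed.

End BoundedLipschitz.

(** * Local Lipschitz estimates for smooth functions *)

Section LocalLipschitz.
Variables (R : realType) (n : nat).
Implicit Types (f : 'rV[R]_n -> R) (a x y : 'rV[R]_n).

Definition in_box a (r : R) x := forall i, `|x 0 i - a 0 i| <= r.

Lemma in_box_ball a r q x : 0 < q -> r < q -> in_box a r x -> `|x - a| < q.
Proof.
move=> q0 rq bx; rewrite [ltLHS]/Num.Def.normr/= mx_normrE.
apply: bigmax_lt => // -[i j] _; rewrite ord1 !mxE /=.
exact: le_lt_trans (bx j) rq.
Qed.

(** Near a the partial derivatives exceed their absolute values at a by at most 1; the mean value
    theorem is applied on the segment between two points, which stays in the convex box. The claim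
    is for all small r, so that finitely many functions can share a radius. *)
Lemma locally_lipschitz f a :
  (\forall x \near a, differentiable f x) ->
  (forall i, differentiable (partial i f) a) ->
  \forall r \near 0^'+, exists2 K : R, 0 <= K &
    forall x y, in_box a r x -> in_box a r y -> `|f x| <= K /\
      forall e, 0 <= e -> (forall i, `|x 0 i - y 0 i| <= e) -> `|f x - f y| <= K * e.
Proof.
move=> nf dp.
have np : \forall x \near a, forall i, `|partial i f x| <= `|partial i f a| + 1.
  apply: (@filter_forall _ 'I_n (fun i x => `|partial i f x| <= `|partial i f a| + 1)
    (nbhs a) _) => i.
  have := differentiable_continuous (dp i) => /cvgrPdist_le /(_ 1 ltr01).
  apply: filterS => x H; rewrite -lerBlDl; apply: le_trans H.
  by rewrite distrC; exact: lerB_dist.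
have : \forall x \near a, differentiable f x /\
    forall i, `|partial i f x| <= `|partial i f a| + 1 by exact: filterI nf np.
move=> /nbhs_normP[q /= q0 Hq].
near=> r.
have r0 : 0 < r by [].
have rq : r < q by near: r; exact: nbhs_right_lt.
pose K1 := \sum_i (`|partial i f a| + 1).
have K10 : 0 <= K1 by apply: sumr_ge0 => i _; rewrite addr_ge0.
have lip x y (e : R) : in_box a r x -> in_box a r y -> 0 <= e ->
    (forall i, `|x 0 i - y 0 i| <= e) -> `|f x - f y| <= K1 * e.
  move=> bx byy e0 xy.
  pose c (s : R) := y + s *: (x - y).
  have cb (s : R) : 0 <= s -> s <= 1 -> in_box a r (c s).
    move=> s0 s1 i; rewrite !mxE.
    have -> : y 0 i + s * (x 0 i - y 0 i) - a 0 i
      = (1 - s) * (y 0 i - a 0 i) + s * (x 0 i - a 0 i) by ring.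
    apply: le_trans (ler_normD _ _) _; rewrite !normrM (ger0_norm s0) ger0_norm ?subr_ge0//.
    have -> : r = (1 - s) * r + s * r by ring.
    by rewrite lerD// ler_wpM2l// subr_ge0.
  have cq (s : R) : 0 <= s -> s <= 1 -> differentiable f (c s) /\
      forall i, `|partial i f (c s)| <= `|partial i f a| + 1.
    move=> s0 s1; apply: Hq; rewrite /= distrC.
    exact: in_box_ball rq (cb s s0 s1).
  pose dphi s := \sum_i (x 0 i - y 0 i) * partial i f (c s).
  have D (s : R) : 0 <= s -> s <= 1 -> is_derive s 1 (fun u => f (c u)) (dphi s).
    move=> s0 s1; apply: is_derive_curve; first by have [] := cq s s0 s1.
    move=> k; rewrite (_ : (fun u => c u 0 k) = fun u => y 0 k + u * (x 0 k - y 0 k)).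
      apply: is_derive_eq (is_derive_funD (is_derive_cst _ s 1)
        (is_derive_funM (is_derive_id s 1) (is_derive_cst _ s 1))) _.
      by rewrite mul1r mulr0 addr0 add0r.
    by apply/funext => u; rewrite !mxE.
  have [||s /[!in_itv]/= /andP[s0 s1]] := @MVT_segment R (fun u => f (c u)) dphi 0 1 ler01.
  - by move=> s /[!in_itv]/= /andP[s0 s1]; apply: D; exact: ltW.
  - apply: derivable_within_continuous => s /[!in_itv]/= /andP[s0 s1].
    by have [] := D s s0 s1.
  have -> : c 1 = x by rewrite /c scale1r addrC subrK.
  have -> : c 0 = y by rewrite /c scale0r addr0.
  rewrite subr0 mulr1 => ->.
  apply: le_trans (ler_norm_sum _ _ _) _; rewrite /K1 mulr_suml.
  apply: ler_sum => i _; rewrite normrM mulrC; apply: ler_pM => //.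
  by have [_] := cq s s0 s1; exact.
(* K1 is the Lipschitz constant, and |f a| + K1 r bounds f on the box. *)
exists (K1 + (`|f a| + K1 * r)); first by rewrite !addr_ge0 ?mulr_ge0// ltW.
move=> x y bx byy; split.
  have ba : in_box a r a by move=> i; rewrite subrr normr0 ltW.
  have := lip x a r bx ba (ltW r0) bx; rewrite -[f x](subrK (f a)) => H.
  apply: le_trans (ler_normD _ _) _; rewrite addrC; apply: ler_wpDl => //.
  by rewrite lerD2l; move: H; rewrite subrK.
move=> e e0 xy; apply: le_trans (lip x y e bx byy e0 xy) _.
by rewrite ler_wpM2r// lerDl !addr_ge0 ?mulr_ge0// ltW.
Unshelve. all: by end_near. Qed.

End LocalLipschitz.

Section Geodesics.
Variables (R : realType) (n : nat) (M : manifold R n) (g : metric M).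
Implicit Types (c d : chart M) (p : M).

Section ChartCurve.
Variables (c : chart M) (I : set R) (gamma : R -> M) (w : 'I_n -> R -> R).
Hypothesis oI : open I.
Hypothesis cI : forall t, I t -> cdom c (gamma t).
Hypothesis gamma_cont : forall t, I t -> {for t, continuous gamma}.
Hypothesis gamma_der : forall t b, I t ->
  is_derive t 1 (fun u => cmap c (gamma u) 0 b) (w b t).
Hypothesis w_der : forall t b, I t -> is_derive t 1 (w b)
  (- \sum_(a < n) \sum_(e < n) christoffel g c b a e (gamma t) * w a t * w e t).

Lemma near_interval t : I t -> \forall u \near t, I u.
Proof. by move=> It; exact: open_nbhs_nbhs. Qed.

Lemma is_derive_along t f : I t -> dif c (gamma t) f ->
  is_derive t 1 (fun u => f (gamma u)) (\sum_(k < n) w k t * cder c k f (gamma t)).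
Proof.
move=> It df.
apply: (@near_eq_is_derive _ _ _ (fun u => (f \o cinv c) (cmap c (gamma u)))).
  have := near_interval It; apply: filterS => u Iu /=.
  by rewrite (cmapK (cI Iu)).
have H := @is_derive_curve _ _ (f \o cinv c) (fun u => cmap c (gamma u)) t
  (fun k => w k t) df (fun k => gamma_der k It).
exact: H.
Qed.

Section Velocity.
Variable d : chart M.

Let W b u := \sum_(k < n) w k u * jac c d (gamma u) b k.

Lemma velocity_chart t b : I t -> cdom d (gamma t) ->
  is_derive t 1 (fun u => cmap d (gamma u) 0 b) (W b t).
Proof.
move=> It dt.
have dd : dif c (gamma t) (fun q => cmap d q 0 b).
  exact: smooth_dif (@smooth_transition _ _ _ c d b) dt (cI It).
apply: is_derive_eq (is_derive_along It dd) _.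
by apply: eq_bigr => k _; rewrite jacE.
Qed.

(** The velocity in d is J w. Differentiating J along the curve yields dJ(w) w, which is exactly the
    inhomogeneous term of the transformation law of the Christoffel symbols. *)
Lemma acceleration_chart t b : I t -> cdom d (gamma t) ->
  is_derive t 1 (W b)
    (- \sum_(a < n) \sum_(e < n) christoffel g d b a e (gamma t) * W a t * W e t).
Proof.
move=> It dt; have ct := cI It; set p := gamma t in ct dt *.
have dJ k : dif c p (fun q => jac c d q b k) by exact: dif_jac.
have H := is_derive_fun_sum (index_enum 'I_n) (fun k =>
  is_derive_funM (w_der k It) (is_derive_along It (dJ k))).
apply: is_derive_eq H _; rewrite -/p big_split /=.
have -> : \sum_(k < n) - (\sum_(a < n) \sum_(e < n) christoffel g c k a e p * w a t * w e t)
     * jac c d p b k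
   = - \sum_(a < n) \sum_(e < n) w a t * w e t * (jac c d p *m conn g c a p) b e.
  under eq_bigr => k _ do rewrite mulNr mulr_suml.
  rewrite sumrN; congr (- _); rewrite exchange_big; apply: eq_bigr => a _.
  under eq_bigr => k _ do rewrite mulr_suml.
  rewrite exchange_big; apply: eq_bigr => e _.
  rewrite mxE mulr_sumr; apply: eq_bigr => k _; rewrite connE; ring.
have -> : \sum_(k < n) w k t * (\sum_(l < n) w l t * cder c l (fun q => jac c d q b k) p)
   = \sum_(a < n) \sum_(e < n) w a t * w e t * dmx c a (jac c d) p b e.
  under eq_bigr => k _ do rewrite mulr_sumr.
  rewrite exchange_big; apply: eq_bigr => a _; apply: eq_bigr => e _.
  by rewrite dmxE; ring.
have -> : \sum_(a < n) \sum_(e < n) w a t * w e t * dmx c a (jac c d) p b e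
   = \sum_(a < n) \sum_(e < n) w a t * w e t * (jac c d p *m conn g c a p) b e
     - \sum_(a < n) \sum_(e < n) w a t * w e t * (pconn g c d a p *m jac c d p) b e.
  rewrite -sumrB; apply: eq_bigr => a _; rewrite -sumrB; apply: eq_bigr => e _.
  have -> : (jac c d p *m conn g c a p) b e
      = dmx c a (jac c d) p b e + (pconn g c d a p *m jac c d p) b e.
    by rewrite (conn_chart g ct dt) [LHS]mxE.
  by ring.
rewrite addKr; congr (- _).
transitivity (\sum_(m < n) \sum_(s < n) christoffel g d b m s p
   * (\sum_(a < n) w a t * jac c d p m a) * (\sum_(e < n) w e t * jac c d p s e)); last by [].
transitivity (\sum_(a < n) \sum_(e < n) \sum_(m < n) \sum_(s < n)
   (christoffel g d b m s p * (w a t * jac c d p m a) * (w e t * jac c d p s e))).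
  apply: eq_bigr => a _; apply: eq_bigr => e _.
  rewrite /pconn mulmx_suml summxE mulr_sumr; apply: eq_bigr => m _.
  rewrite -scalemxAl [X in _ * X = _]mxE [X in _ * (_ * X) = _]mxE !mulr_sumr.
  apply: eq_bigr => s _; rewrite connE; ring.
under eq_bigr => a _ do rewrite exchange_big /=.
rewrite exchange_big /=; apply: eq_bigr => m _.
under eq_bigr => a _ do rewrite exchange_big /=.
rewrite exchange_big /=; apply: eq_bigr => s _.
rewrite [X in _ = X * _]mulr_sumr mulr_suml; apply: eq_bigr => a _.
by rewrite mulr_sumr.
Qed.

Lemma near_chart t : I t -> cdom d (gamma t) -> \forall u \near t, I u /\ cdom d (gamma u).
Proof.
move=> It dt; apply: filterI; first exact: near_interval.
exact: (gamma_cont It) (near_cdom dt).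
Qed.

End Velocity.

(** The equation is solved in the single chart c, but [geodesic] asks for it in every chart that the
    curve meets; the laws of velocity and acceleration supply it there. *)
Lemma geodesic_of_chart : geodesic g I gamma.
Proof.
split=> // d t It dt.
have near_vel b : \forall u \near t,
    derive1 (fun u => cmap d (gamma u) 0 b) u = \sum_(k < n) w k u * jac c d (gamma u) b k.
  have := near_chart It dt; apply: filterS => u [Iu du].
  by rewrite derive1E; have [_ ->] := velocity_chart b Iu du.
have acc b := acceleration_chart b It dt.
have vel b := velocity_chart b It dt.
have acc' b : is_derive t 1 (derive1 (fun u => cmap d (gamma u) 0 b))
    (- \sum_(a < n) \sum_(e < n) christoffel g d b a e (gamma t)
     * (\sum_(k < n) w k t * jac c d (gamma t) a k)
     * (\sum_(k < n) w k t * jac c d (gamma t) e k)).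
  apply: near_eq_is_derive (acc b).
  by apply: filterS (near_vel b) => u ->.
split=> [b|b]; first by split; [have [] := vel b | have [] := acc' b].
rewrite derive1E; have [_ ->] := acc' b; rewrite addrC; apply/eqP; rewrite subr_eq0; apply/eqP.
apply: eq_bigr => a _; apply: eq_bigr => e _.
by rewrite !derive1E; have [_ ->] := vel a; have [_ ->] := vel e.
Qed.

End ChartCurve.
End Geodesics.

(** * Local existence of geodesics *)

Section GeodesicExistence.
Variables (R : realType) (n : nat) (M : manifold R n) (g : metric M).
Variables (c : chart M) (p : M) (cp : cdom c p) (w0 : 'I_n -> R).
Hypothesis n0 : (0 < n)%N.

Let J : finType := ('I_n + 'I_n)%type.

Let J0 : (0 < #|J|)%N.
Proof. by rewrite card_sum card_ord addn_gt0 n0. Qed.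

Let u0 (i : J) : R := match i with inl b => cmap c p 0 b | inr b => w0 b end.

Section Field.
Variable r : R.
Hypothesis r0 : 0 < r.

(** A state consists of position and velocity. Clamping it to the box of radius r about the initial
    state makes the geodesic field globally Lipschitz and keeps positions where the Christoffel
    symbols are controlled. *)
Let cl (u : J -> R) (i : J) : R := clamp (u0 i) r (u i).

Let pos (u : J -> R) : 'rV[R]_n := \row_b cl u (inl b).

Let F (u : J -> R) (i : J) : R :=
  match i with
  | inl b => cl u (inr b)
  | inr b => - \sum_(a < n) \sum_(e < n)
      christoffel g c b a e (cinv c (pos u)) * cl u (inr a) * cl u (inr e)
  end.

Hypothesis Gam_lip : forall b a e, exists2 K : R, 0 <= K &
  forall x y, in_box (cmap c p) r x -> in_box (cmap c p) r y ->
    `|(christoffel g c b a e \o cinv c) x| <= K /\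
    forall eps, 0 <= eps -> (forall i, `|x 0 i - y 0 i| <= eps) ->
    `|(christoffel g c b a e \o cinv c) x - (christoffel g c b a e \o cinv c) y| <= K * eps.

Lemma field_bdlip i : bdlip (F ^~ i).
Proof.
have cl_bd j : bdlip (cl ^~ j) by exact: bdlip_clamp (ltW r0).
have pos_box u : in_box (cmap c p) r (pos u).
  by move=> b; rewrite mxE; exact: clamp_in (ltW r0).
case: i => b; first exact: cl_bd.
apply: bdlipN; apply: bdlip_sum => // a; apply: bdlip_sum => // e.
apply: bdlipM => //; apply: bdlipM => //.
have [K K0 HK] := Gam_lip b a e; exists K => //.
split=> [u|u v eps uv]; first by have [] := HK _ _ (pos_box u) (pos_box u).
have [_ H] := HK _ _ (pos_box u) (pos_box v); apply: H; first exact: sup_dist_ge0 uv.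
move=> j; rewrite !mxE; apply: le_trans (uv (inl j)).
exact: clamp_lip.
Qed.

Lemma field_solution : exists (r1 : R) (y : R -> J -> R), [/\ 0 < r1, y 0 = u0 &
  forall t, `|t| < r1 -> (forall i, `|y t i - u0 i| <= r) /\
    (forall b, is_derive t 1 (fun s => y s (inl b)) (y t (inr b))) /\
    forall b, is_derive t 1 (fun s => y s (inr b)) (- \sum_(a < n) \sum_(e < n)
      christoffel g c b a e (cinv c (\row_k y t (inl k))) * y t (inr a) * y t (inr e))].
Proof.
have [L L0 FL] : exists2 L : R, 0 <= L & forall (u v : J -> R) e,
    (forall i, `|u i - v i| <= e) -> forall i, `|F u i - F v i| <= L * e.
  pose Ki i := sval (cid2 (field_bdlip i)).
  have KiP i : 0 <= Ki i /\ forall u v e, (forall i, `|u i - v i| <= e) ->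
      `|F u i - F v i| <= Ki i * e.
    by rewrite /Ki; case: (cid2 _) => K /= K0 [_ H].
  exists (\sum_i Ki i); first by apply: sumr_ge0 => i _; have [] := KiP i.
  move=> u v e uv i; have e0 := sup_dist_ge0 J0 uv.
  have [_ H] := KiP i; apply: le_trans (H _ _ _ uv) _; rewrite ler_wpM2r//.
  by rewrite (bigD1 i)//= lerDl sumr_ge0// => j _; have [] := KiP j.
have [r1 [y [r10 y0 yD]]] := picard_lindelof u0 L0 FL.
(* By continuity the solution stays in the box for a short time, and there clamping changes
   nothing. *)
have nb : \forall t \near (0 : R), forall i, `|u0 i - y t i| <= r.
  apply: (@filter_forall _ J (fun i t => `|u0 i - y t i| <= r) (nbhs (0 : R)) _) => i.
  have y0i : {for (0 : R), continuous (fun s => y s i)}.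
    by apply: is_derive_continuous (yD 0 i _); rewrite normr0.
  by move: y0i => /cvgrPdist_le /(_ r r0); rewrite y0.
have /nbhs_normP[r2 /= r20 Hr2] := nb.
exists (Num.min r1 r2), y; split=> //; first by rewrite lt_min r10.
move=> t; rewrite lt_min => /andP[t1 t2].
have yb i : `|y t i - u0 i| <= r.
  by rewrite distrC; apply: Hr2 => /=; rewrite sub0r normrN.
have clE i : cl (y t) i = y t i by exact: clamp_id.
have posE : pos (y t) = \row_k y t (inl k) by apply/rowP => k; rewrite !mxE clE.
split=> //; split=> b; first by apply: is_derive_eq (yD t (inl b) t1) (clE (inr b)).
apply: is_derive_eq (yD t (inr b) t1) _; rewrite /F posE; congr (- _).
by apply: eq_bigr => a _; apply: eq_bigr => e _; rewrite !clE.
Qed.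

End Field.

Theorem geodesic_exists : exists (I : set R) (gamma : R -> M) (w : 'I_n -> R -> R),
  [/\ open_interval I /\ I 0, gamma 0 = p /\ (forall b, w b 0 = w0 b),
      forall t, I t -> cdom c (gamma t) /\
        forall b, is_derive t 1 (fun u => cmap c (gamma u) 0 b) (w b t),
      forall t b, I t -> is_derive t 1 (w b)
       (- \sum_(a < n) \sum_(e < n) christoffel g c b a e (gamma t) * w a t * w e t)
    & geodesic g I gamma].
Proof.
have Gam_near : \forall r \near 0^'+, forall bae : 'I_n * 'I_n * 'I_n,
    exists2 K : R, 0 <= K &
    forall x y, in_box (cmap c p) r x -> in_box (cmap c p) r y ->
    `|(christoffel g c bae.1.1 bae.1.2 bae.2 \o cinv c) x| <= K /\
    forall eps, 0 <= eps -> (forall i, `|x 0 i - y 0 i| <= eps) ->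
    `|(christoffel g c bae.1.1 bae.1.2 bae.2 \o cinv c) x
      - (christoffel g c bae.1.1 bae.1.2 bae.2 \o cinv c) y| <= K * eps.
  apply: filter_forall => -[[b a] e] /=.
  have sG := @smooth_christoffel _ _ _ g c b a e.
  have Dp : (cmap c @` (setT `&` cdom c)) (cmap c p) by exists p.
  apply: locally_lipschitz.
    by apply: (near_open (open_sdom (c:=c) openT)) => // x; exact: (sG [::]).
  by move=> i; exact: (sG [:: i]).
have /nbhs_normP[q /= q0 Hq] := near_img cp.
have [r [r0 [rq Gr]]] := filter_ex (filterI (nbhs_right_gt (0 : R))
  (filterI (nbhs_right_lt q0) Gam_near)).
have {}Gr b a e := Gr (b, a, e).
have [r1 [y [r10 y0 yD]]] := field_solution r0 Gr.
pose x t : 'rV[R]_n := \row_k y t (inl k).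
have yI t : `|t| < r1 -> (cmap c @` cdom c) (x t).
  move=> t1; apply: Hq; rewrite /= distrC; apply: in_box_ball q0 rq _ => k.
  by rewrite mxE; have [+ _] := yD t t1 => /(_ (inl k)).
pose I := [set` `]- r1, r1[].
have IE t : I t -> `|t| < r1 by rewrite /I /= in_itv /= ltr_norml.
pose gamma t := cinv c (x t).
have cg t : I t -> cdom c (gamma t) /\ cmap c (gamma t) = x t.
  by move=> /IE/yI [q' cq' qx]; rewrite /gamma -qx cmapK.
have oI : open I by exact: itv_open.
have nI t : I t -> \forall u \near t, I u by move=> It; exact: open_nbhs_nbhs.
have D1 t b : I t -> is_derive t 1 (fun u => cmap c (gamma u) 0 b) (y t (inr b)).
  move=> It; have [_ [H _]] := yD t (IE t It).
  apply: near_eq_is_derive (H b); apply: filterS (nI t It) => u Iu.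
  by have [_ ->] := cg u Iu; rewrite mxE.
have D2 t b : I t -> is_derive t 1 (fun s => y s (inr b)) (- \sum_(a < n) \sum_(e < n)
      christoffel g c b a e (gamma t) * y t (inr a) * y t (inr e)).
  by move=> It; have [_ [_ H]] := yD t (IE t It); exact: H.
exists I, gamma, (fun b t => y t (inr b)); split=> //.
- split; last by rewrite /I /= in_itv /= oppr_lt0 r10.
  by split=> //; exact: interval_is_interval.
- split; last by move=> b; rewrite y0.
  rewrite /gamma (_ : x 0 = cmap c p) ?cmapK//.
  by apply/rowP => k; rewrite mxE y0.
- by move=> t It; split; [have [] := cg t It | move=> b; exact: D1].
apply: (@geodesic_of_chart _ _ _ g c I gamma (fun b t => y t (inr b))) => //.
  by move=> t It; have [] := cg t It.
move=> t It; apply: (@continuous_comp _ _ _ x).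
  apply: differentiable_continuous; apply/derivable1_diffP/derivable_mxP => i k.
  rewrite ord1 (_ : (fun u => x u 0 k) = fun u => y u (inl k)).
    by have [_ [H _]] := yD t (IE t It); have [] := H k.
  by apply/funext => u; rewrite mxE.
by apply: cinv_continuous; exact: yI (IE t It).
Qed.

End GeodesicExistence.

(** * Weyl's theorem *)

Section WeylTheorem.
Variables (R : realType) (n : nat).

(* A symmetric D with D(w, w) always a multiple of w is U w + w U: compare the
   coefficients of D(w, w) = lambda w for w = e_i and w = e_i +- e_j. *)
Lemma quadratic_parallel (D : 'I_n -> 'I_n -> 'I_n -> R) :
  (forall b a e, D b a e = D b e a) ->
  (forall w : 'I_n -> R, exists lam, forall b,
     \sum_a \sum_e D b a e * w a * w e = lam * w b) ->
  exists U : 'I_n -> R, forall b a e, D b a e = (b == a)%:R * U e + (b == e)%:R * U a.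
Proof.
move=> symD Dw.
have Q (x y : 'I_n) (s : R) b : \sum_a \sum_e D b a e * ((a == x)%:R + s * (a == y)%:R)
      * ((e == x)%:R + s * (e == y)%:R)
    = D b x x + s * D b x y + s * D b y x + s * s * D b y y.
  have E a : \sum_e D b a e * ((a == x)%:R + s * (a == y)%:R) * ((e == x)%:R + s * (e == y)%:R)
     = ((a == x)%:R + s * (a == y)%:R) * (D b a x + s * D b a y).
    have -> : D b a x + s * D b a y = \sum_e D b a e * (e == x)%:R
        + s * \sum_e D b a e * (e == y)%:R.
      by rewrite !(sum_deltar (fun e => D b a e)).
    rewrite mulr_sumr -big_split /= mulr_sumr; apply: eq_bigr => e _; ring.
  under eq_bigr => a _ do rewrite E.
  transitivity (\sum_a (D b a x + s * D b a y) * (a == x)%:R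
      + s * \sum_a (D b a x + s * D b a y) * (a == y)%:R).
    rewrite mulr_sumr -big_split /=; apply: eq_bigr => a _; ring.
  rewrite (sum_deltar (fun a => D b a x + s * D b a y)).
  by rewrite (sum_deltar (fun a => D b a x + s * D b a y)); ring.
have H (x y : 'I_n) (s : R) : exists lam, forall b,
    D b x x + 2 * s * D b x y + s * s * D b y y = lam * ((b == x)%:R + s * (b == y)%:R).
  have [lam L] := Dw (fun a => (a == x)%:R + s * (a == y)%:R).
  by exists lam => b; rewrite -L Q (symD b y x); ring.
pose lam x := D x x x.
have Dxx x b : D b x x = lam x * (b == x)%:R.
  have [l L] := H x x 0.
  have := L x; have := L b; rewrite eqxx /lam !(mul0r, mulr0, addr0, mulr1) => -> ->.
  by [].
(* Take w = e_x + e_y and w = e_x - e_y. Their components x and y form four equations that eliminate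
   both multipliers and give lam y / 2 and lam x / 2; in any other component the right-hand sides
   vanish. *)
have Dxy x y b : x != y -> D b x y = 2^-1 * ((b == x)%:R * lam y + (b == y)%:R * lam x).
  move=> xy; have [l1 L1] := H x y 1; have [l2 L2] := H x y (-1).
  have xyF : (x == y) = false by exact: negbTE.
  have yxF : (y == x) = false by rewrite eq_sym.
  have := L1 x; have := L1 y; have := L2 x; have := L2 y.
  rewrite !Dxx !eqxx xyF yxF /= => A1 A2 A3 A4.
  have [->|bx] := eqVneq b x; first by rewrite xyF /=; lra.
  have [->|by'] := eqVneq b y; first by rewrite /=; lra.
  have := L1 b; rewrite !Dxx (negbTE bx) (negbTE by') /= => B.
  by lra.
exists (fun x => lam x / 2) => b a e.
have [->|ae] := eqVneq a e; first by rewrite Dxx; field.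
by rewrite Dxy//; field.
Qed.

Variables (M : manifold R n) (g h : metric M).
Hypothesis n0 : (0 < n)%N.
Hypothesis gh : geodesics_reparam g h.

Lemma christoffel_diff_parallel c p (w0 : 'I_n -> R) : cdom c p ->
  exists lam, forall b, \sum_a \sum_e
    (christoffel h c b a e p - christoffel g c b a e p) * w0 a * w0 e = lam * w0 b.
Proof.
move=> cp; have [I [gamma [w [[oI I0] [g0 w0E] cI wD geo]]]] := geodesic_exists g cp w0 n0.
have [J [s [[oJ _] [[fJ _ sJ] sD] [_ geoh]]]] := gh oI geo.
(* The parameter at which the geodesic of h passes through p; it exists because s is onto I. *)
have [t0 Jt0 st0] := sJ 0 I0.
have nJ : \forall u \near t0, J u by exact: open_nbhs_nbhs.
have ct0 : cdom c ((gamma \o s) t0) by rewrite /= st0 g0.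
have [_ eqh] := geoh c t0 Jt0 ct0.
have s1 u : J u -> is_derive u 1 s (derive1 s u).
  by move=> Ju; have [d _ _] := sD u Ju; rewrite derive1E; exact: derivableP.
have [_ ds2 s0] := sD t0 Jt0.
have s2 : is_derive t0 1 (derive1 s) (derive1 (derive1 s) t0).
  by rewrite [derive1 (derive1 s) t0]derive1E; exact: derivableP.
have x1 u b : J u -> is_derive u 1 (fun v => cmap c ((gamma \o s) v) 0 b)
    (w b (s u) * derive1 s u).
  move=> Ju; have [_ H] := cI _ (fJ u Ju).
  exact: (@is_derive1_comp _ (fun v => cmap c (gamma v) 0 b) s u _ _ (H b) (s1 u Ju)).
have x1E u b : J u -> derive1 (fun v => cmap c ((gamma \o s) v) 0 b) u
    = w b (s u) * derive1 s u.
  by move=> Ju; rewrite derive1E; have [_ ->] := x1 u b Ju.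
set s' := derive1 s t0 in s0 s1 *; set s'' := derive1 (derive1 s) t0 in s2.
have x2 b : derive1 (derive1 (fun v => cmap c ((gamma \o s) v) 0 b)) t0
   = - (\sum_a \sum_e christoffel g c b a e p * w0 a * w0 e) * s' * s' + w0 b * s''.
  rewrite derive1E.
  have I0' : I (s t0) by rewrite st0.
  have D1 : is_derive t0 1 (fun u => w b (s u)) (- (\sum_a \sum_e
      christoffel g c b a e (gamma (s t0)) * w a (s t0) * w e (s t0)) * s').
    exact: (@is_derive1_comp _ (w b) s t0 _ _ (wD (s t0) b I0') (s1 t0 Jt0)).
  have D2 := is_derive_funM D1 s2.
  have nE : \forall u \near t0, w b (s u) * derive1 s u
      = derive1 (fun v => cmap c ((gamma \o s) v) 0 b) u.
    by apply: filterS nJ => u Ju; rewrite x1E.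
  have [_ ->] := near_eq_is_derive nE D2; rewrite st0 g0 w0E; congr (- _ * _ * _ + _).
  by apply: eq_bigr => a _; apply: eq_bigr => e _; rewrite !w0E.
(* The geodesic equation of h at p, with that of g inserted, reads s'' w0 + s'^2 (Gamma_h -
   Gamma_g)(w0, w0) = 0, and s' is nonzero. *)
exists (- s'' / (s' * s')) => b; have := eqh b; rewrite x2.
have gs : (gamma \o s) t0 = p by rewrite /= st0.
have -> : \sum_a \sum_e christoffel h c b a e ((gamma \o s) t0)
     * derive1 (fun v => cmap c ((gamma \o s) v) 0 a) t0
     * derive1 (fun v => cmap c ((gamma \o s) v) 0 e) t0
   = (\sum_a \sum_e christoffel h c b a e p * w0 a * w0 e) * (s' * s').
  rewrite mulr_suml; apply: eq_bigr => a _; rewrite mulr_suml.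
  by apply: eq_bigr => e _; rewrite !(x1E _ _ Jt0) gs st0 !w0E -/s'; ring.
have -> : \sum_a \sum_e (christoffel h c b a e p - christoffel g c b a e p) * w0 a * w0 e
  = \sum_a \sum_e christoffel h c b a e p * w0 a * w0 e
    - \sum_a \sum_e christoffel g c b a e p * w0 a * w0 e.
  rewrite -sumrB; apply: eq_bigr => a _; rewrite -sumrB.
  by apply: eq_bigr => e _; ring.
move: (\sum_a _) (\sum_a _) => X Y E.
have ss : s' * s' != 0 by rewrite mulf_neq0.
apply: (mulIf ss).
rewrite mulrAC divfK//.
rewrite mulrBl; move: E; rewrite -mulrA => E.
by apply/subr0_eq; rewrite -E; ring.
Qed.

Theorem proj_conn c p k : cdom c p ->
  conn h c k p = conn g c k p + upsilon_mx g h c k p.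
Proof.
move=> cp.
pose D b a e := christoffel h c b a e p - christoffel g c b a e p.
have symD b a e : D b a e = D b e a.
  by rewrite /D -!connE (conn_sym h a)// (conn_sym g a).
have [U HU] := quadratic_parallel symD (fun w => christoffel_diff_parallel w cp).
(* Taking the trace identifies the covector found algebraically with the normalised difference of
   traces. *)
have UE a : upsilon g h c p 0 a = U a.
  rewrite mxE -sumrB.
  under eq_bigr => b _ do rewrite -/(D b a b) HU eqxx mul1r.
  rewrite big_split /= sumr_const card_ord.
  have -> : \sum_(i < n) (i == a)%:R * U i = U a.
    by rewrite -[RHS](sum_deltar U a); apply: eq_bigr => i _; rewrite mulrC.
  by rewrite -mulrS -[U a *+ _]mulr_natl mulKf// pnatr_eq0.
apply/matrixP => b e; rewrite [RHS]mxE upsilon_mxE !UE !connE.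
have := HU b k e; rewrite /D => /eqP; rewrite subr_eq addrC => /eqP ->.
by rewrite [(b == e)%:R * _]mulrC.
Qed.

End WeylTheorem.

(** * Densities *)

Section Jacobi.
Variables (R : realType) (n : nat) (M : manifold R n) (c : chart M) (p : M).
Hypothesis cp : cdom c p.

Lemma dif_prod (I : Type) (r : seq I) (P : pred I) (F : I -> M -> R) :
  (forall i, dif c p (F i)) -> dif c p (fun q => \prod_(i <- r | P i) F i q).
Proof.
move=> dF; elim: r => [|i r IH].
  rewrite (_ : (fun q => _) = fun=> 1); first exact: dif_cst.
  by apply/funext => q; rewrite big_nil.
case Pi : (P i).
  rewrite (_ : (fun q => _) = fun q => F i q * \prod_(i <- r | P i) F i q).
    exact: difM.
  by apply/funext => q; rewrite big_cons Pi.
rewrite (_ : (fun q => _) = fun q => \prod_(i <- r | P i) F i q)//.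
by apply/funext => q; rewrite big_cons Pi.
Qed.

Lemma cder_prod k (I : eqType) (r : seq I) (F : I -> M -> R) : uniq r ->
  (forall i, dif c p (F i)) ->
  cder c k (fun q => \prod_(i <- r) F i q) p
  = \sum_(i <- r) cder c k (F i) p * \prod_(j <- r | j != i) F j p.
Proof.
move=> + dF; elim: r => [_|i r IH /= /andP[ir ur]].
  rewrite big_nil (@eq_cder _ _ _ _ _ _ (fun=> 1)) ?cder_cst// => q.
  by rewrite big_nil.
rewrite (@eq_cder _ _ _ _ _ _ (fun q => F i q * \prod_(j <- r) F j q)); last first.
  by move=> q; rewrite big_cons.
have dP : dif c p (fun q => \prod_(j <- r) F j q) by exact: dif_prod.
rewrite (cderM k cp (dF i) dP) IH// !big_cons eqxx /=; congr (_ * _ + _).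
  rewrite [RHS]big_seq_cond [LHS]big_seq; apply: eq_bigl => j.
  by case: (boolP (j \in r)) => //= jr; apply/esym; apply: contraNneq ir => <-.
rewrite mulr_sumr; apply: eq_big_seq => j jr.
rewrite big_cons ifT; last by apply: contraNneq ir => ->.
by rewrite mulrCA.
Qed.

Lemma dif_det m (A : M -> 'M[R]_m) : difmx c p A -> dif c p (fun q => \det (A q)).
Proof.
move=> dA; rewrite /determinant; apply: dif_sum => s _.
by apply: difM; [exact: dif_cst | exact: dif_prod].
Qed.

(** Jacobi's formula. The product rule writes the derivative as a sum of determinants with one row
    differentiated; Laplace expansion along that row gives the trace against the adjugate. *)
Lemma cder_det k m (A : M -> 'M[R]_m) : difmx c p A -> A p \in unitmx ->
  cder c k (fun q => \det (A q)) p = \det (A p) * \tr (invmx (A p) *m dmx c k A p).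
Proof.
move=> dA uA.
have dprod (s : {perm 'I_m}) : dif c p (fun q => \prod_i A q i (s i)).
  by apply: dif_prod => i; exact: dA.
rewrite (@eq_cder _ _ _ _ _ _ (fun q => \sum_(s : {perm 'I_m}) (-1) ^+ s * \prod_i A q i (s i)))//.
rewrite cder_sum; last by move=> s _; apply: difM => //; exact: dif_cst.
have E (s : {perm 'I_m}) : cder c k (fun q => (-1) ^+ s * \prod_i A q i (s i)) p
   = \sum_i (-1) ^+ s * (dmx c k A p i (s i) * \prod_(j | j != i) A p j (s j)).
  rewrite (cderM k cp (dif_cst c p _) (dprod s)) cder_cst mul0r add0r.
  rewrite cder_prod ?index_enum_uniq// mulr_sumr.
  by apply: eq_bigr => i _; rewrite dmxE.
rewrite (eq_bigr _ (fun s _ => E s)) exchange_big /=.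
pose B i : 'M[R]_m := \matrix_(a, b) if a == i then dmx c k A p a b else A p a b.
transitivity (\sum_i \det (B i)).
  apply: eq_bigr => i _; apply: eq_bigr => s _; congr (_ * _).
  rewrite [RHS](bigD1 i)//= mxE eqxx; congr (_ * _); apply: eq_bigr => j ji.
  by rewrite mxE (negbTE ji).
transitivity (\tr (dmx c k A p *m \adj (A p))); last first.
  rewrite mxtrace_mulC /invmx uA -scalemxAl mxtraceZ mulrA divff ?mul1r//.
  by rewrite -unitfE -unitmxE.
apply: eq_bigr => i _; rewrite (expand_det_row _ i) mxE; apply: eq_bigr => j _.
rewrite [B i i j]mxE eqxx; congr (_ * _); rewrite [RHS]mxE /cofactor; congr (_ * \det _).
apply/matrixP => a b; rewrite !mxE.
by rewrite eq_sym (negbTE (neq_lift _ _)).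
Qed.

End Jacobi.

Definition wt (R : realType) (n : nat) : R := 1 / n.+1%:R.

(* transition function of E(1) *)
HB.lock Definition dens_trans (R : realType) (n : nat) (M : manifold R n)
    (c d : chart M) (p : M) : R := `|\det (jac c d p)| `^ wt R n.

(* Densities of every 1-jet at p: a tractor field is only constrained through its
   pairing with local densities, so its transformation law needs enough of them. *)
HB.lock Definition affine_dens (R : realType) (n : nat) (M : manifold R n)
    (c : chart M) (p : M) (al : R) (be : 'I_n -> R) : chart M -> M -> R :=
  fun e q => dens_trans c e q * (al + \sum_(k < n) be k * (cmap c q 0 k - cmap c p 0 k)).

Section Densities.
Variables (R : realType) (n : nat) (M : manifold R n).
Implicit Types (c d e : chart M) (p : M) (O : set M).

Local Notation wt := (wt R n).

Lemma dens_transE c d p : dens_trans c d p = `|\det (jac c d p)| `^ wt.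
Proof. by rewrite dens_trans.unlock. Qed.

Lemma dens_trans_gt0 c d p : cdom c p -> cdom d p -> 0 < dens_trans c d p.
Proof.
move=> cp dp; rewrite dens_transE powR_gt0// normr_gt0 -unitfE -unitmxE.
exact: jac_unit.
Qed.

Lemma dens_trans_cocycle c d e p : cdom c p -> cdom d p -> cdom e p ->
  dens_trans c e p = dens_trans d e p * dens_trans c d p.
Proof.
move=> cp dp ep; rewrite !dens_transE (jac_cocycle cp dp ep) det_mulmx normrM.
by rewrite powRM.
Qed.

Lemma dens_trans_id c p : cdom c p -> dens_trans c c p = 1.
Proof. by move=> cp; rewrite dens_transE jac_id// det1 normr1 powR1. Qed.

Section AtPoint.
Variables (c d : chart M) (p : M).
Hypothesis (cp : cdom c p) (dp : cdom d p).
Local Notation J := (jac c d).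

Lemma det_jac_neq0 : \det (J p) != 0.
Proof. by rewrite -unitfE -unitmxE; exact: jac_unit. Qed.

(** By Jacobi's formula, the derivative of log |det J|. *)
Definition log_jac a : R := \tr (invmx (J p) *m dmx c a J p).

Lemma dif_dens_trans : dif c p (dens_trans c d).
Proof.
have -> : dens_trans c d = fun q => `|\det (J q)| `^ wt.
  by apply/funext => q; exact: dens_transE.
apply: (differentiable_comp1 (h := fun y => `|y| `^ wt) (f := (fun q => \det (J q)) \o cinv c)).
  by apply: dif_det; exact: dif_jac.
rewrite /= cmapK//; by have [] := is_derive_abs_powR wt det_jac_neq0.
Qed.

Lemma cder_dens_trans a :
  cder c a (dens_trans c d) p = dens_trans c d p * (wt * log_jac a).
Proof.
have dJ := dif_jac (c:=c) (d:=d) cp dp.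
rewrite (eq_cder _ _ _ (dens_transE c d)).
rewrite (cder_comp1 (h := fun y => `|y| `^ wt) a cp (dif_det dJ)
  (is_derive_abs_powR wt det_jac_neq0)).
rewrite (cder_det cp a dJ (jac_unit cp dp)) -/(log_jac a) -dens_transE.
by field; exact: det_jac_neq0.
Qed.

Lemma christoffel_tr_chart (g : metric M) a : christoffel_tr g c a p
  = \sum_(m < n) J p m a * christoffel_tr g d m p + log_jac a.
Proof.
rewrite christoffel_trE -[conn g c a p](mulKmx (jac_unit cp dp)) conn_chart// mulmxDr.
rewrite linearD addrC /=; congr (_ + _).
rewrite mxtrace_mulC mulmxK ?jac_unit// /pconn linear_sum /=; apply: eq_bigr => m _.
by rewrite linearZ /= christoffel_trE.
Qed.

(** The derivative of the transition function contributes [log_jac] with the factor 1 / (n + 1), and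
    so does the inhomogeneous term of the trace of the connection, with the opposite effect. *)
Lemma nabla_dens_chart (g : metric M) O s a : open O -> density_on 1 O s -> O p ->
  \sum_(b < n) J p b a * nabla_dens g 1 d b (s d) p
  = dens_trans c d p * nabla_dens g 1 c a (s c) p.
Proof.
move=> oO [sO sE] Op.
have dsd : dif d p (s d) by exact: smooth_dif (sO d) Op dp.
have dsc : dif c p (s c) by exact: smooth_dif (sO c) Op cp.
have nE : \forall q \near p, s d q = dens_trans c d q * s c q.
  have nO : \forall q \near p, O q by exact: open_nbhs_nbhs.
  have n1 := near_cdom cp; have n2 := near_cdom dp.
  by near=> q; rewrite dens_transE; apply: sE; near: q.
have sdp := nbhs_singleton nE.
have E : \sum_(b < n) J p b a * cder d b (s d) p
   = dens_trans c d p * (wt * log_jac a) * s c p + dens_trans c d p * cder c a (s c) p.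
  rewrite -(cder_chart a cp dp dsd) (cder_ext a cp nE).
  by rewrite (cderM a cp dif_dens_trans dsc) cder_dens_trans.
rewrite /nabla_dens; under eq_bigr => b _ do rewrite mulrDr.
rewrite big_split /= E (christoffel_tr_chart g a) -/wt.
have -> : \sum_(i < n) J p i a * (wt * christoffel_tr g d i p * s d p)
    = wt * s d p * \sum_(m < n) J p m a * christoffel_tr g d m p.
  by rewrite mulr_sumr; apply: eq_bigr => m _; ring.
by rewrite sdp; ring.
Unshelve. all: by end_near. Qed.

End AtPoint.

Lemma affine_densE' c p al be e q : affine_dens c p al be e q
  = dens_trans c e q * (al + \sum_(k < n) be k * (cmap c q 0 k - cmap c p 0 k)).
Proof. by rewrite affine_dens.unlock. Qed.

Lemma affine_dens_on c p al be : density_on 1 (cdom c) (affine_dens c p al be).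
Proof.
split=> [e|d e q cq dq eq].
  have oc := @cdom_open _ _ _ c.
  apply: (smooth_ext oc (f := fun q => dens_trans c e q
    * (al + \sum_(k < n) be k * (cmap c q 0 k - cmap c p 0 k)))).
    by move=> q _ _; rewrite affine_densE'.
  apply: (smoothM oc).
    apply: (smooth_ext oc (f := fun q => `|(\det (jac e c q))^-1| `^ wt)).
      move=> q cq eq; rewrite dens_transE -(jac_inv eq cq) det_inv//.
    have nz q : cdom c q -> cdom e q -> \det (jac e c q) != 0.
      by move=> cq eq; exact: det_jac_neq0.
    apply: (smooth_abs_powR oc); first by move=> q cq eq; rewrite invr_neq0// nz.
    apply: (smoothV oc) => //; apply: (smooth_det oc) => i j; exact: smooth_jac.
  apply: (smoothD oc); first exact: (smooth_cst oc).
  apply: (smooth_sum oc) => k; apply: (smoothM oc); first exact: (smooth_cst oc).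
  apply: (smoothB oc); last exact: (smooth_cst oc).
  exact: smooth_transition.
by rewrite !affine_densE' (dens_trans_cocycle cq dq eq) dens_transE mulrA.
Qed.

Lemma affine_densE c p al be : cdom c p -> affine_dens c p al be c p = al.
Proof.
move=> cp; rewrite affine_densE' dens_trans_id// mul1r big1 ?addr0// => k _.
by rewrite subrr mulr0.
Qed.

Lemma cder_affine_dens c p al be a : cdom c p ->
  cder c a (affine_dens c p al be c) p = be a.
Proof.
move=> cp.
have dk k : dif c p (fun q => cmap c q 0 k).
  exact: (smooth_dif (@smooth_transition _ _ _ c c k) cp cp).
have dk' k : dif c p (fun q => cmap c q 0 k + - cmap c p 0 k).
  by apply: difD => //; exact: dif_cst.
have dbk k : dif c p (fun q => be k * (cmap c q 0 k - cmap c p 0 k)).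
  by apply: difM => //; exact: dif_cst.
have ds : dif c p (fun q => \sum_(k < n) be k * (cmap c q 0 k - cmap c p 0 k)).
  by apply: dif_sum.
rewrite (@cder_ext _ _ _ c a _ (fun q => al
  + \sum_(k < n) be k * (cmap c q 0 k - cmap c p 0 k)))//; last first.
  have := near_cdom cp; apply: filterS => q cq.
  by rewrite affine_densE' dens_trans_id// mul1r.
rewrite (cderD a (dif_cst c p al) ds) cder_cst add0r cder_sum//.
rewrite -[RHS](sum_deltar be); apply: eq_bigr => k _.
rewrite (cderM a cp (dif_cst c p _) (dk' k)) cder_cst mul0r add0r.
by rewrite (cderD a (dk k) (dif_cst c p _)) cder_cst addr0 cder_coord.
Qed.

End Densities.

(** * Tractors *)

Section TractorLaw.
Variables (R : realType) (n : nat) (M : manifold R n) (g : metric M).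
Implicit Types (c d e : chart M) (p : M) (O : set M) (V : tfield M).

Local Notation wt := (wt R n).

Definition nuv V c p : 'cV[R]_n := \col_b nu V c b p.

(** nu is a vector field and rho a density, both of weight -1. The transition function of weight 1
    therefore stands on the side of d. *)
Definition scale_law V c d p : Prop :=
  jac c d p *m nuv V c p = dens_trans c d p *: nuv V d p /\
  rho g V c p = dens_trans c d p * rho g V d p.

Lemma nabla_dens_affine c d p al be : cdom c p -> cdom d p ->
  \row_e nabla_dens g 1 d e (affine_dens c p al be d) p *m jac c d p
  = dens_trans c d p *: \row_a (be a + wt * christoffel_tr g c a p * al).
Proof.
move=> cp dp; apply/rowP => a; rewrite [LHS]mxE [RHS]mxE [X in _ = _ * X]mxE.
have := nabla_dens_chart cp dp g a (@cdom_open _ _ _ c) (affine_dens_on c p al be) cp.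
rewrite [nabla_dens g 1 c a _ p]/nabla_dens cder_affine_dens// affine_densE// => <-.
by apply: eq_bigr => e _; rewrite mxE mulrC.
Qed.

Lemma pairing_scale_row V s c p : pairing (V c p) s c p
  = (\row_a nabla_dens g 1 c a (s c) p *m nuv V c p) 0 0 + rho g V c p * s c p.
Proof.
rewrite (pairing_scale g) mxE; congr (_ + _); apply: eq_bigr => a _.
by rewrite !mxE mulrC.
Qed.

Lemma tractor_scale_law V c d p : tractor_field V -> cdom c p -> cdom d p ->
  scale_law V c d p.
Proof.
move=> [_ tV] cp dp; have uJ := jac_unit cp dp.
have T al be := tV _ _ (@cdom_open _ _ _ c) (affine_dens_on c p al be) c d p cp cp dp.
have J1 := jac_id cp.
have Sc al be : \row_a nabla_dens g 1 c a (affine_dens c p al be c) p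
   = \row_a (be a + wt * christoffel_tr g c a p * al).
  by have := nabla_dens_affine al be cp cp; rewrite J1 mulmx1 dens_trans_id// scale1r.
have Sd al be := nabla_dens_affine al be cp dp.
have sd al be : affine_dens c p al be d p = dens_trans c d p * al.
  rewrite affine_densE' big1 ?addr0// => k _; by rewrite subrr mulr0.
split.
  apply/colP => b; rewrite [RHS]mxE.
  (* A density that vanishes at p and has row b of J as its derivative there isolates the component
     b of J nu. *)
  have := T 0 (fun a => jac c d p b a).
  rewrite !pairing_scale_row sd affine_densE// !mulr0 !addr0 Sc.
  have := Sd 0 (fun a => jac c d p b a).
  have -> : \row_a (jac c d p b a + wt * christoffel_tr g c a p * 0) = row b (jac c d p).
    by apply/rowP => a; rewrite !mxE mulr0 addr0.
  rewrite rowE scalemxAl => /(can_inj (mulmxK uJ)) ->.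
  rewrite -rowE -row_mul [X in X = _ -> _]mxE => ->.
  by rewrite -scalemxAl mxE -rowE [X in _ * X]mxE.
(* A density with value 1 and zero covariant derivative at p isolates rho. *)
have := T 1 (fun a => - (wt * christoffel_tr g c a p)).
rewrite !pairing_scale_row sd affine_densE// !mulr1 Sc.
have := Sd 1 (fun a => - (wt * christoffel_tr g c a p)).
have -> : \row_a (- (wt * christoffel_tr g c a p) + wt * christoffel_tr g c a p * 1)
    = 0 :> 'rV[R]_n.
  by apply/rowP => a; rewrite !mxE mulr1 addNr.
rewrite scaler0 => E; have -> : \row_e nabla_dens g 1 d e (affine_dens c p 1
    (fun a => - (wt * christoffel_tr g c a p)) d) p = 0.
  by rewrite -[LHS](mulmxK uJ) E mul0mx.
by rewrite !mul0mx mxE !add0r mulrC => ->; rewrite mulrC.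
Qed.

Definition slot (F : tform M) a : tfield M := fun c p => F c p a.

(** The converse direction for 1-forms: in a scale the pairing with a 1-jet is nu contracted with
    nabla s plus rho s, and the weights -1 of the slots cancel the weight 1 of s. *)
Lemma tractor_formP (F : tform M) :
  (forall c a A, smooth_in c setT (fun p => F c p a A)) ->
  (forall c d p a, cdom c p -> cdom d p ->
     jac c d p *m nuv (slot F a) c p
     = dens_trans c d p *: \sum_(m < n) jac c d p m a *: nuv (slot F m) d p /\
     rho g (slot F a) c p
     = dens_trans c d p * \sum_(m < n) jac c d p m a * rho g (slot F m) d p) ->
  tractor_form F.
Proof.
move=> sF lawF; split=> // O s oO ds c d p a Op cp dp.
have [nuE rhoE] := lawF c d p a cp dp.
have [_ sE] := ds; have sdE := sE c d p Op cp dp; rewrite -dens_transE in sdE.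
have y : \row_e nabla_dens g 1 d e (s d) p *m jac c d p
  = dens_trans c d p *: \row_e nabla_dens g 1 c e (s c) p.
  apply/rowP => e; rewrite [LHS]mxE [RHS]mxE [X in _ = _ * X]mxE.
  rewrite -(nabla_dens_chart cp dp g e oO ds Op).
  by apply: eq_bigr => b _; rewrite mxE mulrC.
have t0 : dens_trans c d p != 0 by rewrite gt_eqF// dens_trans_gt0.
apply: (mulfI t0).
have P (l : 'I_n) := pairing_scale_row (slot F l) s.
have -> : pairing (F c p a) s c p = pairing (slot F a c p) s c p by [].
rewrite P mulrDr rhoE.
have -> : dens_trans c d p * (\row_e nabla_dens g 1 c e (s c) p *m nuv (slot F a) c p) 0 0
   = (\row_e nabla_dens g 1 d e (s d) p *m (jac c d p *m nuv (slot F a) c p)) 0 0.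
  by rewrite mulmxA y -scalemxAl [RHS]mxE.
rewrite nuE -scalemxAr [X in X + _]mxE -mulrA -mulrDr; congr (_ * _).
rewrite mulmx_sumr summxE.
have -> : dens_trans c d p * ((\sum_(m < n) jac c d p m a * rho g (slot F m) d p) * s c p)
  = \sum_(m < n) jac c d p m a * (rho g (slot F m) d p * s d p).
  rewrite mulr_suml mulr_sumr; apply: eq_bigr => m _.
  by rewrite sdE; ring.
rewrite -big_split; apply: eq_bigr => m _ /=.
rewrite -/(slot F m d p) P mulrDr; congr (_ + _).
by rewrite -scalemxAr [LHS]mxE.
Qed.

End TractorLaw.

Section SmoothCurvature.
Variables (R : realType) (n : nat) (M : manifold R n) (g : metric M) (c : chart M).

Lemma smoothmxM m1 m2 m3 (A : M -> 'M[R]_(m1, m2)) (B : M -> 'M[R]_(m2, m3)) :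
  smoothmx c setT A -> smoothmx c setT B -> smoothmx c setT (fun p => A p *m B p).
Proof.
move=> sA sB i j; apply: (smooth_ext openT (f := fun p => \sum_k A p i k * B p k j)).
  by move=> p _ _; rewrite mxE.
by apply: (smooth_sum openT) => k; exact: (smoothM openT).
Qed.

Lemma smooth_curv l k : smoothmx c setT (curv g c l k).
Proof.
have sC a : smoothmx c setT (conn g c a) by exact: smooth_conn.
have sD a b : smoothmx c setT (dmx c a (conn g c b)) by exact: (smooth_dmx a openT (sC b)).
have sM a b := smoothmxM (sC a) (sC b).
move=> i j; apply: (smooth_ext openT (f := fun p => dmx c l (conn g c k) p i j
  - dmx c k (conn g c l) p i j + (conn g c l p *m conn g c k p) i j
  - (conn g c k p *m conn g c l p) i j)).
  by move=> p _ _; rewrite /curv [RHS]mxE [X in _ = X + _]mxE [X in _ = X + _ + _]mxE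
    [X in _ = _ + X + _ + _]mxE [X in _ = _ + X]mxE.
apply: (smoothB openT); last exact: sM.
apply: (smoothD openT); last exact: sM.
by apply: (smoothB openT); exact: sD.
Qed.

Lemma smooth_schouten : smoothmx c setT (schouten g c).
Proof.
move=> i j; apply: (smooth_ext openT (f := fun p => (n%:R - 1)^-1
    * \sum_a curv g c a j p a i)).
  by move=> p _ _; rewrite [RHS]mxE ricci_curv.
apply: (smoothM openT); first exact: (smooth_cst openT).
by apply: (smooth_sum openT) => a; exact: smooth_curv.
Qed.

Lemma smooth_phi : smooth_fun (Bfun g) -> smoothmx c setT (phi_of g c).
Proof.
move=> sB i j; apply: (smooth_ext openT (f := fun p => schouten g c p i j
   - Bfun g p * g c p i j)).
  move=> p _ _; rewrite /phi_of; move: (schouten g c p) (g c p) => P G.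
  by rewrite !mxE.
apply: (smoothB openT); first exact: smooth_schouten.
by apply: (smoothM openT); [exact: sB | exact: metric_smooth].
Qed.

End SmoothCurvature.

(** * The normal tractor connection in one scale *)

Section TractorConnection.
Variables (R : realType) (n : nat) (M : manifold R n) (g : metric M).
Implicit Types (c d e : chart M) (p : M) (O : set M) (V W : tfield M).

Local Notation wt := (wt R n).

(* the two slots of the normal tractor derivative in the scale of g *)
Definition conn_nu V c (a b : 'I_n) p : R :=
  nabla_vect g (-1) c a (nu V c) b p + rho g V c p * (b == a)%:R.

Definition conn_rho V c (a : 'I_n) p : R :=
  nabla_dens g (-1) c a (rho g V c) p - \sum_(b < n) schouten g c p a b * nu V c b p.

(** The formula prescribes the two slots; the component [None] is recovered by inverting the
    definition of [rho]. *)
Definition normal_conn V : tform M := fun c p a C =>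
  match C with
  | Some b => conn_nu V c a b p
  | None => conn_rho V c a p
      + \sum_(b < n) 1 / n.+1%:R * christoffel_tr g c b p * conn_nu V c a b p
  end.

Lemma rho_normal_conn V c a p : rho g (slot (normal_conn V) a) c p = conn_rho V c a p.
Proof. by rewrite /rho /slot /= addrK. Qed.

Section Smoothness.
Variables (V : tfield M) (c : chart M).
Hypothesis sV : forall A, smooth_in c setT (fun p => V c p A).

Lemma smooth_rho : smooth_in c setT (rho g V c).
Proof.
apply: (smoothB openT); first exact: sV.
apply: (smooth_sum openT) => a; apply: (smoothM openT); last exact: sV.
by apply: (smoothM openT); [exact: (smooth_cst openT) | exact: smooth_christoffel_tr].
Qed.

Lemma smooth_conn_nu a b : smooth_in c setT (conn_nu V c a b).
Proof.
have sn k : smooth_in c setT (nu V c k) by exact: (sV (Some k)).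
apply: (smoothD openT); last first.
  by apply: (smoothM openT); [exact: smooth_rho | exact: (smooth_cst openT)].
apply: (smoothD openT); last first.
  apply: (smoothM openT); last exact: sn.
  by apply: (smoothM openT); [exact: (smooth_cst openT) | exact: smooth_christoffel_tr].
apply: (smoothD openT); first exact: (smooth_cder openT).
by apply: (smooth_sum openT) => e; apply: (smoothM openT) => //; exact: smooth_christoffel.
Qed.

Lemma smooth_conn_rho a : smooth_in c setT (conn_rho V c a).
Proof.
apply: (smoothB openT); last first.
  apply: (smooth_sum openT) => b; apply: (smoothM openT); last exact: sV.
  exact: smooth_schouten.
apply: (smoothD openT); first exact: (smooth_cder openT _ smooth_rho).
apply: (smoothM openT); last exact: smooth_rho.
by apply: (smoothM openT); [exact: (smooth_cst openT) | exact: smooth_christoffel_tr].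
Qed.

Lemma smooth_normal_conn a A : smooth_in c setT (fun p => normal_conn V c p a A).
Proof.
case: A => [b|]; first exact: smooth_conn_nu.
apply: (smoothD openT); first exact: smooth_conn_rho.
apply: (smooth_sum openT) => b; apply: (smoothM openT); last exact: smooth_conn_nu.
by apply: (smoothM openT); [exact: (smooth_cst openT) | exact: smooth_christoffel_tr].
Qed.

Lemma dif_nuv p : cdom c p -> difmx c p (nuv V c).
Proof.
move=> cp b z; apply: (dif_ext cp (f := fun q => V c q (Some b))).
  by apply: nearW => q; rewrite mxE.
exact: (smooth_dif (sV (Some b)) I cp).
Qed.

Lemma dif_rho p : cdom c p -> dif c p (rho g V c).
Proof. by move=> cp; exact: (smooth_dif smooth_rho I cp). Qed.

End Smoothness.

Lemma nuv_normal_conn V c a p : nuv (slot (normal_conn V) a) c p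
  = dmx c a (nuv V c) p + conn g c a p *m nuv V c p
    - (wt * christoffel_tr g c a p) *: nuv V c p + rho g V c p *: delta_mx a 0.
Proof.
apply/colP => b; rewrite [LHS]mxE.
have X (A B C D : 'cV[R]_n) : (A + B - C + D) b 0 = A b 0 + B b 0 - C b 0 + D b 0.
  by rewrite !mxE.
have Y (A : 'cV[R]_n) (x : R) : (x *: A) b 0 = x * A b 0 by rewrite mxE.
rewrite X !Y dmxE [(_ *m _) b 0]mxE [delta_mx _ _ _ _]mxE eqxx andbT [nuv V c p b 0]mxE.
rewrite /nu /slot /= /conn_nu /nabla_vect /wt.
have -> : cder c a (fun q => nuv V c q b 0) p = cder c a (nu V c b) p.
  by apply: eq_cder => q; rewrite mxE.
have -> : \sum_j conn g c a p b j * nuv V c p j 0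
    = \sum_(e < n) christoffel g c b a e p * nu V c e p.
  by apply: eq_bigr => j _; rewrite connE mxE.
by rewrite !mulNr.
Qed.

Section Covariance.
Variables (V : tfield M).
Hypothesis tV : tractor_field V.

Let sV c A : smooth_in c setT (fun p => V c p A). Proof. by have [+ _] := tV. Qed.

(** Differentiate the laws of nu and rho. The terms with dJ are absorbed by the law of the
    connection matrices, and [log_jac] by the trace terms of weight -1. *)
Lemma normal_conn_law c d p a : cdom c p -> cdom d p ->
  jac c d p *m nuv (slot (normal_conn V) a) c p
  = dens_trans c d p *: \sum_(m < n) jac c d p m a *: nuv (slot (normal_conn V) m) d p /\
  rho g (slot (normal_conn V) a) c p
  = dens_trans c d p * \sum_(m < n) jac c d p m a * rho g (slot (normal_conn V) m) d p.
Proof.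
move=> cp dp; set J := jac c d p; set t := dens_trans c d p.
have [nuE rhoE] := tractor_scale_law g tV cp dp.
have near_law : \forall q \near p, scale_law g V c d q.
  by apply: (near_cdom2 cp dp) => q cq dq; exact: tractor_scale_law.
have dN := dif_nuv (@sV c) cp; have dNd := dif_nuv (@sV d) dp.
have dNdc := difmx_chart cp dp dNd.
have dJ : difmx c p (jac c d) by exact: dif_jac.
have dt := dif_dens_trans cp dp.
set th := log_jac c d p a.
have trE : christoffel_tr g c a p = \sum_(m < n) J m a * christoffel_tr g d m p + th.
  exact: christoffel_tr_chart.
have nuE' : J *m nuv V c p = t *: nuv V d p by [].
have dtE := cder_dens_trans cp dp a.
(* The derivative of J nu_c = t nu_d, where t is the transition function of E(1). *)
have A1 : dmx c a (jac c d) p *m nuv V c p + J *m dmx c a (nuv V c) p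
   = (t * (wt * th)) *: nuv V d p + t *: \sum_(m < n) J m a *: dmx d m (nuv V d) p.
  rewrite -dmxM// (@dmx_ext _ _ _ c p cp _ _ _ _ (fun q => dens_trans c d q *: nuv V d q)).
    rewrite -(dmx_chart a cp dp dNd); apply/colP => b.
    rewrite dmxE [RHS]mxE [X in _ = X + _]mxE [X in _ = _ + X]mxE dmxE.
    rewrite (@eq_cder _ _ _ _ _ _ (fun q => dens_trans c d q * nuv V d q b 0)).
      by rewrite (cderM a cp dt (dNdc b 0)) dtE.
    by move=> q; rewrite mxE.
  by apply: filterS near_law => q [].
split.
  rewrite !nuv_normal_conn.
  have -> : \sum_(m < n) J m a *: nuv (slot (normal_conn V) m) d p
    = \sum_(m < n) J m a *: dmx d m (nuv V d) p + pconn g c d a p *m nuv V d p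
      - (wt * \sum_(m < n) J m a * christoffel_tr g d m p) *: nuv V d p
      + rho g V d p *: \sum_(m < n) J m a *: delta_mx m 0.
    rewrite /pconn mulmx_suml mulr_sumr !scaler_suml scaler_sumr.
    rewrite -big_split -sumrB -big_split; apply: eq_bigr => m _ /=.
    rewrite nuv_normal_conn -scalemxAl !(scalerDr, scalerN) !scalerA.
    by congr (_ + _ - _ *: _ + _ *: _); ring.
  have Jd : J *m delta_mx a 0 = \sum_(m < n) J m a *: delta_mx m (0 : 'I_1).
    rewrite -colE; apply/colP => i; rewrite mxE summxE.
    rewrite -[LHS](sum_deltar (fun m => J m a) i).
    by apply: eq_bigr => m _; rewrite !mxE eqxx andbT eq_sym.
  rewrite !(mulmxDr, mulmxN) -!scalemxAr mulmxA -/J.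
  have -> : J *m conn g c a p = dmx c a (jac c d) p + pconn g c d a p *m J.
    by rewrite conn_chart.
  rewrite mulmxDl -!mulmxA nuE'.
  have -> : J *m dmx c a (nuv V c) p = (t * (wt * th)) *: nuv V d p
     + t *: (\sum_(m < n) J m a *: dmx d m (nuv V d) p) - dmx c a (jac c d) p *m nuv V c p.
    by rewrite -A1 addrC addKr.
  rewrite Jd rhoE trE -scalemxAr.
  move: (\sum_(m < n) J m a *: dmx d m _ p) (\sum_(m < n) J m a *: delta_mx m _) => X Y.
  move: (pconn g c d a p *m nuv V d p) (nuv V d p) (dmx c a (jac c d) p *m _) => U N Z.
  move: (\sum_(m < n) _) => S; rewrite -/t.
  mxring.
rewrite rho_normal_conn.
under eq_bigr => m _ do rewrite rho_normal_conn.
have dr := dif_rho (@sV c) cp; have drd := dif_rho (@sV d) dp.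
have drc := dif_chart cp dp drd.
have -> : conn_rho V c a p = cder c a (rho g V c) p - wt * christoffel_tr g c a p * rho g V c p
    - (schouten g c p *m nuv V c p) a 0.
  rewrite /conn_rho /nabla_dens /wt !mulNr; congr (_ - _ - _).
  by rewrite mxE; apply: eq_bigr => b _; rewrite [nuv _ _ _ _ _]mxE.
have -> : cder c a (rho g V c) p = t * (wt * th) * rho g V d p
    + t * \sum_(m < n) J m a * cder d m (rho g V d) p.
  rewrite (@cder_ext _ _ _ c a _ (fun q => dens_trans c d q * rho g V d q))//.
    by rewrite (cderM a cp dt drc) dtE (cder_chart a cp dp drd).
  by apply: filterS near_law => q [].
have -> : (schouten g c p *m nuv V c p) a 0
    = t * \sum_(m < n) J m a * (schouten g d p *m nuv V d p) m 0.
  rewrite (schouten_chart g cp dp) -!mulmxA nuE -!scalemxAr [LHS]mxE; congr (_ * _).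
  by rewrite mxE; apply: eq_bigr => m _; rewrite [X in X * _]mxE.
rewrite rhoE -/t trE.
have -> : \sum_(m < n) J m a * conn_rho V d m p
   = \sum_(m < n) J m a * cder d m (rho g V d) p
     - wt * (\sum_(m < n) J m a * christoffel_tr g d m p) * rho g V d p
     - \sum_(m < n) J m a * (schouten g d p *m nuv V d p) m 0.
  rewrite mulr_sumr mulr_suml -!sumrB; apply: eq_bigr => m _.
  rewrite /conn_rho /nabla_dens /wt !mulNr [(_ *m _) m 0]mxE.
  have -> : \sum_j schouten g d p m j * nuv V d p j 0
      = \sum_(b < n) schouten g d p m b * nu V d b p.
    by apply: eq_bigr => b _; rewrite [nuv _ _ _ _ _]mxE.
  by ring.
move: (\sum_(m < n) _) (\sum_(m < n) _) (\sum_(m < n) _) => X Y Z.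
ring.
Qed.

Lemma normal_conn_form : tractor_form (normal_conn V).
Proof.
apply: (tractor_formP (g := g)); last by move=> c d p a; exact: normal_conn_law.
by move=> c a A; exact: smooth_normal_conn.
Qed.

End Covariance.

Lemma normal_conn_in_scale : in_scale g 0 normal_conn.
Proof.
move=> V tV c p a cp /=; split; first by [].
by rewrite mul0r addr0; exact: rho_normal_conn.
Qed.

End TractorConnection.

Section ConnectionAxioms.
Variables (R : realType) (n : nat) (M : manifold R n) (g : metric M).
Implicit Types (c d e : chart M) (p : M) (V W : tfield M) (f : M -> R).

Lemma normal_conn_eq V W c p a A : cdom c p ->
  (forall q, cdom c q -> V c q = W c q) ->
  normal_conn g V c p a A = normal_conn g W c p a A.
Proof.
move=> cp VW; have VWp := VW p cp.
have nuE b : nu V c b p = nu W c b p by rewrite /nu VWp.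
have rhoE q : cdom c q -> rho g V c q = rho g W c q by move=> cq; rewrite /rho VW.
have cn b : cder c a (nu V c b) p = cder c a (nu W c b) p.
  by apply: cder_ext => //; apply: filterS (near_cdom cp) => q cq; rewrite /nu VW.
have cr : cder c a (rho g V c) p = cder c a (rho g W c) p.
  by apply: cder_ext => //; apply: filterS (near_cdom cp) => q cq; exact: rhoE.
have nE b : conn_nu g V c a b p = conn_nu g W c a b p.
  rewrite /conn_nu /nabla_vect rhoE// cn nuE; congr (_ + _ + _ + _).
  by apply: eq_bigr => e _; rewrite nuE.
case: A => [b|]; first exact: nE.
rewrite /= /conn_rho /nabla_dens cr rhoE//; congr (_ - _ + _).
  by apply: eq_bigr => b _; rewrite nuE.
by apply: eq_bigr => b _; rewrite nE.
Qed.

Lemma rhoD V W c q :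
  rho g (fun c p A => V c p A + W c p A) c q = rho g V c q + rho g W c q.
Proof.
rewrite /rho; under eq_bigr => a _ do rewrite mulrDr.
by rewrite big_split /=; ring.
Qed.

Lemma rhoZ f V c q : rho g (fun c p A => f p * V c p A) c q = f q * rho g V c q.
Proof.
by rewrite /rho mulrBr mulr_sumr; congr (_ - _); apply: eq_bigr => a _; ring.
Qed.

Section Local.
Variables (V W : tfield M) (f : M -> R) (c : chart M) (p : M) (a : 'I_n).
Hypotheses (cp : cdom c p) (df : dif c p f).
Hypothesis sV : forall A, smooth_in c setT (fun p => V c p A).
Hypothesis sW : forall A, smooth_in c setT (fun p => W c p A).

Lemma normal_connD A : normal_conn g (fun c p A => V c p A + W c p A) c p a A
  = normal_conn g V c p a A + normal_conn g W c p a A.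
Proof.
have dV b : dif c p (nu V c b) by exact: (smooth_dif (sV (Some b)) I cp).
have dW b : dif c p (nu W c b) by exact: (smooth_dif (sW (Some b)) I cp).
have nE b : conn_nu g (fun c p A => V c p A + W c p A) c a b p
    = conn_nu g V c a b p + conn_nu g W c a b p.
  rewrite /conn_nu /nabla_vect rhoD.
  rewrite (_ : nu _ c b = fun q => nu V c b q + nu W c b q)// cderD//.
  under eq_bigr => e _ do rewrite [nu _ c e p](_ : _ = nu V c e p + nu W c e p)// mulrDr.
  by rewrite big_split /=; ring.
case: A => [b|]; first exact: nE.
rewrite /=; under eq_bigr => b _ do rewrite nE mulrDr.
rewrite big_split /= /conn_rho /nabla_dens rhoD.
rewrite (eq_cder _ _ _ (rhoD V W c)) cderD; [|exact: dif_rho|exact: dif_rho].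
have -> : \sum_(b < n) schouten g c p a b * nu (fun c p A => V c p A + W c p A) c b p
   = \sum_(b < n) schouten g c p a b * nu V c b p
     + \sum_(b < n) schouten g c p a b * nu W c b p.
  by rewrite -big_split /=; apply: eq_bigr => b _; rewrite -mulrDr.
by ring.
Qed.

Lemma normal_connZ A : normal_conn g (fun c p A => f p * V c p A) c p a A
  = cder c a f p * V c p A + f p * normal_conn g V c p a A.
Proof.
have dV b : dif c p (nu V c b) by exact: (smooth_dif (sV (Some b)) I cp).
have nE b : conn_nu g (fun c p A => f p * V c p A) c a b p
    = cder c a f p * V c p (Some b) + f p * conn_nu g V c a b p.
  rewrite /conn_nu /nabla_vect rhoZ.
  rewrite (_ : nu _ c b = fun q => f q * nu V c b q)// (cderM a cp df (dV b)).
  have -> : \sum_(e < n) christoffel g c b a e p * nu (fun c p A => f p * V c p A) c e p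
     = f p * \sum_(e < n) christoffel g c b a e p * nu V c e p.
    by rewrite mulr_sumr; apply: eq_bigr => e _; rewrite /nu; ring.
  by rewrite /nu; ring.
case: A => [b|]; first exact: nE.
rewrite /=; under eq_bigr => b _ do rewrite nE mulrDr.
rewrite big_split /= /conn_rho /nabla_dens rhoZ.
rewrite (eq_cder _ _ _ (rhoZ f V c)) (cderM a cp df (dif_rho g sV cp)).
have -> : \sum_(b < n) schouten g c p a b * nu (fun c p A => f p * V c p A) c b p
   = f p * \sum_(b < n) schouten g c p a b * nu V c b p.
  by rewrite mulr_sumr; apply: eq_bigr => e _; rewrite /nu; ring.
(* This is the difference of the component [None] and rho. Added to the Leibniz term of the rho slot
   it yields df times the component [None]. *)
have -> : \sum_(i < n) 1 / n.+1%:R * christoffel_tr g c i p * (cder c a f p * V c p (Some i))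
  = cder c a f p * (V c p None - rho g V c p).
  rewrite /rho opprB addrC subrK mulr_sumr.
  by apply: eq_bigr => b _; ring.
have -> : \sum_(i < n) 1 / n.+1%:R * christoffel_tr g c i p * (f p * conn_nu g V c a i p)
  = f p * \sum_(b < n) 1 / n.+1%:R * christoffel_tr g c b p * conn_nu g V c a b p.
  by rewrite mulr_sumr; apply: eq_bigr => b _; ring.
by ring.
Qed.

End Local.

Lemma normal_conn_connection : tractor_connection (normal_conn g).
Proof.
split=> [V tV|V W tV tW VW c p cp|V W [sV _] [sW _] c p a A cp|f V sf [sV _] c p a A cp].
- exact: normal_conn_form.
- apply/funext => a; apply/funext => A; apply: normal_conn_eq => // q cq.
  exact: VW.
- exact: normal_connD.
- by apply: normal_connZ => //; exact: (smooth_dif (sf c) I cp).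
Qed.

End ConnectionAxioms.

(** * Change of scale within the projective class *)

Section ScaleChange.
Variables (R : realType) (n : nat) (M : manifold R n) (g h : metric M).
Hypothesis n2 : (2 <= n)%N.
Hypothesis projgh : forall c p k, cdom c p ->
  conn h c k p = conn g c k p + upsilon_mx g h c k p.
Implicit Types (c : chart M) (p : M) (V : tfield M).

Local Notation U := (upsilon g h).

Lemma christoffel_tr_proj c a p :
  christoffel_tr h c a p = christoffel_tr g c a p + n.+1%:R * U c p 0 a.
Proof. by rewrite mxE mulVKf ?pnatr_eq0// addrC subrK. Qed.

Lemma christoffel_proj c b a e p : cdom c p -> christoffel h c b a e p
  = christoffel g c b a e p + (b == a)%:R * U c p 0 e + U c p 0 a * (b == e)%:R.
Proof. by move=> cp; rewrite -connE projgh// [LHS]mxE upsilon_mxE connE addrA. Qed.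

Lemma rho_proj V c p : rho h V c p = rho g V c p - \sum_(b < n) U c p 0 b * nu V c b p.
Proof.
rewrite /rho -addrA -opprD -big_split; congr (_ - _); apply: eq_bigr => b _ /=.
rewrite christoffel_tr_proj /nu; field.
by rewrite nat1r pnatr_eq0.
Qed.

(** In the first slot the weight -1 cancels Upsilon_a nu^b, and the remaining Upsilon_c nu^c
    delta^b_a is compensated by the change of rho. In the second slot the derivatives of Upsilon are
    compensated by the change of P. *)
Lemma in_scale_proj (D : tfield M -> tform M) : in_scale g 0 D -> in_scale h 0 D.
Proof.
move=> sD V tV c p a cp; have [] := sD V tV c p a cp; set DaV := fun c p => D V c p a.
rewrite mul0r addr0 => nuE rhoE.
have [sV _] := tV.
have n1 : (n.+1%:R : R) != 0 by rewrite pnatr_eq0.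
pose S1 := \sum_(b < n) U c p 0 b * nu V c b p.
pose G := 1 / n.+1%:R * christoffel_tr g c a p.
have Gh : 1 / n.+1%:R * christoffel_tr h c a p = G + U c p 0 a.
  by rewrite christoffel_tr_proj /G mulrDr; congr (_ + _); rewrite mulrA div1r mulVf// mul1r.
split=> [b|].
  rewrite nuE /nabla_vect (rho_proj V c p) -/S1 !mulNr Gh -/G.
  have -> : \sum_(e < n) christoffel h c b a e p * nu V c e p
     = \sum_(e < n) christoffel g c b a e p * nu V c e p
       + (b == a)%:R * S1 + U c p 0 a * nu V c b p.
    rewrite /S1 mulr_sumr -(sum_delta (fun e => nu V c e p) b) mulr_sumr -!big_split /=.
    by apply: eq_bigr => e _; rewrite christoffel_proj//; ring.
  by ring.
rewrite mul0r addr0 rho_proj rhoE.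
(* S2 and S3 come from the derivative of Upsilon_b nu^b, and S4 from the Christoffel symbols. The
   combination S2 - S4 - Upsilon_a S1 is psi_ab nu^b. *)
pose S2 := \sum_(b < n) dmx c a (U c) p 0 b * nu V c b p.
pose S3 := \sum_(b < n) U c p 0 b * cder c a (nu V c b) p.
pose S4 := \sum_(b < n) (U c p *m conn g c a p) 0 b * nu V c b p.
have -> : \sum_(b < n) U c p 0 b * nu DaV c b p
   = S3 + S4 - G * S1 + rho g V c p * U c p 0 a.
  have -> : S4 = \sum_(b < n) U c p 0 b * \sum_(e < n) christoffel g c b a e p * nu V c e p.
    rewrite /S4; under eq_bigr => b _ do rewrite mxE mulr_suml.
    rewrite exchange_big; apply: eq_bigr => e _; rewrite mulr_sumr.
    by apply: eq_bigr => b _; rewrite connE; ring.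
  rewrite -(sum_deltar (U c p 0) a) /S3 /S1 !mulr_sumr -big_split -sumrB -big_split /=.
  by apply: eq_bigr => b _; rewrite nuE /nabla_vect !mulNr -/G; ring.
have dU b : dif c p (fun q => U c q 0 b).
  exact: (smooth_dif (@smooth_upsilon _ _ _ g h c 0 b) I cp).
have dn b : dif c p (nu V c b) by exact: (smooth_dif (sV c (Some b)) I cp).
have dr : dif c p (rho g V c) by exact: (dif_rho g (sV c) cp).
have dUn b : dif c p (fun q => U c q 0 b * nu V c b q) by exact: difM.
have dS : dif c p (fun q => \sum_(b < n) U c q 0 b * nu V c b q) by exact: dif_sum.
have dS' := difM (dif_cst c p (-1)) dS.
have E : cder c a (rho h V c) p = cder c a (rho g V c) p - (S2 + S3).
  rewrite (@eq_cder _ _ _ _ _ _ (fun q => rho g V c q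
     + (-1) * \sum_(b < n) U c q 0 b * nu V c b q)); last first.
    by move=> q; rewrite rho_proj mulN1r.
  rewrite (cderD a dr dS') (cderM a cp (dif_cst c p _) dS) cder_cst mul0r add0r mulN1r.
  congr (_ - _); rewrite cder_sum// -big_split /=; apply: eq_bigr => b _.
  by rewrite (cderM a cp (dU b) (dn b)) dmxE.
rewrite /nabla_dens E rho_proj -/S1 !mulNr Gh -/G.
have -> : \sum_(b < n) schouten h c p a b * nu V c b p
   = \sum_(b < n) schouten g c p a b * nu V c b p - (S2 - S4 - U c p 0 a * S1).
  rewrite /S2 /S4 /S1 mulr_sumr -!sumrB; apply: eq_bigr => b _.
  rewrite (schouten_proj projgh cp n2) (psi_sym g h cp) /psi; ring.
by ring.
Qed.

End ScaleChange.

(** * Adding a multiple of Phi *)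

Section AddForm.
Variables (R : realType) (n : nat) (M : manifold R n).
Implicit Types (c d : chart M) (p : M) (V : tfield M) (g : metric M).
Variables (D : tfield M -> tform M) (t : R) (phi : chart M -> M -> 'M[R]_n).

Local Notation Dt := (add_form D t (Phi phi)).

Lemma sum_option (f : option 'I_n -> R) : \sum_A f A = f None + \sum_(a < n) f (Some a).
Proof.
rewrite (bigD1 None)//=; congr (_ + _).
rewrite (reindex_omap Some id) => [|[a|]//].
by apply: eq_bigl => a; rewrite /= eqxx.
Qed.

Lemma add_form_Some V c p a b : Dt V c p a (Some b) = D V c p a (Some b).
Proof.
rewrite /add_form big1 ?mulr0 ?addr0// => B _.
by rewrite /Phi /tX mul0r mulr0.
Qed.

Lemma add_form_None V c p a : Dt V c p a None
  = D V c p a None + t * \sum_(b < n) phi c p a b * nu V c b p.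
Proof.
rewrite /add_form; congr (_ + _ * _); rewrite sum_option {1}/Phi big1 => [|b _]; last first.
  by rewrite /tZ mul0r.
rewrite mulr0 mulr0 add0r; apply: eq_bigr => e _; rewrite /Phi /tX mul1r.
rewrite (bigD1 e)//= /tZ eqxx mul1r big1 ?addr0 => [|b be]; first by rewrite mulrC.
by rewrite [_ == _](negbTE _) ?mul0r// eq_sym; apply: contra be => /eqP[->].
Qed.

Lemma rho_add_form g V a c p : rho g (slot (Dt V) a) c p
  = rho g (slot (D V) a) c p + t * \sum_(b < n) phi c p a b * nu V c b p.
Proof.
rewrite /rho /slot add_form_None addrAC; congr (_ - _ + _).
by apply: eq_bigr => b _; rewrite add_form_Some.
Qed.

Lemma add_form_in_scale g : in_scale g 0 D ->
  (forall c p, cdom c p -> phi c p = phi_of g c p) -> in_scale g t Dt.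
Proof.
move=> sD phiE V tV c p a cp; have [nuE rhoE] := sD V tV c p a cp; split=> [b|].
  by rewrite /nu add_form_Some; exact: nuE.
rewrite (rho_add_form g V a c p) phiE//; congr (_ + _).
by rewrite /slot rhoE mul0r addr0.
Qed.

(** The added term is linear over functions, so the Leibniz rule is kept. In the pairing with s it
    contributes t phi_ab nu^b s, where the weights -1 of nu and 1 of s cancel and leave an ordinary
    1-form. *)
Lemma add_form_connection g : tractor_connection D ->
  (forall c p, cdom c p -> phi c p = phi_of g c p) -> smooth_fun (Bfun g) ->
  tractor_connection Dt.
Proof.
move=> [D1 D2 D3 D4] phiE sB.
have smooth_phi' c : smoothmx c setT (phi c).
  move=> i j; apply: (smooth_ext openT (f := fun p => phi_of g c p i j)).
    by move=> p _ cp; rewrite phiE.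
  exact: smooth_phi.
split.
- move=> V tV; have [sDV lDV] := D1 V tV; have [sV _] := tV; split.
    move=> c a [b|].
      apply: (smooth_ext openT (f := fun p => D V c p a (Some b))) => [p _ _|//].
      by rewrite add_form_Some.
    apply: (smooth_ext openT (f := fun p => D V c p a None
      + t * \sum_(b < n) phi c p a b * nu V c b p)).
      by move=> p _ _; rewrite add_form_None.
    apply: (smoothD openT); first exact: sDV.
    apply: (smoothM openT); first exact: (smooth_cst openT).
    apply: (smooth_sum openT) => b; apply: (smoothM openT); first exact: smooth_phi'.
    exact: (sV c (Some b)).
  move=> O s oO ds c d p a Op cp dp.
  have E e q l : pairing (Dt V e q l) s e q = pairing (D V e q l) s e q
      + t * (phi e q *m nuv V e q) l 0 * s e q.
    rewrite !pairing_option add_form_None mulrDl addrAC; congr (_ + _ + _ * _ * _).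
      by apply: eq_bigr => b _; rewrite add_form_Some.
    by rewrite mxE; apply: eq_bigr => b _; rewrite [nuv _ _ _ _ _]mxE.
  rewrite E (lDV O s oO ds c d p a Op cp dp).
  under [RHS]eq_bigr => b _ do rewrite E mulrDr.
  rewrite big_split /=; congr (_ + _).
  have [nuE _] := tractor_scale_law g tV cp dp.
  have phi_chart : phi c p = (jac c d p)^T *m phi d p *m jac c d p.
    rewrite !phiE// /phi_of (schouten_chart g cp dp) (metric_chart g cp dp).
    by rewrite mulmxBr mulmxBl -scalemxAr -scalemxAl.
  have sE : s d p = dens_trans c d p * s c p.
    by have [_ H] := ds; rewrite (H c d p Op cp dp) dens_transE.
  have -> : (phi c p *m nuv V c p) a 0
      = dens_trans c d p * \sum_(b < n) jac c d p b a * (phi d p *m nuv V d p) b 0.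
    rewrite phi_chart -!mulmxA nuE -!scalemxAr [LHS]mxE; congr (_ * _).
    by rewrite mxE; apply: eq_bigr => b _; rewrite [X in X * _]mxE.
  rewrite sE mulr_sumr mulr_sumr mulr_suml; apply: eq_bigr => b _; ring.
- move=> V W tV tW VW c p cp; apply/funext => a; apply/funext => A.
  by rewrite /add_form (D2 V W tV tW VW c p cp) (VW c p cp).
- move=> V W tV tW c p a A cp; rewrite /add_form D3//.
  under eq_bigr => B _ do rewrite mulrDl.
  by rewrite big_split /=; ring.
- move=> f V sf tV c p a A cp; rewrite /add_form D4//.
  have -> : \sum_B f p * V c p B * Phi phi c p A B a = f p * \sum_B V c p B * Phi phi c p A B a.
    by rewrite mulr_sumr; apply: eq_bigr => B _; rewrite mulrA.
  by ring.
Qed.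

Lemma in_scale_unique g (D1 D2 : tfield M -> tform M) :
  in_scale g t D1 -> in_scale g t D2 -> same_connection D1 D2.
Proof.
move=> s1 s2 V tV c p a A cp.
have [nu1 rho1] := s1 V tV c p a cp; have [nu2 rho2] := s2 V tV c p a cp.
have nuE b : D1 V c p a (Some b) = D2 V c p a (Some b).
  exact: etrans (nu1 b) (esym (nu2 b)).
case: A => [b|]; first exact: nuE.
have := etrans rho1 (esym rho2); rewrite /rho.
under eq_bigr => b _ do rewrite nuE.
exact: addIr.
Qed.

End AddForm.

Lemma geodesics_reparam_refl (R : realType) (n : nat) (M : manifold R n) (g : metric M) :
  geodesics_reparam g g.
Proof.
move=> I gamma oI geo; exists I, id; split=> //; split.
  by split=> [x //|x y _ _ //|x Ix]; exists x.
have E : derive1 (id : R -> R) = cst 1.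
  by apply/funext => x; rewrite derive1E; exact: derive_id.
by move=> t It; rewrite E oner_eq0; split => //; exact: derivable_id.
Qed.

Theorem proposition3p21 (R : realType) (n : nat) (M : manifold R n)
  (m : set (metric M)) (hn : (2 <= n)%N)
  (hm : metric_projective_structure m) (hW : weyl_nullity m)
  (hB : forall g : metric M, m g -> smooth_fun (Bfun g)) :
  [/\ exists phi : chart M -> M -> 'M[R]_n, fundamental_tensor m phi,
      exists nablaT : tfield M -> tform M, normal_tractor_connection m nablaT
    & forall (phi : chart M -> M -> 'M[R]_n) (nablaT : tfield M -> tform M),
      fundamental_tensor m phi -> normal_tractor_connection m nablaT ->
      forall t : R,
      let nablaTt := add_form nablaT t (Phi phi) in
      [/\ tractor_connection nablaTt,
          forall g : metric M, m g -> in_scale g t nablaTt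
        & forall (g : metric M) (D : tfield M -> tform M),
          m g -> in_scale g t D -> same_connection D nablaTt]].
Proof.
have [g0 mE] := hm.
have mg0 : m g0 by rewrite mE; split; exact: geodesics_reparam_refl.
have projg0 h : m h -> forall c p k, cdom c p ->
    conn h c k p = conn g0 c k p + upsilon_mx g0 h c k p.
  by rewrite mE => -[g0h _] c p k cp; apply: proj_conn => //; exact: ltnW.
split.
- exists (phi_of g0) => h mh c p cp.
  have [v v0 nv] := hW g0 mg0 c p cp.
  by apply/esym; exact: (phi_proj (projg0 h mh) cp hn v0 nv).
- exists (normal_conn g0); split; first exact: normal_conn_connection.
  by move=> h mh; apply: (in_scale_proj hn (projg0 h mh)); exact: normal_conn_in_scale.
move=> phi nablaT phiE [tT sT] t nablaTt.
have inT g : m g -> in_scale g t nablaTt.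
  by move=> mg; apply: add_form_in_scale (sT g mg) (phiE g mg).
split=> //; first exact: (add_form_connection t tT (phiE g0 mg0) (hB g0 mg0)).
by move=> g D mg sD; exact: in_scale_unique sD (inT g mg).
Qed.
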